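(* Let $f\in \bar{H}^{2,0}\cap C(\mathbb{T})$ and let $n\geq 0$ be an integer. Let $v_0,\dots,v_n$ be an orthonormal family (in $H^2$) of singular vectors of the Hankel operator $\Gamma_f$, where $v_k$ is associated with the singular value $s_k(\Gamma_f)$ for $0\le k\le n$. Define $$M_n(f):=\min\left\{\frac{d_{\infty}(f,H_j^\infty)}{\|v_j\|_{\infty}}:\ 0\leq j\leq n\right\}$$ if $v_j\in H^\infty$ for all $0\leq j\leq n$, and $M_n(f):=0$ otherwise. Then $$\frac{M_n(f)}{\sqrt{n+1}}\leq d_2(f,\mathcal{R}_{n-1,n}).$$
   Context: $\mathbb{D}$ is the open unit disk, $\mathbb{T}$ the unit circle, $C(\mathbb{T})$ the continuous complex functions on $\mathbb{T}$, and $L^p=L^p(\mathbb{T})$ is taken with respect to normalized arclength $d\theta/2\pi$, with norm $\|\cdot\|_p$. $H^2$ (resp. $H^\infty$) is the Hardy space of $\mathbb{D}$, identified via nontangential boundary values with the closed subspace of $L^2$ (resp. $L^\infty$) of functions whose Fourier coefficients of strictly negative index vanish. $\bar{H}^{2,0}$ is the closed subspace of $L^2$ of functions whose Fourier coefficients of non-negative index vanish (boundary values of functions holomorphic in $\mathbb{C}\setminus\overline{\mathbb{D}}$, vanishing at infinity, with square summable Taylor coefficients there); $L^2=H^2\oplus\bar{H}^{2,0}$, and ${\bf P}_-$ is the orthogonal projection of $L^2$ onto $\bar{H}^{2,0}$. $\mathcal{P}_k$ is the space of complex polynomials of degree at most $k$ ($\mathcal{P}_{-1}=\{0\}$). $\mathcal{R}_{m,n}$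 is the set of rational functions $p/q$ with $p\in\mathcal{P}_m$, $q\in\mathcal{P}_n$, $q$ having no root on $\mathbb{T}$. $B_m$ is the set of Blaschke products of degree at most $m$ (unimodular constants included), and $H_m^\infty:=\{g/b:\ g\in H^\infty,\ b\in B_m\}\subset L^\infty$. $d_2(f,E)$ and $d_\infty(f,E)$ are the distances from $f$ to $E$ in $L^2$ and $L^\infty$. For $f\in L^\infty$, the Hankel operator $\Gamma_f:H^2\to\bar{H}^{2,0}$ is $\Gamma_f(v)={\bf P}_-(fv)$; it is compact when $f\in C(\mathbb{T})$. Its $k$-th singular value is $s_k(\Gamma_f)=\inf\{|||\Gamma_f-\Gamma|||:\ \Gamma:H^2\to\bar{H}^{2,0}\text{ linear bounded of rank}\le k\}$, $k=0,1,2,\dots$ ($|||\cdot|||$ is the operator norm). A singular vector associated with a singular value $s$ is a nonzero $v\in H^2$ with $\Gamma_f^*\Gamma_f(v)=s^2v$. *)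

(* Defs.v *)
From HB Require Import structures.
From mathcomp Require Import all_boot all_order all_algebra.
From mathcomp Require Import complex.
From mathcomp Require Import all_classical all_reals all_analysis.

Set Implicit Arguments.
Unset Strict Implicit.
Unset Printing Implicit Defensive.

Import Order.TTheory GRing.Theory Num.Theory.
Import numFieldNormedType.Exports.

Local Open Scope classical_set_scope.
Local Open Scope complex_scope.
Local Open Scope ring_scope.

(* A function on the unit circle is represented by a function [R[i] -> R[i]]
   of which only the values on the circle matter. Elements of L^p are such
   functions (representatives); equality in L^p is [aeT], and every operator
   below is required or shown by its definition to be compatible with it. *)

Section Circle.
Variable R : realType.
Local Notation C := R[i].
Implicit Types (u v w f : C -> C) (p : \bar R).

Lemma twopi_gt0 : 0 < (2 * pi : R).
Proof. by rewrite mulr_gt0 // pi_gt0. Qed.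

Definition expi (t : R) : C := cos t +i* sin t.

Definition circle : set C := [set z | ComplexField.Normc.normc z = 1].

Definition continuousT f : Prop :=
  {within (circle : set C^o), continuous (f : C^o -> C^o)}.

(* dtheta / 2pi on [0, 2pi], transported to the circle through [expi]. *)
Definition arclength : probability (measurableTypeR R) R :=
  uniform_prob twopi_gt0.

Definition aeT u w : Prop :=
  {ae arclength, forall t, u (expi t) = w (expi t)}.

Definition circle_measurable u : Prop :=
  measurable_fun [set: R] (fun t => complex.Re (u (expi t))) /\
  measurable_fun [set: R] (fun t => complex.Im (u (expi t))).

Definition integralT u : C :=
  (\int[arclength]_t complex.Re (u (expi t))) +i*
  (\int[arclength]_t complex.Im (u (expi t))).

Definition normT p u : \bar R :=
  Lnorm arclength p (fun t => (ComplexField.Normc.normc (u (expi t)))%:E).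

Definition LpT p : set (C -> C) :=
  [set u | circle_measurable u /\ (normT p u < +oo)%E].

Definition distT p f (E : set (C -> C)) : \bar R :=
  ereal_inf [set normT p (f \- g) | g in E].

Definition dotT u w : C := integralT (fun z => u z * (w z)^*).

Definition fourier u (k : int) : C := integralT (fun z => u z * z ^ (- k)).

Definition hardy p : set (C -> C) :=
  [set u | LpT p u /\ forall k : int, k < 0 -> fourier u k = 0].

Definition H2 : set (C -> C) := hardy 2%:E.

Definition Hinf : set (C -> C) := hardy +oo%E.

Definition Hbar20 : set (C -> C) :=
  [set u | LpT 2%:E u /\ forall k : int, 0 <= k -> fourier u k = 0].

(* Representative of the orthogonal projection of [u] onto [E]. The set of
   representatives is nonempty if [u] is in L^2 and [E] is a closed subspace;
   it only depends on the class of [u], hence so does the one selected. *)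
Definition orth_proj (E : set (C -> C)) u : C -> C :=
  xget (fun=> 0) [set w | E w /\ forall e, E e -> dotT (u \- w) e = 0].

Definition Pminus : (C -> C) -> (C -> C) := orth_proj Hbar20.

Definition hankel f v : C -> C := Pminus (f \* v).

Definition opnorm (G : (C -> C) -> (C -> C)) : \bar R :=
  ereal_sup [set normT 2%:E (G v) | v in [set v | H2 v /\ (normT 2%:E v <= 1)%E]].

(* Bounded linear operators from H^2 to [Hbar20]. *)
Definition bounded_linear (G : (C -> C) -> (C -> C)) : Prop :=
  [/\ forall v, H2 v -> Hbar20 (G v),
      forall v w, H2 v -> H2 w -> aeT v w -> aeT (G v) (G w),
      forall (a : C) v w, H2 v -> H2 w ->
        aeT (G (fun z => a * v z + w z)) (fun z => a * G v z + G w z) &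
      (opnorm G < +oo)%E].

(* The range of [G] is spanned by [k] elements. *)
Definition rank_le (k : nat) (G : (C -> C) -> (C -> C)) : Prop :=
  exists e : 'I_k -> C -> C, (forall i, Hbar20 (e i)) /\
    forall v, H2 v -> exists c : 'I_k -> C,
      aeT (G v) (fun z => \sum_(i < k) c i * e i z).

Definition singular_value f (k : nat) : \bar R :=
  ereal_inf [set opnorm (fun v => hankel f v \- G v) |
             G in [set G | bounded_linear G /\ rank_le k G]].

(* Representative of the value at [w] of the adjoint of [G], viewed as an
   operator from H^2 to [Hbar20]; it exists by the Riesz theorem if [G] is
   bounded. *)
Definition adjoint (G : (C -> C) -> (C -> C)) w : C -> C :=
  xget (fun=> 0) [set g | H2 g /\ forall u, H2 u -> dotT (G u) w = dotT u g].

Definition singular_vector f (s : R) v : Prop :=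
  [/\ H2 v, ~ aeT v (fun=> 0) &
      aeT (adjoint (hankel f) (hankel f v)) (fun z => (s ^+ 2)%:C * v z)].

Definition orthonormal_family (n : nat) (v : 'I_n -> C -> C) : Prop :=
  forall i j, dotT (v i) (v j) = (i == j)%:R.

(* The degree bound is an integer so as to allow -1, which gives {0};
   recall that [size P] is the degree plus one, and [size 0 = 0]. *)
Definition polys (k : int) : set {poly C} := [set P | (size P)%:Z <= k + 1].

Definition ratfuns (m n : int) : set (C -> C) :=
  [set r | exists P Q : {poly C}, [/\ polys m P, polys n Q,
     forall z, circle z -> ~~ root Q z & r = (fun z => P.[z] / Q.[z])]].

Definition blaschke (m : nat) : set (C -> C) :=
  [set b | exists (c : C) (a : seq C),
    [/\ circle c, (size a <= m)%N,
        forall x, x \in a -> ComplexField.Normc.normc x < 1 &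
        b = (fun z => c * \prod_(x <- a) ((z - x) / (1 - x^* * z)))]].

Definition Hinf_ (m : nat) : set (C -> C) :=
  [set h | exists g b,
    [/\ Hinf g, blaschke m b & h = (fun z => g z / b z)]].

Definition M_ f (n : nat) (v : 'I_n.+1 -> C -> C) : \bar R :=
  if `[< forall j, Hinf (v j) >] then
    \big[Order.min/+oo%E]_(j < n.+1)
      (distT +oo%E f (Hinf_ j) / normT +oo%E (v j))%E
  else 0%E.

End Circle.

(* Main.v *)
Require Import Defs.
From mathcomp Require Import all_boot all_order all_algebra.
From mathcomp Require Import complex.
From mathcomp Require Import all_classical all_reals all_analysis.
From mathcomp Require Import measurable_realfun ess_sup_inf zify ring lra.

Set Implicit Arguments.
Unset Strict Implicit.
Unset Printing Implicit Defensive.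

Import Order.TTheory GRing.Theory Num.Theory.
Import numFieldNormedType.Exports.
Import ComplexField.Normc.

Local Open Scope classical_set_scope.
Local Open Scope complex_scope.
Local Open Scope ring_scope.

(** Let [g = P / Q] have at most [n] poles in the disk. For each of them one
    linear condition on [u] in H^2 is enough for [g u] to be in H^2, so some
    nonzero combination [u] of the [n + 1] singular vectors [v_j], with
    coefficients [c_j], satisfies them all. Let [w] be the same combination of
    the images of the [v_j] under the Hankel operator; these are orthogonal, of
    norms [s_j]. Since [w] is orthogonal to [g u], the scalar product of
    [(f - g) u] and [w] is that of [f u] and [w], which is the squared norm of
    [w]. Hence the sum of the [|c_j|^2 s_j^2] is at most the square of the sum
    of the [|c_j| ||v_j||_oo], times [||f - g||_2^2]: this is
    [rational_combination_bound]. If [a ||v_j||_oo <= s_j] for all [j], the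
    inequality of Cauchy and Schwarz deduces [a <= sqrt (n + 1) ||f - g||_2]
    ([weighted_bound]).

    That [a] may be the minimum of the quotients [d_oo (f, H_j^oo) / ||v_j||_oo]
    is the hard half of the theorem of Adamyan, Arov and Krein: the distance is
    at most [s_j] ([aak_distance]). As distances are infima, [f] can be replaced
    by a trigonometric polynomial [T = F / z^N] with [F(0)] nonzero, whose
    Hankel operator is an invertible [N x N] matrix [H]. Let [s] be its singular
    value of index [k]. A pair of row vectors with [a H = s b^*] and
    [b H = s a^*] yields polynomials [v] and [w] of the same modulus on the
    circle, and [T v] is the sum of a polynomial [p] and of [s (z w)^*]. So
    [T - p / v] has modulus [s] on the circle, and the denominator [Q] of [p / v]
    in lowest terms divides [w] ([schmidt_quotient]). It has at most [k] zeros
    in the disk if [a] vanishes at 0 to the largest possible order: otherwise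
    the functions [z q v / D], with [q] of small degree and [D] the denominator
    of the Blaschke product of these zeros, would produce another eigenvector
    of [H H^*] that vanishes to a larger order ([inner_degree_le]). In the other
    direction, an operator of rank [k] vanishes somewhere on the span of [k + 1]
    singular vectors of [H], so that it is at distance at least
    [s - ||f - T||_oo] from the Hankel operator of [f] ([opnorm_lower]).

    The spaces are defined by Fourier coefficients, so the orthogonality used in
    the first paragraph relies on the density of trigonometric polynomials in
    L^2 ([hardy_orth]). Both this density and the uniform approximation of [f]
    come from the kernel of de la Vallee Poussin ([vp_error]). *)

(** * Modulus of complex numbers *)
Section ComplexModulus.
Variable R : realType.
Local Notation C := R[i].
Local Notation Re := complex.Re.
Local Notation Im := complex.Im.
Implicit Types z w : C.

(** Most estimates are made on the squared modulus, which is polynomial in the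
    real and imaginary parts. *)
Definition sqn z : R := Re z ^+ 2 + Im z ^+ 2.

Lemma sqn_ge0 z : 0 <= sqn z.
Proof. by rewrite addr_ge0 // sqr_ge0. Qed.

Lemma sqnE z : (sqn z)%:C = z * z^*.
Proof.
case: z => a b; rewrite /sqn; simpc => /=.
by congr (_ +i* _); ring.
Qed.

Lemma normcE2 z : normc z = Num.sqrt (sqn z).
Proof. by case: z. Qed.

Lemma normc_sqr z : normc z ^+ 2 = sqn z.
Proof. by rewrite normcE2 sqr_sqrtr // sqn_ge0. Qed.

Lemma normc_ge0 z : 0 <= normc z.
Proof. by rewrite normcE2 sqrtr_ge0. Qed.

Lemma sqnM z w : sqn (z * w) = sqn z * sqn w.
Proof. by rewrite -!normc_sqr normcM exprMn. Qed.

Lemma sqn_conj z : sqn z^* = sqn z.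
Proof. by case: z => a b; rewrite /sqn /= sqrrN. Qed.

Lemma normc_conj z : normc z^* = normc z.
Proof. by rewrite !normcE2 sqn_conj. Qed.

Lemma sqn_eq0 z : (sqn z == 0) = (z == 0).
Proof.
case: z => a b; rewrite /sqn /= paddr_eq0 ?sqr_ge0 // !sqrf_eq0.
by rewrite eq_complex.
Qed.

Lemma sqn0 : sqn 0 = 0.
Proof. by apply/eqP; rewrite sqn_eq0. Qed.

Lemma normc_eq0 z : (normc z == 0) = (z == 0).
Proof. by rewrite -sqn_eq0 -normc_sqr sqrf_eq0. Qed.

Lemma sqn_real (x : R) : sqn x%:C = x ^+ 2.
Proof. by rewrite /sqn /= expr0n addr0. Qed.

Lemma normc_real (x : R) : normc x%:C = `|x|.
Proof. by rewrite normcE2 sqn_real sqrtr_sqr. Qed.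

Lemma normc_Re z : `|Re z| <= normc z.
Proof.
by rewrite normcE2 -sqrtr_sqr ler_wsqrtr // lerDl sqr_ge0.
Qed.

Lemma normc_Im z : `|Im z| <= normc z.
Proof.
by rewrite normcE2 -sqrtr_sqr ler_wsqrtr // lerDr sqr_ge0.
Qed.

Lemma normc_le z : normc z <= `|Re z| + `|Im z|.
Proof.
rewrite -(ler_pXn2r (n := 2)) ?nnegrE ?normc_ge0 ?addr_ge0 //.
rewrite normc_sqr /sqn -[Re z ^+ 2]real_normK ?num_real //.
rewrite -[Im z ^+ 2]real_normK ?num_real //.
have := normr_ge0 (Re z); have := normr_ge0 (Im z).
by move: `|Re z| `|Im z| => x y; nra.
Qed.

Lemma normc_sum (I : Type) (r : seq I) (P : pred I) (F : I -> C) :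
  normc (\sum_(i <- r | P i) F i) <= \sum_(i <- r | P i) normc (F i).
Proof.
elim/big_rec2 : _ => [|i y x _ h]; first by rewrite normc0.
by apply: le_trans (le_normcD _ _) _; rewrite lerD2l.
Qed.

Lemma normcX z n : normc (z ^+ n) = normc z ^+ n.
Proof. by elim: n => [|n IH]; rewrite ?normc1 // !exprS normcM IH. Qed.

Lemma sqnD z w : sqn (z + w) = sqn z + sqn w + 2 * Re (z * w^*).
Proof. by case: z w => a b [c d]; rewrite /sqn /=; ring. Qed.

Lemma Re_amgm z w : `|2 * Re (z * w^*)| <= sqn z + sqn w.
Proof.
case: z w => a b [c d]; rewrite /sqn /= ler_norml.
have := sqr_ge0 (a - c); have := sqr_ge0 (b - d).
have := sqr_ge0 (a + c); have := sqr_ge0 (b + d).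
by move=> h1 h2 h3 h4; apply/andP; split; nra.
Qed.

Lemma reD z w : Re (z + w) = Re z + Re w.
Proof. by case: z w => a b [c d]. Qed.

Lemma imD z w : Im (z + w) = Im z + Im w.
Proof. by case: z w => a b [c d]. Qed.

Lemma reM z w : Re (z * w) = Re z * Re w - Im z * Im w.
Proof. by case: z w => a b [c d]. Qed.

Lemma imM z w : Im (z * w) = Re z * Im w + Im z * Re w.
Proof. by case: z w => a b [c d]. Qed.

Lemma re_conj z : Re z^* = Re z.
Proof. by case: z. Qed.

Lemma im_conj z : Im z^* = - Im z.
Proof. by case: z. Qed.

Lemma reZ (x : R) z : Re (x%:C * z) = x * Re z.
Proof. by case: z => a b /=; rewrite mul0r subr0. Qed.

Lemma reV z : Re z^-1 = Re z * sqn z `^ (- 1).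
Proof. by rewrite powR_inv1 ?sqn_ge0 //; case: z. Qed.

Lemma imV z : Im z^-1 = - Im z * sqn z `^ (- 1).
Proof. by rewrite powR_inv1 ?sqn_ge0 //; case: z => a b /=; rewrite mulNr. Qed.

Lemma complex_eqP z w : Re z = Re w -> Im z = Im w -> z = w.
Proof. by case: z w => a b [c d] /= -> ->. Qed.

End ComplexModulus.

(** * The circle and its angle parametrization *)
Section CircleParam.
Variable R : realType.
Local Notation C := R[i].
Local Notation Re := complex.Re.
Local Notation Im := complex.Im.
Implicit Types (t : R) (z : C).

Lemma normc_expi t : normc (expi t) = 1.
Proof. by rewrite normcE2 /sqn /= cos2Dsin2 sqrtr1. Qed.

Lemma sqn_expi t : sqn (expi t) = 1.
Proof. by rewrite -normc_sqr normc_expi expr1n. Qed.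

Lemma circle_expi t : circle (expi t).
Proof. exact: normc_expi. Qed.

Lemma circle_neq0 z : circle z -> z != 0.
Proof. by rewrite /circle /= => h; rewrite -normc_eq0 h oner_eq0. Qed.

Lemma circle_conj z : circle z -> z^* = z^-1.
Proof.
move=> h; apply: (mulfI (circle_neq0 h)).
by rewrite -sqnE -normc_sqr h expr1n mulfV // circle_neq0.
Qed.

Lemma expi_neq0 t : expi t != 0.
Proof. exact/circle_neq0/circle_expi. Qed.

Lemma expi_conj t : (expi t)^* = (expi t)^-1.
Proof. exact/circle_conj/circle_expi. Qed.

(** The angle is the arc cosine of the real part, up to the sign of the
    imaginary part. *)
Lemma circleP z : circle z -> exists2 t, t \in `[- pi, pi] & z = expi t.
Proof.
rewrite /circle /= => h.
have h1 : sqn z = 1 by rewrite -normc_sqr h expr1n.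
have hre : -1 <= Re z <= 1 by rewrite -ler_norml -h normc_Re.
have hs : Num.sqrt (1 - Re z ^+ 2) = `|Im z|.
  by rewrite -sqrtr_sqr -h1 /sqn addrAC subrr add0r.
have [i0|i0] := leP 0 (Im z).
  exists (acos (Re z)).
    by rewrite in_itv /= acos_lepi // andbT (le_trans _ (acos_ge0 hre)) // oppr_le0 pi_ge0.
  apply: complex_eqP => /=.
    by rewrite acosK // itvE.
  by rewrite sin_acos // hs ger0_norm.
exists (- acos (Re z)).
  by rewrite in_itv /= lerN2 acos_lepi //= (le_trans _ (pi_ge0 R)) // oppr_le0 acos_ge0.
apply: complex_eqP => /=.
  by rewrite cosN acosK // itvE.
by rewrite sinN sin_acos // hs ltr0_norm // opprK.
Qed.

Lemma expi_int t (k : int) : circle (expi t ^ k).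
Proof.
rewrite /circle /=; case: k => k; first by rewrite -exprnP normcX normc_expi expr1n.
by rewrite NegzE -exprnN normcV normcX normc_expi expr1n invr1.
Qed.

End CircleParam.

(** * Measurable functions on the circle *)
Section Measurable.
Variable R : realType.
Local Notation C := R[i].
Local Notation cmeas := (@circle_measurable R).
Implicit Types u w : C -> C.

Lemma cmeas_cst (a : C) : cmeas (fun=> a).
Proof. by split; exact: measurable_cst. Qed.

Lemma cmeas_id : cmeas id.
Proof.
split; apply: continuous_measurable_fun; first exact: continuous_cos.
exact: continuous_sin.
Qed.

Lemma cmeasD u w : cmeas u -> cmeas w -> cmeas (fun z => u z + w z).
Proof.
move=> [u1 u2] [w1 w2]; split.
  under eq_fun do rewrite reD; exact: measurable_funD.
under eq_fun do rewrite imD; exact: measurable_funD.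
Qed.

Lemma cmeasM u w : cmeas u -> cmeas w -> cmeas (fun z => u z * w z).
Proof.
move=> [u1 u2] [w1 w2]; split.
  under eq_fun do rewrite reM.
  by apply: measurable_funB; exact: measurable_funM.
under eq_fun do rewrite imM.
by apply: measurable_funD; exact: measurable_funM.
Qed.

Lemma cmeas_sqn u : cmeas u ->
  measurable_fun [set: R] (fun t => sqn (u (expi t))).
Proof.
by move=> [u1 u2]; apply: measurable_funD; exact: measurable_funX.
Qed.

Lemma cmeas_normc u : cmeas u ->
  measurable_fun [set: R] (fun t => normc (u (expi t))).
Proof.
move=> mu; under eq_fun do rewrite normcE2 -powR12_sqrt ?sqn_ge0 //.
exact: measurableT_comp (measurable_powR _) (cmeas_sqn mu).
Qed.

Lemma cmeas_conj u : cmeas u -> cmeas (fun z => (u z)^*).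
Proof.
move=> [u1 u2]; split; first by under eq_fun do rewrite re_conj.
under eq_fun do rewrite im_conj; exact: measurable_funN.
Qed.

Lemma cmeasV u : cmeas u -> cmeas (fun z => (u z)^-1).
Proof.
move=> mu; have ms := measurableT_comp (measurable_powR (- 1)) (cmeas_sqn mu).
case: mu => u1 u2; split.
  by under eq_fun do rewrite reV; exact: measurable_funM.
under eq_fun do rewrite imV; apply: measurable_funM => //.
exact: measurable_funN.
Qed.

Lemma cmeasX u n : cmeas u -> cmeas (fun z => u z ^+ n).
Proof.
move=> mu; elim: n => [|n IH].
  by under eq_fun do rewrite expr0; exact: cmeas_cst.
by under eq_fun do rewrite exprS; exact: cmeasM.
Qed.

Lemma cmeas_exprz (k : int) : cmeas (fun z => z ^ k).
Proof.
case: k => k; first exact: cmeasX cmeas_id.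
exact/cmeasV/cmeasX/cmeas_id.
Qed.

Lemma cmeas_eq u w : (forall t, u (expi t) = w (expi t)) -> cmeas u -> cmeas w.
Proof. by move=> uw [u1 u2]; split; under eq_fun do rewrite -uw. Qed.

End Measurable.

(** * Integrals, scalar products and norms on the circle *)
Section Integrability.
Variable R : realType.
Local Notation C := R[i].
Local Notation Re := complex.Re.
Local Notation Im := complex.Im.
Local Notation cmeas := (@circle_measurable R).
Local Notation mu := (arclength R).
Implicit Types u w : C -> C.

Definition integrableT (h : R -> R) := mu.-integrable setT (EFin \o h).
Definition L1T u := cmeas u /\ integrableT (fun t => normc (u (expi t))).
Definition L2T u := cmeas u /\ integrableT (fun t => sqn (u (expi t))).
(** The bound holds everywhere, not only almost everywhere: this class serves
    for multipliers given by explicit formulas. *)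
Definition bddT u := cmeas u /\ exists M, forall t, normc (u (expi t)) <= M.
Definition nsq u : R := \int[mu]_t sqn (u (expi t)).

Lemma ae_mono (P Q : R -> Prop) : (forall t, P t -> Q t) ->
  {ae mu, forall t, P t} -> {ae mu, forall t, Q t}.
Proof. by move=> PQ; apply: (@filterS _ _ (ae_filter_ringOfSetsType mu)). Qed.

Lemma ae_and (P Q : R -> Prop) : {ae mu, forall t, P t} ->
  {ae mu, forall t, Q t} -> {ae mu, forall t, P t /\ Q t}.
Proof. by move=> p q; apply: (@filterI _ _ (ae_filter_ringOfSetsType mu)). Qed.

Lemma ae_all (P : R -> Prop) : (forall t, P t) -> {ae mu, forall t, P t}.
Proof.
by move=> p; apply: (@filterE _ _ (ae_filter_ringOfSetsType mu)).
Qed.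

Lemma integrableT_le (g h : R -> R) : measurable_fun setT h ->
  (forall t, `|h t| <= g t) -> integrableT g -> integrableT h.
Proof.
move=> mh hg; apply: le_integrable => //; first exact/measurable_EFinP.
by move=> t _ /=; rewrite lee_fin (le_trans (hg t)) // ler_norm.
Qed.

Lemma integrableT_D (g h : R -> R) : integrableT g -> integrableT h ->
  integrableT (fun t => g t + h t).
Proof. by move=> ig ih; exact: (integrableD measurableT ig ih). Qed.

Lemma integrableT_Z (a : R) (h : R -> R) : integrableT h ->
  integrableT (fun t => a * h t).
Proof. by move=> ih; exact: (integrableZl measurableT a ih). Qed.

Lemma integrableT_cst (a : R) : integrableT (fun=> a).
Proof. exact: finite_measure_integrable_cst. Qed.

Lemma L1T_Re u : L1T u -> integrableT (fun t => Re (u (expi t))).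
Proof.
by move=> [[m1 m2]]; apply: integrableT_le => // t; exact: normc_Re.
Qed.

Lemma L1T_Im u : L1T u -> integrableT (fun t => Im (u (expi t))).
Proof.
by move=> [[m1 m2]]; apply: integrableT_le => // t; exact: normc_Im.
Qed.

Lemma L1TD u w : L1T u -> L1T w -> L1T (fun z => u z + w z).
Proof.
move=> [mu1 iu] [mw iw]; split; first exact: cmeasD.
apply: integrableT_le (integrableT_D iu iw); first exact: cmeas_normc (cmeasD mu1 mw).
by move=> t; rewrite ger0_norm ?normc_ge0 // le_normcD.
Qed.

Lemma L1TM u w : bddT u -> L1T w -> L1T (fun z => u z * w z).
Proof.
move=> [mu1 [M uM]] [mw iw]; split; first exact: cmeasM.
apply: integrableT_le (integrableT_Z M iw); first exact: cmeas_normc (cmeasM mu1 mw).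
by move=> t; rewrite ger0_norm ?normc_ge0 // normcM; apply: ler_wpM2r; rewrite ?normc_ge0.
Qed.

Lemma L1T_conj u : L1T u -> L1T (fun z => (u z)^*).
Proof.
move=> [mu1 iu]; split; first exact: cmeas_conj.
by under [X in integrableT X]eq_fun do rewrite normc_conj.
Qed.

Lemma L1T_bdd u : bddT u -> L1T u.
Proof.
move=> [mu1 [M uM]]; split=> //.
apply: integrableT_le (integrableT_cst M); first exact: cmeas_normc.
by move=> t; rewrite ger0_norm ?normc_ge0.
Qed.

Lemma bddT_cst (a : C) : bddT (fun=> a).
Proof. by split; [exact: cmeas_cst|exists (normc a)]. Qed.

Lemma bddT_exprz (k : int) : bddT (fun z => z ^ k).
Proof.
by split; [exact: cmeas_exprz|exists 1 => t; rewrite (expi_int t k)].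
Qed.

Lemma bddTM u w : bddT u -> bddT w -> bddT (fun z => u z * w z).
Proof.
move=> [mu1 [M uM]] [mw [N wN]]; split; first exact: cmeasM.
by exists (M * N) => t; rewrite normcM ler_pM ?normc_ge0.
Qed.

Lemma bddTD u w : bddT u -> bddT w -> bddT (fun z => u z + w z).
Proof.
move=> [mu1 [M uM]] [mw [N wN]]; split; first exact: cmeasD.
by exists (M + N) => t; rewrite (le_trans (le_normcD _ _)) ?lerD.
Qed.

Lemma bddT_conj u : bddT u -> bddT (fun z => (u z)^*).
Proof.
move=> [mu1 [M uM]]; split; first exact: cmeas_conj.
by exists M => t; rewrite normc_conj.
Qed.

Lemma bddT_sum (I : Type) (r : seq I) (F : I -> C -> C) :
  (forall i, bddT (F i)) -> bddT (fun z => \sum_(i <- r) F i z).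
Proof.
move=> bF; elim: r => [|i r IH].
  by under eq_fun do rewrite big_nil; exact: bddT_cst.
by under eq_fun do rewrite big_cons; exact: bddTD.
Qed.

Lemma bddT_eq u w : (forall t, u (expi t) = w (expi t)) -> bddT u -> bddT w.
Proof.
move=> uw [mu1 [M uM]]; split; first exact: cmeas_eq uw mu1.
by exists M => t; rewrite -uw.
Qed.

Lemma bddT_horner (P : {poly C}) : bddT (fun z => P.[z]).
Proof.
under eq_fun do rewrite horner_coef.
by apply: bddT_sum => i; exact: bddTM (bddT_cst _) (bddT_exprz i).
Qed.

Lemma L1T_eq u w : (forall t, u (expi t) = w (expi t)) -> L1T u -> L1T w.
Proof.
move=> uw [mu1 iu]; split; first exact: cmeas_eq uw mu1.
by under [X in integrableT X]eq_fun do rewrite -uw.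
Qed.

Lemma L2T_eq u w : (forall t, u (expi t) = w (expi t)) -> L2T u -> L2T w.
Proof.
move=> uw [mu1 iu]; split; first exact: cmeas_eq uw mu1.
by under [X in integrableT X]eq_fun do rewrite -uw.
Qed.

Lemma L1TZ (a : C) u : L1T u -> L1T (fun z => a * u z).
Proof. by apply: L1TM; exact: bddT_cst. Qed.

Lemma L1T_sum (I : Type) (r : seq I) (F : I -> C -> C) :
  (forall i, L1T (F i)) -> L1T (fun z => \sum_(i <- r) F i z).
Proof.
move=> bF; elim: r => [|i r IH].
  by under eq_fun do rewrite big_nil; exact/L1T_bdd/bddT_cst.
by under eq_fun do rewrite big_cons; exact: L1TD.
Qed.

Lemma L2T_bdd u : bddT u -> L2T u.
Proof.
move=> [mu1 [M uM]]; split=> //.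
apply: integrableT_le (integrableT_cst (M ^+ 2)); first exact: cmeas_sqn.
move=> t; rewrite ger0_norm ?sqn_ge0 // -normc_sqr.
by rewrite ler_pXn2r ?nnegrE ?normc_ge0 // (le_trans (normc_ge0 _) (uM t)).
Qed.

Lemma L2TD u w : L2T u -> L2T w -> L2T (fun z => u z + w z).
Proof.
move=> [mu1 iu] [mw iw]; split; first exact: cmeasD.
have := integrableT_Z 2 (integrableT_D iu iw).
apply: integrableT_le; first exact: cmeas_sqn (cmeasD mu1 mw).
move=> t; rewrite ger0_norm ?sqn_ge0 // sqnD.
have := Re_amgm (u (expi t)) (w (expi t)).
by rewrite ler_norml => /andP[_ h]; lra.
Qed.

Lemma L2TM u w : bddT u -> L2T w -> L2T (fun z => u z * w z).
Proof.
move=> [mu1 [M uM]] [mw iw]; split; first exact: cmeasM.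
have := integrableT_Z (M ^+ 2) iw.
apply: integrableT_le; first exact: cmeas_sqn (cmeasM mu1 mw).
move=> t; rewrite ger0_norm ?sqn_ge0 // sqnM ler_wpM2r ?sqn_ge0 //.
rewrite -normc_sqr.
by rewrite ler_pXn2r ?nnegrE ?normc_ge0 // (le_trans (normc_ge0 _) (uM t)).
Qed.

Lemma L2TZ (a : C) u : L2T u -> L2T (fun z => a * u z).
Proof. by apply: L2TM; exact: bddT_cst. Qed.

Lemma L2TB u w : L2T u -> L2T w -> L2T (fun z => u z - w z).
Proof.
move=> hu hw; apply: (@L2T_eq (fun z => u z + (-1) * w z)).
  by move=> t; rewrite mulN1r.
by apply: L2TD => //; exact: L2TZ.
Qed.

Lemma L2T_sum (I : Type) (r : seq I) (F : I -> C -> C) :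
  (forall i, L2T (F i)) -> L2T (fun z => \sum_(i <- r) F i z).
Proof.
move=> bF; elim: r => [|i r IH].
  by under eq_fun do rewrite big_nil; exact/L2T_bdd/bddT_cst.
by under eq_fun do rewrite big_cons; exact: L2TD.
Qed.

Lemma L2T_conj u : L2T u -> L2T (fun z => (u z)^*).
Proof.
move=> [mu1 iu]; split; first exact: cmeas_conj.
by under [X in integrableT X]eq_fun do rewrite sqn_conj.
Qed.

Lemma L2TM_L1T u w : L2T u -> L2T w -> L1T (fun z => u z * w z).
Proof.
move=> [mu1 iu] [mw iw]; split; first exact: cmeasM.
apply: integrableT_le (integrableT_D iu iw); first exact: cmeas_normc (cmeasM mu1 mw).
move=> t; rewrite ger0_norm ?normc_ge0 // normcM -!normc_sqr.
move: (normc _) (normc _) => x y.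
by have := sqr_ge0 (x - y); have := sqr_ge0 (x + y); nra.
Qed.

Lemma L2T_L1T u : L2T u -> L1T u.
Proof.
move=> hu; have := L2TM_L1T hu (L2T_bdd (bddT_cst 1)).
by apply: L1T_eq => t; rewrite mulr1.
Qed.

Lemma L2T_dot u w : L2T u -> L2T w -> L1T (fun z => u z * (w z)^*).
Proof. by move=> hu hw; exact: L2TM_L1T hu (L2T_conj hw). Qed.

Lemma integralT_eq u w : (forall t, u (expi t) = w (expi t)) ->
  integralT u = integralT w.
Proof.
by move=> uw; congr (_ +i* _); apply: eq_Rintegral => t _; rewrite uw.
Qed.

Lemma integralTD u w : L1T u -> L1T w ->
  integralT (fun z => u z + w z) = integralT u + integralT w.
Proof.
move=> hu hw; rewrite /integralT; apply: complex_eqP => /=.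
  under eq_Rintegral do rewrite reD.
  by rewrite RintegralD //; exact: L1T_Re.
under eq_Rintegral do rewrite imD.
by rewrite RintegralD //; exact: L1T_Im.
Qed.

Lemma integralTZ (a : C) u : L1T u ->
  integralT (fun z => a * u z) = a * integralT u.
Proof.
move=> hu; have [h1 h2] := (L1T_Re hu, L1T_Im hu).
rewrite /integralT; apply: complex_eqP; rewrite ?reM ?imM /=.
  under eq_Rintegral do rewrite reM.
  by rewrite RintegralB ?RintegralZl //; exact: integrableT_Z.
under eq_Rintegral do rewrite imM.
by rewrite RintegralD ?RintegralZl //; exact: integrableT_Z.
Qed.

Lemma integralT0 : integralT (fun=> 0 : C) = 0.
Proof. by rewrite /integralT /= /Rintegral !integral0. Qed.

Lemma integralT_cst (a : C) : integralT (fun=> a) = a.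
Proof.
apply: complex_eqP => /=; rewrite Rintegral_cst // /=.
  by rewrite probability_setT mulr1.
by rewrite probability_setT mulr1.
Qed.

Lemma integralT_sum (I : Type) (r : seq I) (F : I -> C -> C) :
  (forall i, L1T (F i)) ->
  integralT (fun z => \sum_(i <- r) F i z) = \sum_(i <- r) integralT (F i).
Proof.
move=> hF; elim: r => [|i r IH].
  rewrite big_nil -[RHS]integralT0; apply: integralT_eq => t.
  by rewrite big_nil.
rewrite big_cons -IH -integralTD //; last exact: L1T_sum.
by apply: integralT_eq => t; rewrite big_cons.
Qed.

Lemma integralT_conj u : L1T u ->
  integralT (fun z => (u z)^*) = (integralT u)^*.
Proof.
move=> hu; apply: complex_eqP; rewrite ?re_conj ?im_conj /=.
  by apply: eq_Rintegral => t _; rewrite re_conj.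
under eq_Rintegral do rewrite im_conj -mulN1r.
by rewrite RintegralZl ?mulN1r //; exact: L1T_Im.
Qed.

Lemma integralT_ae u w : cmeas u -> cmeas w -> aeT u w ->
  integralT u = integralT w.
Proof.
move=> [u1 u2] [w1 w2] uw; congr (_ +i* _); rewrite /Rintegral;
  congr fine; apply: ae_eq_integral => //; try exact/measurable_EFinP.
  by apply: ae_mono uw => t /= -> _.
by apply: ae_mono uw => t /= -> _.
Qed.

(** Real and imaginary parts are bounded separately, whence the factor 2. *)
Lemma le_integralT u (g : R -> R) : cmeas u -> integrableT g ->
  (forall t, normc (u (expi t)) <= g t) ->
  normc (integralT u) <= 2 * \int[mu]_t g t.
Proof.
move=> mu1 ig ug.
have iu : L1T u.
  split=> //; apply: integrableT_le ig; first exact: cmeas_normc.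
  by move=> t; rewrite ger0_norm ?normc_ge0.
apply: le_trans (normc_le _) _; rewrite mulr2n mulrDl mul1r; apply: lerD => /=.
  apply: le_trans (le_normr_Rintegral _ _) _ => //; first exact: L1T_Re.
  apply: le_Rintegral => //; last by move=> t _; exact: le_trans (normc_Re _) _.
  apply: integrableT_le ig; last by move=> t; rewrite normr_id (le_trans (normc_Re _)).
  by apply: measurableT_comp => //; case: mu1.
apply: le_trans (le_normr_Rintegral _ _) _ => //; first exact: L1T_Im.
apply: le_Rintegral => //; last by move=> t _; exact: le_trans (normc_Im _) _.
apply: integrableT_le ig; last by move=> t; rewrite normr_id (le_trans (normc_Im _)).
by apply: measurableT_comp => //; case: mu1.
Qed.

Lemma dotT_eq u u' w w' : (forall t, u (expi t) = u' (expi t)) ->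
  (forall t, w (expi t) = w' (expi t)) -> dotT u w = dotT u' w'.
Proof. by move=> hu hw; apply: integralT_eq => t; rewrite hu hw. Qed.

Lemma dotTDl u u' w : L2T u -> L2T u' -> L2T w ->
  dotT (fun z => u z + u' z) w = dotT u w + dotT u' w.
Proof.
move=> hu hu' hw; rewrite /dotT -integralTD; try exact: L2T_dot.
by apply: integralT_eq => t; rewrite mulrDl.
Qed.

Lemma dotTZl (a : C) u w : L2T u -> L2T w ->
  dotT (fun z => a * u z) w = a * dotT u w.
Proof.
move=> hu hw; rewrite /dotT -integralTZ; last exact: L2T_dot.
by apply: integralT_eq => t; rewrite mulrA.
Qed.

Lemma dotTBl u u' w : L2T u -> L2T u' -> L2T w ->
  dotT (fun z => u z - u' z) w = dotT u w - dotT u' w.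
Proof.
move=> hu hu' hw; rewrite -[in RHS]mulN1r -dotTZl // -dotTDl //; last exact: L2TZ.
by apply: dotT_eq => // t; rewrite mulN1r.
Qed.

Lemma dotT_suml (I : Type) (r : seq I) (F : I -> C -> C) w :
  (forall i, L2T (F i)) -> L2T w ->
  dotT (fun z => \sum_(i <- r) F i z) w = \sum_(i <- r) dotT (F i) w.
Proof.
move=> hF hw; rewrite /dotT -integralT_sum; last by move=> i; exact: L2T_dot.
by apply: integralT_eq => t; rewrite mulr_suml.
Qed.

Lemma dotT_conj u w : L2T u -> L2T w -> (dotT u w)^* = dotT w u.
Proof.
move=> hu hw; rewrite /dotT -integralT_conj; last exact: L2T_dot.
by apply: integralT_eq => t; rewrite rmorphM /= conjCK mulrC.
Qed.

Lemma dotT_sumr (I : Type) (r : seq I) (F : I -> C -> C) u :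
  (forall i, L2T (F i)) -> L2T u ->
  dotT u (fun z => \sum_(i <- r) F i z) = \sum_(i <- r) dotT u (F i).
Proof.
move=> hF hu; rewrite -dotT_conj //; last exact: L2T_sum.
rewrite dotT_suml // rmorph_sum; apply: eq_bigr => i _.
by rewrite /= dotT_conj.
Qed.

Lemma dotTZr (a : C) u w : L2T u -> L2T w ->
  dotT u (fun z => a * w z) = a^* * dotT u w.
Proof.
move=> hu hw; rewrite -dotT_conj //; last exact: L2TZ.
by rewrite dotTZl // rmorphM /= dotT_conj.
Qed.

Lemma dotTBr u w w' : L2T u -> L2T w -> L2T w' ->
  dotT u (fun z => w z - w' z) = dotT u w - dotT u w'.
Proof.
move=> hu hw hw'; rewrite -dotT_conj //; last exact: L2TB.
by rewrite dotTBl // rmorphB /= !dotT_conj.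
Qed.

Lemma dotT_nsq u : dotT u u = (nsq u)%:C.
Proof.
apply: complex_eqP => /=.
  by apply: eq_Rintegral => t _; rewrite -sqnE.
under eq_Rintegral do rewrite -sqnE /=.
by rewrite /Rintegral integral0.
Qed.

Lemma nsq_ge0 u : 0 <= nsq u.
Proof. by apply: Rintegral_ge0 => t _; exact: sqn_ge0. Qed.

Lemma nsqZ (a : C) u : L2T u -> nsq (fun z => a * u z) = sqn a * nsq u.
Proof.
move=> [_ hu]; rewrite /nsq -RintegralZl //.
by apply: eq_Rintegral => t _; rewrite sqnM.
Qed.

Lemma nsq_eq u w : (forall t, u (expi t) = w (expi t)) -> nsq u = nsq w.
Proof. by move=> uw; apply: eq_Rintegral => t _; rewrite uw. Qed.

Lemma nsq_eq_sqn u w : (forall t, sqn (u (expi t)) = sqn (w (expi t))) ->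
  nsq u = nsq w.
Proof. by move=> uw; apply: eq_Rintegral => t _; rewrite uw. Qed.

Lemma le_nsq u w : L2T u -> L2T w ->
  (forall t, sqn (u (expi t)) <= sqn (w (expi t))) -> nsq u <= nsq w.
Proof. by move=> [_ hu] [_ hw] h; apply: le_Rintegral => // t _; exact: h. Qed.

Lemma nsqD u w : L2T u -> L2T w ->
  nsq (fun z => u z + w z) = nsq u + nsq w + 2 * Re (dotT u w).
Proof.
move=> hu hw; have [[_ iu] [_ iw]] := (hu, hw).
have h := L1T_Re (L2T_dot hu hw).
rewrite /nsq; under eq_Rintegral do rewrite sqnD.
rewrite RintegralD //; last 2 first.
- exact: integrableT_D.
- exact: integrableT_Z.
by rewrite RintegralD // RintegralZl.
Qed.

Lemma nsqB u w : L2T u -> L2T w ->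
  nsq (fun z => u z - w z) = nsq u + nsq w - 2 * Re (dotT u w).
Proof.
move=> hu hw.
rewrite (@nsq_eq _ (fun z => u z + (-1) * w z)); last by move=> t; rewrite mulN1r.
rewrite nsqD //; last exact: L2TZ.
rewrite nsqZ // dotTZr // rmorphN rmorph1 mulN1r /sqn /=.
by case: (dotT u w) => a b /=; ring.
Qed.

(** The polynomial [nsq (a u - w)] in the real number [a] is nonnegative; it
    is evaluated at its minimum. *)
Lemma CauchySchwarzT u w : L2T u -> L2T w ->
  Re (dotT u w) <= Num.sqrt (nsq u) * Num.sqrt (nsq w).
Proof.
move=> hu hw; set x := Re _.
have [x0|/ltW x0] := leP x 0; first by rewrite (le_trans x0) // mulr_ge0 ?sqrtr_ge0.
rewrite -(ler_pXn2r (n := 2)) ?nnegrE ?mulr_ge0 ?sqrtr_ge0 //.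
rewrite exprMn !sqr_sqrtr ?nsq_ge0 //.
have key (a : R) : 0 <= nsq u * a ^+ 2 + nsq w - 2 * a * x.
  have := nsq_ge0 (fun z => a%:C * u z - w z).
  rewrite nsqB //; last exact: L2TZ.
  by rewrite nsqZ // dotTZl // reZ sqn_real -/x; nra.
have := nsq_ge0 u; rewrite le_eqVlt => /predU1P[u0|u0].
  (* The polynomial is then affine; unless [x = 0] it is negative here. *)
  move: (key ((nsq w + 1) / (2 * x))); rewrite -u0 !mul0r add0r.
  have [->|x1] := eqVneq x 0; first by rewrite expr0n.
  rewrite (_ : 2 * _ * x = nsq w + 1); last by field.
  by move=> ?; exfalso; lra.
have := key (x / nsq u).
rewrite (_ : _ + _ - _ = (nsq u * nsq w - x ^+ 2) / nsq u); last first.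
  by field; rewrite gt_eqF.
by rewrite pmulr_lge0 ?invr_gt0 // subr_ge0.
Qed.

Lemma ae_nsq u w : cmeas u -> cmeas w -> aeT u w -> nsq u = nsq w.
Proof.
move=> hu hw uw; congr fine; apply: ae_eq_integral => //.
- by apply/measurable_EFinP; exact: cmeas_sqn.
- by apply/measurable_EFinP; exact: cmeas_sqn.
- by apply: ae_mono uw => t /= -> _.
Qed.

Lemma normT2E u : L2T u -> normT 2%:E u = (Num.sqrt (nsq u))%:E.
Proof.
move=> [mu1 iu]; rewrite /normT unlock /Lnorm.
rewrite (_ : integral _ _ _ = (nsq u)%:E); last first.
  rewrite /nsq /Rintegral fineK; last exact: integrable_fin_num iu.
  apply: eq_integral => t _ /=.
  by rewrite powR_mulrn ?normr_ge0 // ger0_norm ?normc_ge0 // normc_sqr.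
by rewrite poweR_EFin powR12_sqrt // nsq_ge0.
Qed.

Lemma LpT2P u : LpT 2%:E u <-> L2T u.
Proof.
split=> [[mu1 hu]|hu]; last by split; [case: hu|rewrite normT2E // ltry].
split=> //; apply/integrableP; split; first by apply/measurable_EFinP; exact: cmeas_sqn.
move: hu; rewrite /normT unlock /Lnorm => hu.
rewrite ltey; apply/eqP => h; move: hu.
rewrite (_ : integral _ _ _ = +oo%E); last first.
  rewrite -h; apply: eq_integral => t _ /=.
  rewrite powR_mulrn ?normr_ge0 // ger0_norm ?normc_ge0 // normc_sqr.
  by rewrite ger0_norm // sqn_ge0.
by rewrite poweRyr ?invr_eq0 ?pnatr_eq0.
Qed.

Lemma normTyE u : normT +oo%E u =
  ess_sup mu (fun t => `|(normc (u (expi t)))%:E|%E).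
Proof.
rewrite /normT unlock /Lnorm ifT //.
have h : (0 < mu [set: R])%E by rewrite probability_setT lte01.
exact: h.
Qed.

Lemma normTy_le u (M : R) : {ae mu, forall t, normc (u (expi t)) <= M} ->
  (normT +oo%E u <= M%:E)%E.
Proof.
move=> h; rewrite normTyE; apply/ess_supP; apply: ae_mono h => t h /=.
by rewrite lee_fin ger0_norm ?normc_ge0.
Qed.

Lemma normTy_ge u : (normT +oo%E u < +oo)%E ->
  {ae mu, forall t, normc (u (expi t)) <= fine (normT +oo%E u)}.
Proof.
move=> h; have h0 : (0 <= normT +oo%E u)%E by exact: Lnorm_ge0.
have := ess_sup_ge mu (fun t => `|(normc (u (expi t)))%:E|%E).
apply: ae_mono => t; rewrite -lee_fin fineK ?ge0_fin_numE // normTyE.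
by apply: le_trans; rewrite /= lee_fin ler_norm.
Qed.

End Integrability.

(** * Orthogonality of the exponentials *)
Lemma bernoulli_ge (R : realType) (a : R) n : 0 <= a ->
  1 + n%:R * (a - 1) <= a ^+ n.
Proof.
move=> a0; elim: n => [|n IH]; first by rewrite mul0r addr0 expr0.
rewrite exprS -natr1; have := ler_wpM2l a0 IH; have := ler0n R n.
set c := n%:R => c0 h; have := mulr_ge0 c0 (sqr_ge0 (a - 1)).
by move=> h4; apply: le_trans h; nra.
Qed.

Section Exponentials.
Variable R : realType.
Local Notation C := R[i].
Local Notation Re := complex.Re.
Local Notation Im := complex.Im.
Local Notation mu := (arclength R).

Lemma is_derive_mulc (c x : R) : is_derive x 1 (fun t : R => c * t) c.
Proof.
have h := @is_deriveZ _ _ _ (@id R) c x 1 1 (is_derive_id _ _).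
by apply: is_derive_eq h _; rewrite /GRing.scale /= mulr1.
Qed.

(** The integral against a uniform law is known for nonnegative functions, so
    [f] is shifted by its lower bound [- M]. *)
Lemma Rint_ftc (F f : R -> R) (M : R) :
  (forall x : R, is_derive x 1 F (f x)) -> continuous f ->
  (forall x, - M <= f x) -> integrableT f ->
  \int[mu]_t f t = (F (2 * pi) - F 0) / (2 * pi).
Proof.
move=> dF cf Mf intf.
have h : \int[mu]_t (f t + M) = (F (2 * pi) - F 0) / (2 * pi) + M.
  have mf : measurable_fun [set: R] (fun x => f x + M).
    by apply: measurable_funD => //; exact: continuous_measurable_fun.
  rewrite /Rintegral integral_uniform /=; last 2 first.
  - exact: (proj2 (measurable_EFinP setT (fun x => f x + M)) mf).
  - by move=> x; rewrite lee_fin -lerBlDr sub0r.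
  have dG (x : R) : is_derive x 1 (fun y => F y + M * y) (f x + M).
    exact: is_deriveD (dF x) (is_derive_mulc M x).
  rewrite (@continuous_FTC2 _ _ (fun y => F y + M * y)) ?twopi_gt0 //.
  - rewrite -EFinD -EFinM /= subr0 mulr0 addr0.
    have p0 : pi != 0 :> R by rewrite gt_eqF ?pi_gt0.
    by move: (pi : R) p0 => q q0; field.
  - have cfM : continuous (fun x : R => f x + M).
      by move=> x; apply: continuousD; [exact: cf|exact: cst_continuous].
    exact: (continuous_subspaceT cfM).
  - have dd x : derivable (fun y => F y + M * y) x 1 by case: (dG x).
    have cG x : {for x, continuous (fun y => F y + M * y)}.
      by apply/differentiable_continuous; rewrite -derivable1_diffP.
    by split => //; [apply: cvg_at_right_filter|apply: cvg_at_left_filter];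
       exact: cG.
  - by move=> x _; rewrite derive1E; have [_ ->] := dG x.
rewrite RintegralD // in h; last exact: integrableT_cst.
apply: (addIr M); rewrite -h; congr (_ + _).
by rewrite Rintegral_cst //= probability_setT mulr1.
Qed.

Lemma expiD (s t : R) : expi (s + t) = expi s * expi t.
Proof. by apply: complex_eqP; rewrite ?reM ?imM /= ?cosD ?sinD // addrC [cos s * _]mulrC. Qed.

Lemma expiX (t : R) n : expi t ^+ n = expi (n%:R * t).
Proof.
elim: n => [|n IH].
  by rewrite mul0r /expi cos0 sin0.
by rewrite exprS IH -expiD -natr1 mulrDl mul1r addrC.
Qed.

Lemma cos_sin_nat2pi n : cos (n%:R * (2 * pi)) = 1 :> R /\ sin (n%:R * (2 * pi)) = 0 :> R.
Proof.
have : expi (n%:R * (2 * pi)) = 1 :> C.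
  rewrite -expiX (_ : expi (2 * pi) = 1) ?expr1n //.
  by rewrite /expi mulr_natl cos2pi sin2pi.
by case.
Qed.

Lemma integralT_exprn n : integralT (fun z : C => z ^+ n.+1) = 0.
Proof.
have m0 : n.+1%:R != 0 :> R by rewrite pnatr_eq0.
have cm : continuous (fun t : R => n.+1%:R * t).
  move=> x; apply/differentiable_continuous; rewrite -derivable1_diffP.
  by case: (is_derive_mulc n.+1%:R x).
have b : bddT (fun z : C => z ^+ n.+1) := bddT_exprz R n.+1.
have [h1 h2] := (L1T_Re (L1T_bdd b), L1T_Im (L1T_bdd b)).
have dcos (x : R) : is_derive x 1 (fun t => n.+1%:R^-1 * sin (n.+1%:R * t))
    (Re (expi x ^+ n.+1)).
  rewrite expiX /=.
  have h := @is_deriveZ _ _ _ (fun t : R => sin (n.+1%:R * t)) n.+1%:R^-1 x 1 _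
    (is_derive1_comp (is_derive_sin _) (is_derive_mulc n.+1%:R x)).
  by apply: is_derive_eq h _; rewrite /GRing.scale /= mulrC mulfK.
have dsin (x : R) : is_derive x 1 (fun t => n.+1%:R^-1 * - cos (n.+1%:R * t))
    (Im (expi x ^+ n.+1)).
  rewrite expiX /=.
  have h := @is_deriveZ _ _ _ (fun t : R => - cos (n.+1%:R * t)) n.+1%:R^-1 x 1 _
    (is_deriveN (is_derive1_comp (is_derive_cos _) (is_derive_mulc n.+1%:R x))).
  by apply: is_derive_eq h _; rewrite /GRing.scale /= mulNr opprK mulrC mulfK.
have ccos : continuous (fun x : R => Re (expi x ^+ n.+1)).
  move=> x; under eq_fun do rewrite expiX /=.
  exact: (continuous_comp (cm x) (@continuous_cos _ _)).
have csin : continuous (fun x : R => Im (expi x ^+ n.+1)).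
  move=> x; under eq_fun do rewrite expiX /=.
  exact: (continuous_comp (cm x) (@continuous_sin _ _)).
have [c1 s0] := cos_sin_nat2pi n.+1.
apply: complex_eqP.
  rewrite [LHS](Rint_ftc dcos ccos (M := 1) _ h1) => [|x]; last first.
    by rewrite expiX cos_geN1.
  by rewrite s0 !mulr0 sin0 mulr0 subr0 mul0r.
rewrite [LHS](Rint_ftc dsin csin (M := 1) _ h2) => [|x]; last first.
  by rewrite expiX sin_geN1.
by rewrite c1 !mulr0 cos0 subrr mul0r.
Qed.

Lemma integralT_exprz (k : int) : integralT (fun z : C => z ^ k) = (k == 0)%:R.
Proof.
case: k => [[|n]|n]; first by rewrite -[RHS](integralT_cst (1 : C)).
  by rewrite integralT_exprn.
rewrite -[RHS]conjC0 -(integralT_exprn n) -integralT_conj.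
  apply: integralT_eq => t; rewrite NegzE -exprnN.
  by rewrite rmorphXn /= expi_conj exprVn.
exact: L1T_bdd (bddT_exprz R n.+1).
Qed.

Lemma fourier_exprz (j k : int) : fourier (fun z : C => z ^ j) k = (j == k)%:R.
Proof.
rewrite -subr_eq0 -integralT_exprz; apply: integralT_eq => t.
by rewrite -expfzDr // expi_neq0.
Qed.

End Exponentials.

(** * The space H^1 and division by linear factors *)
Section Hardy1.
Variable R : realType.
Local Notation C := R[i].
Local Notation mu := (arclength R).
Implicit Types u w : C -> C.

Lemma fourier_eq u w k : (forall t, u (expi t) = w (expi t)) ->
  fourier u k = fourier w k.
Proof. by move=> uw; apply: integralT_eq => t; rewrite uw. Qed.

Lemma L1T_exprzM u (k : int) : L1T u -> L1T (fun z => u z * z ^ k).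
Proof.
move=> hu; apply: L1T_eq (L1TM (bddT_exprz R k) hu) => t.
by rewrite mulrC.
Qed.

Lemma fourierD u w k : L1T u -> L1T w ->
  fourier (fun z => u z + w z) k = fourier u k + fourier w k.
Proof.
move=> hu hw; rewrite /fourier -integralTD; try exact: L1T_exprzM.
by apply: integralT_eq => t; rewrite mulrDl.
Qed.

Lemma fourierZ (a : C) u k : L1T u ->
  fourier (fun z => a * u z) k = a * fourier u k.
Proof.
move=> hu; rewrite /fourier -integralTZ; last exact: L1T_exprzM.
by apply: integralT_eq => t; rewrite mulrA.
Qed.

Lemma fourierB u w k : L1T u -> L1T w ->
  fourier (fun z => u z - w z) k = fourier u k - fourier w k.
Proof.
move=> hu hw; rewrite -[in RHS]mulN1r -fourierZ // -fourierD //; last exact: L1TZ.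
by apply: fourier_eq => t; rewrite mulN1r.
Qed.

Lemma fourier_sum (I : Type) (r : seq I) (F : I -> C -> C) k :
  (forall i, L1T (F i)) ->
  fourier (fun z => \sum_(i <- r) F i z) k = \sum_(i <- r) fourier (F i) k.
Proof.
move=> hF; rewrite /fourier -integralT_sum; last by move=> i; exact: L1T_exprzM.
by apply: integralT_eq => t; rewrite mulr_suml.
Qed.

Lemma fourier_exprzM u (j k : int) :
  fourier (fun z => z ^ j * u z) k = fourier u (k - j).
Proof.
apply: integralT_eq => t; rewrite opprB expfzDr ?expi_neq0 //.
by rewrite [RHS]mulrCA mulrA.
Qed.

Lemma fourier_exprnM u (n : nat) (k : int) :
  fourier (fun z => z ^+ n * u z) k = fourier u (k - n%:Z).
Proof. exact: fourier_exprzM u n k. Qed.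

Lemma fourier_dotT u (k : int) : fourier u k = dotT u (fun z => z ^ k).
Proof.
apply: integralT_eq => t; congr (_ * _).
by rewrite rmorphXz ?unitfE ?expi_neq0 //= expi_conj -exprz_inv.
Qed.

(** The Hardy space H^1. *)
Definition hardy1 u := L1T u /\ forall k : int, k < 0 -> fourier u k = 0.

Lemma hardy1_eq u w : (forall t, u (expi t) = w (expi t)) ->
  hardy1 u -> hardy1 w.
Proof.
move=> uw [hu fu]; split; first exact: L1T_eq uw hu.
by move=> k k0; rewrite -(fourier_eq k uw) fu.
Qed.

Lemma hardy1Z (a : C) u : hardy1 u -> hardy1 (fun z => a * u z).
Proof.
move=> [hu fu]; split; first exact: L1TZ.
by move=> k k0; rewrite fourierZ // fu // mulr0.
Qed.

Lemma hardy1_sum (I : Type) (r : seq I) (F : I -> C -> C) :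
  (forall i, hardy1 (F i)) -> hardy1 (fun z => \sum_(i <- r) F i z).
Proof.
move=> hF; split; first by apply: L1T_sum => i; case: (hF i).
move=> k k0; rewrite fourier_sum; last by move=> i; case: (hF i).
by rewrite big1 // => i _; case: (hF i) => _; apply.
Qed.

Lemma hardy1X u n : hardy1 u -> hardy1 (fun z => z ^+ n * u z).
Proof.
move=> [hu fu]; split; first exact: L1TM (bddT_exprz R n) hu.
by move=> k k0; rewrite fourier_exprnM fu // (le_lt_trans _ k0) // gerBl.
Qed.

Lemma hardy1_horner (P : {poly C}) u : hardy1 u -> hardy1 (fun z => P.[z] * u z).
Proof.
move=> hu; apply: (@hardy1_eq (fun z => \sum_(i < size P) P`_i * (z ^+ i * u z))).
  by move=> t; rewrite horner_coef mulr_suml; apply: eq_bigr => i _; rewrite mulrA.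
by apply: hardy1_sum => i; exact/hardy1Z/hardy1X.
Qed.

Lemma hardy1_cst (a : C) : hardy1 (fun=> a).
Proof.
split; first exact/L1T_bdd/bddT_cst.
move=> k k0; apply: (@etrans _ _ (fourier (fun z => a * z ^ 0) k)).
  by apply: fourier_eq => t; rewrite expr0z mulr1.
rewrite fourierZ; last exact: L1T_bdd (bddT_exprz R 0).
by rewrite fourier_exprz eq_sym lt_eqF // mulr0.
Qed.

Lemma hardy1_poly (P : {poly C}) : hardy1 (fun z => P.[z]).
Proof.
by apply: hardy1_eq (hardy1_horner P (hardy1_cst 1)) => t; rewrite mulr1.
Qed.

Lemma bddT_XsubCV (a : C) : normc a != 1 -> bddT (fun z => (z - a)^-1).
Proof.
move=> a1; split; first exact: cmeasV (cmeasD (@cmeas_id R) (cmeas_cst (- a))).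
exists `|1 - normc a|^-1 => t; rewrite normcV lef_pV2 ?posrE.
- have h1 := le_normcD (expi t - a) a.
  have h2 := le_normcD (a - expi t) (expi t).
  rewrite !subrK normc_expi in h1 h2.
  have h3 : normc (a - expi t) = normc (expi t - a) by rewrite -normcN opprB.
  by rewrite ler_norml; apply/andP; split; lra.
- rewrite lt_neqAle normc_ge0 andbT eq_sym normc_eq0 subr_eq0.
  by apply: contra a1 => /eqP <-; rewrite normc_expi.
- by rewrite normr_gt0 subr_eq0 eq_sym.
Qed.

Lemma expi_sub_neq0 (a : C) t : normc a != 1 -> expi t - a != 0.
Proof.
by move=> a1; rewrite subr_eq0; apply: contra a1 => /eqP <-; rewrite normc_expi.
Qed.

(** Multiplying the quotient by [z - a] gives [u], whose negative coefficients
    vanish: hence the negative coefficients of the quotient form a geometric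
    sequence of ratio [a]. *)
Lemma fourier_XsubCV (a : C) u n : normc a != 1 -> hardy1 u ->
  fourier (fun z => (z - a)^-1 * u z) (Negz n) =
  a ^+ n * integralT (fun z => u z * z / (z - a)).
Proof.
move=> a1 [hu fu]; have hw := L1TM (bddT_XsubCV a1) hu.
elim: n => [|n IH].
  rewrite expr0 mul1r; apply: integralT_eq => t.
  by rewrite [RHS]mulrC mulrA.
rewrite exprS -mulrA -IH -fourierZ // -[RHS]add0r -(fu (Negz n)) // -fourierD //.
  rewrite (_ : Negz n.+1 = Negz n - 1%:Z); last first.
    by rewrite !NegzE -[n.+2]addn1 PoszD opprD.
  rewrite -fourier_exprzM; apply: fourier_eq => t; rewrite expr1z.
  have h := expi_sub_neq0 t a1; apply: (mulfI h).
  by rewrite mulrDr [RHS]addrC; field.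
exact: L1TZ.
Qed.

(** The integral is the value of [u] at [a] when [a] is in the disk. *)
Lemma hardy1_div_in (a : C) u : normc a != 1 -> hardy1 u ->
  integralT (fun z => u z * z / (z - a)) = 0 -> hardy1 (fun z => u z / (z - a)).
Proof.
move=> a1 hu h0; apply: (@hardy1_eq (fun z => (z - a)^-1 * u z)).
  by move=> t; rewrite mulrC.
split; first by apply: L1TM; [exact: bddT_XsubCV|case: hu].
by case=> // n _; rewrite fourier_XsubCV // h0 mulr0.
Qed.

(** Outside of the closed disk the condition of [hardy1_div_in] is automatic:
    otherwise the geometric sequence of the negative coefficients would be
    unbounded. *)
Lemma hardy1_div_out (a : C) u : 1 < normc a -> hardy1 u ->
  hardy1 (fun z => u z / (z - a)).
Proof.
move=> a1 hu; have a1' : normc a != 1 by rewrite gt_eqF.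
apply: hardy1_div_in => //; apply/eqP; rewrite -normc_eq0.
set x := integralT _.
have hw := L1TM (bddT_XsubCV a1') (proj1 hu).
have [M hM] : exists M, forall n, normc a ^+ n * normc x <= M.
  exists (2 * \int[mu]_t normc ((expi t - a)^-1 * u (expi t))) => n.
  rewrite -normcX -normcM -fourier_XsubCV //.
  apply: le_integralT; first by case: (L1T_exprzM (- Negz n) hw).
    by case: hw.
  by move=> t; rewrite [leLHS]normcM (expi_int t) mulr1.
rewrite eq_le normc_ge0 andbT leNgt; apply/negP => x0.
have M0 : 0 <= M by apply: le_trans (hM 0%N); rewrite expr0 mul1r ltW.
(* By Bernoulli's inequality the power of index [n.+1] exceeds the bound. *)
pose n := Num.truncn (M / (normc x * (normc a - 1))).
have h1 := hM n.+1; have h2 := bernoulli_ge n.+1 (normc_ge0 a).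
have h3 : M / (normc x * (normc a - 1)) < n.+1%:R by exact: truncnS_gt.
move: h3; rewrite ltr_pdivrMr; last by rewrite mulr_gt0 ?subr_gt0.
move: h1 h2; set c := n.+1%:R; set y := _ ^+ _ => h1 h2 h3.
have := ler_wpM2r (ltW x0) h2; nra.
Qed.

(** The division is made one factor at a time, and the condition of index [i]
    is that of [hardy1_div_in] for the quotient by the previous factors. *)
Lemma hardy1_div_disk (s : seq C) u :
  (forall a, a \in s -> normc a != 1) -> hardy1 u ->
  (forall i, (i < size s)%N ->
     integralT (fun z => u z * z / \prod_(a <- take i.+1 s) (z - a)) = 0) ->
  hardy1 (fun z => u z / \prod_(a <- s) (z - a)).
Proof.
elim/last_ind: s => [|s a IH] hs hu h0.
  by apply: hardy1_eq hu => t; rewrite big_nil divr1.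
have hv : hardy1 (fun z => u z / \prod_(a <- s) (z - a)).
  apply: IH => // [b bs|i i_s]; first by rewrite hs // mem_rcons inE bs orbT.
  rewrite -(h0 i); last by rewrite size_rcons ltnW.
  by rewrite -cats1 takel_cat.
apply: hardy1_eq (hardy1_div_in _ hv _) => [t||].
- by rewrite big_rcons /= invfM mulrA.
- by rewrite hs // mem_rcons inE eqxx.
rewrite -(h0 (size s)) ?size_rcons // take_oversize ?size_rcons //.
apply: integralT_eq => t; rewrite big_rcons /= invfM.
by rewrite mulrA; congr (_ * _); rewrite mulrAC.
Qed.

Lemma hardy1_div_outer (s : seq C) u :
  (forall a, a \in s -> 1 < normc a) -> hardy1 u ->
  hardy1 (fun z => u z / \prod_(a <- s) (z - a)).
Proof.
elim: s => [|a s IH] hs hu.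
  by apply: hardy1_eq hu => t; rewrite big_nil divr1.
have hv : hardy1 (fun z => u z / \prod_(a <- s) (z - a)).
  by apply: IH => // b bs; rewrite hs // inE bs orbT.
apply: hardy1_eq (hardy1_div_out _ hv) => [t|].
  by rewrite big_cons invfM mulrA mulrAC.
by rewrite hs // inE eqxx.
Qed.

Lemma bddT_prod_XsubCV (s : seq C) : (forall a, a \in s -> normc a != 1) ->
  bddT (fun z => (\prod_(a <- s) (z - a))^-1).
Proof.
elim: s => [|a s IH] hs.
  by apply: bddT_eq (bddT_cst 1) => t; rewrite big_nil invr1.
apply: bddT_eq (bddTM (bddT_XsubCV (hs a _)) (IH _)) => [t||b bs].
- by rewrite big_cons invfM.
- by rewrite inE eqxx.
- by rewrite hs // inE bs orbT.
Qed.

End Hardy1.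

(** * Continuous functions on the circle *)
Section Continuity.
Variable R : realType.
Local Notation C := R[i].
Implicit Types f : C -> C.

Lemma continuousT_at f (z0 : C) (e : R) : continuousT f -> circle z0 -> 0 < e ->
  exists2 d : R, 0 < d & forall z, circle z -> normc (z - z0) < d ->
    normc (f z - f z0) < e.
Proof.
move=> /subspace_continuousP cf cz0 e0.
have /cvgrPdist_lt /(_ e%:C) := cf z0 cz0.
rewrite ltcR => /(_ e0).
rewrite /within /= => /nbhs_ballP[d /= d0 hd].
(* Radii of balls are positive elements of C, hence real. *)
have [dr dE] : exists dr : R, d = dr%:C by apply/complex_realP; exact: gtr0_real.
exists dr; first by rewrite -ltcR -dE.
move=> z cz hz; have := hd z _ cz; rewrite /ball /=.
move=> /(_ _)/wrap[|].
  by rewrite dE -normrN opprB -[`|_|]/((normc (z - z0))%:C) ltcR.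
by rewrite -normrN opprB -[`|_|]/((normc (f z - f z0))%:C) ltcR.
Qed.

Lemma expi_near (t e : R) : 0 < e -> \forall s \near t, normc (expi s - expi t) < e.
Proof.
move=> e0; have e2 : 0 < e / 2 by rewrite divr_gt0.
have /cvgrPdist_lt /(_ _ e2) c := @continuous_cos R t.
have /cvgrPdist_lt /(_ _ e2) s := @continuous_sin R t.
near=> x; apply: le_lt_trans (normc_le _) _.
rewrite [ltRHS]splitr /= ltrD //.
  by rewrite distrC; near: x.
by rewrite distrC; near: x.
Unshelve. all: by end_near. Qed.

(** The circle is the image of the compact interval of angles from [- pi] to
    [pi]. *)
Lemma unif_continuousT f (e : R) : continuousT f -> 0 < e ->
  exists2 d : R, 0 < d & forall z w, circle z -> circle w ->
    normc (z - w) < d -> normc (f z - f w) < e.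
Proof.
move=> cf e0.
have e2 : 0 < e / 2 by rewrite divr_gt0.
pose P (d t : R) := forall z, circle z -> normc (z - expi t) < d ->
  normc (f z - f (expi t)) < e.
have : \forall d \near 0^'+, `[- pi, pi] `<=` P d.
  have /compact_near_coveringP := @segment_compact R (- pi) pi.
  apply => t _; have [d d0 hd] := continuousT_at cf (circle_expi t) e2.
  have d2 : 0 < d / 2 by rewrite divr_gt0.
  near=> s i => z cz zs.
  have st : normc (expi s - expi t) < d / 2 by near: s; exact: expi_near.
  have i2 : i < d / 2 by near: i; exact: nbhs_right_lt.
  have h1 : normc (f z - f (expi t)) < e / 2.
    apply: hd => //; rewrite -[z](subrK (expi s)) -addrA.
    apply: le_lt_trans (le_normcD _ _) _.
    by rewrite [ltRHS]splitr ltrD // (lt_trans zs).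
  have h2 : normc (f (expi s) - f (expi t)) < e / 2.
    by apply: hd; [exact: circle_expi|apply: lt_trans st _; lra].
  rewrite -[f z](subrK (f (expi t))) -addrA.
  apply: le_lt_trans (le_normcD _ _) _.
  by rewrite -[normc (f (expi t) - _)]normcN opprB [ltRHS]splitr ltrD.
move=> h; have [d [d0 hd]] : exists d : R, 0 < d /\ `[- pi, pi] `<=` P d.
  near ((0:R)^'+) => d; exists d; split; first by near: d; exact: nbhs_right_gt.
  by near: d.
exists d => // z w cz cw; have [t tpi ->] := circleP cw.
by apply: hd.
Unshelve. all: by end_near. Qed.

Lemma bounded_continuousT f : continuousT f ->
  exists2 M : R, 0 <= M & forall z, circle z -> normc (f z) <= M.
Proof.
move=> cf; have [d d0 hd] := unif_continuousT cf ltr01.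
have cg : continuous (fun t : R => normc (f (expi t))).
  move=> t; apply/cvgrPdist_lt => e e0.
  have [d' d'0 hd'] := unif_continuousT cf e0.
  near=> s; have : normc (expi s - expi t) < d' by near: s; exact: expi_near.
  move/(hd' _ _ (circle_expi s) (circle_expi t)); apply: le_lt_trans.
  have h1 := le_normcD (f (expi s) - f (expi t)) (f (expi t)).
  have h2 := le_normcD (f (expi t) - f (expi s)) (f (expi s)).
  rewrite !subrK in h1 h2.
  rewrite -[normc (f (expi t) - _)]normcN opprB in h2.
  by rewrite ler_norml; apply/andP; split; lra.
have [|c _ hc] := @EVT_max R _ (- pi) pi _ (continuous_subspaceT cg).
  by have := pi_ge0 R; lra.
exists (normc (f (expi c))); first exact: normc_ge0.
by move=> z cz; have [t tpi ->] := circleP cz; exact: hc.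
Unshelve. all: by end_near. Qed.

End Continuity.

(** * The kernel of de la Vallee Poussin *)
Section Kernel.
Variable R : realType.
Local Notation C := R[i].
Local Notation Re := complex.Re.
Local Notation mu := (arclength R).
Implicit Types (H : C -> C) (z w : C).

(** The central coefficient is the largest of the [2 n + 1] terms of the
    expansion of [(1 + 1) ^ (2 n)]. *)
Lemma central_bin_ge n : (4 ^ n <= (n + n).+1 * 'C(n + n, n))%N.
Proof.
elim: n => // n IH.
have e1 : (n.+1 * 'C((n.+1 + n.+1), n.+1) = (n + n).+2 * 'C((n + n).+1, n))%N.
  by rewrite addnS addSn -mul_bin_diag.
have e2 : (n.+1 * 'C((n + n).+1, n) = (n + n).+1 * 'C(n + n, n))%N.
  by have := mul_bin_down (n + n).+1 n; rewrite /= subSn ?leq_addr // addnK => ->.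
rewrite -(leq_pmul2l (ltn0Sn n)) -(leq_pmul2l (ltn0Sn n)) expnS.
move: e1 e2 IH; rewrite addnS addSn.
move: 'C(_, _) 'C(_, _) 'C(_, _) (4 ^ n)%N => x y c q e1 e2 IH.
nia.
Qed.

Definition vp_coef n (i : nat) : C := 'C(n + n, i)%:R / 'C(n + n, n)%:R.

(** The kernel of de la Vallee Poussin, which on the circle is [|z + w| ^ (2
    n) / 'C(2 n, n)]. It is nonnegative, has an explicit expansion and
    concentrates around [w = z]. *)
Definition vp_ker n z w : C :=
  'C(n + n, n)%:R^-1 * ((z + w) ^+ (n + n) / (z ^+ n * w ^+ n)).

Lemma vp_ker_real n z w : circle z -> circle w ->
  vp_ker n z w = (sqn (z + w) ^+ n / 'C(n + n, n)%:R)%:C.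
Proof.
move=> cz cw; have [z0 w0] := (circle_neq0 cz, circle_neq0 cw).
rewrite rmorphM rmorphXn /= fmorphV /= rmorph_nat mulrC /vp_ker; congr (_ * _).
rewrite sqnE rmorphD /= (circle_conj cz) (circle_conj cw).
rewrite exprD -[(z + w) ^+ n * _]exprMn -[z ^+ n * _]exprMn -exprVn -exprMn.
congr (_ ^+ _).
by field; rewrite z0 w0.
Qed.

Lemma exprz_sub2n n i z : (i <= n + n)%N -> z != 0 ->
  z ^ (n%:Z - i%:Z) = z ^+ (n + n - i) / z ^+ n.
Proof.
move=> i2n z0; rewrite exprnN exprnP -expfzDr // -subzn // PoszD.
by congr (z ^ _); rewrite addrAC addrK.
Qed.

Lemma vp_ker_expand n z w : circle z -> circle w ->
  vp_ker n z w = \sum_(i < (n + n).+1)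
    (vp_coef n i * z ^ (n%:Z - i%:Z)) * w ^ (i%:Z - n%:Z).
Proof.
move=> cz cw; have [z0 w0] := (circle_neq0 cz, circle_neq0 cw).
rewrite /vp_ker exprDn mulr_suml mulr_sumr; apply: eq_bigr => i _.
have i2n : (i <= n + n)%N by rewrite -ltnS.
rewrite /vp_coef -[(_ * _) *+ _]mulr_natl.
rewrite exprz_sub2n //.
have -> : w ^ (i%:Z - n%:Z) = w ^+ i / w ^+ n by rewrite expfzDr // exprnN.
rewrite [(z ^+ n * w ^+ n)^-1]invfM; move: (z ^+ n)^-1 (w ^+ n)^-1 (z ^+ (n + n - i)) (w ^+ i).
move: ('C(n + n, n)%:R^-1 : C) ('C(n + n, i)%:R : C) => c d a b x y; ring.
Qed.

(** The numerator, over [z ^+ n], of the convolution of [H] with the kernel. *)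
Definition vp_poly n H : {poly C} :=
  \sum_(i < (n + n).+1)
    (vp_coef n i * fourier H (n%:Z - i%:Z)) *: 'X^(n + n - i).

Lemma vp_polyE n H z : L1T H -> circle z ->
  (vp_poly n H).[z] / z ^+ n = integralT (fun w => H w * vp_ker n z w).
Proof.
move=> hH cz; have z0 := circle_neq0 cz.
transitivity (integralT (fun w => \sum_(i < (n + n).+1)
   (vp_coef n i * z ^ (n%:Z - i%:Z)) * (H w * w ^ (i%:Z - n%:Z)))).
  rewrite integralT_sum => [|i]; last by apply: L1TZ; exact: L1T_exprzM.
  rewrite horner_sum mulr_suml; apply: eq_bigr => i _.
  rewrite integralTZ; last exact: L1T_exprzM.
  have i2n : (i <= n + n)%N by rewrite -ltnS.
  rewrite hornerZ hornerXn exprz_sub2n // -[in RHS](opprB n%:Z) -/(fourier H _).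
  move: (vp_coef n i) (fourier H _) (z ^+ (n + n - i)) (z ^+ n)^-1 => a b x y.
  ring.
apply: integralT_eq => t.
rewrite [in RHS](vp_ker_expand n cz (circle_expi t)) mulr_sumr.
by apply: eq_bigr => i _; rewrite mulrCA.
Qed.

Lemma vp_poly1 n z : circle z ->
  integralT (fun w => vp_ker n z w) = 1.
Proof.
move=> cz; have z0 := circle_neq0 cz.
have h1 : L1T (fun=> 1 : C) by exact/L1T_bdd/bddT_cst.
rewrite (@integralT_eq _ _ (fun w => 1 * vp_ker n z w)); last by move=> t; rewrite mul1r.
rewrite -vp_polyE // /vp_poly (bigD1 (inord n : 'I_(n + n).+1)) //= big1 => [|i hi].
  rewrite addr0 inordK ?ltnS ?leq_addr // subrr addnK hornerZ hornerXn.
  rewrite (_ : fourier _ 0 = 1).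
    by rewrite mulr1 mulfK ?expf_neq0 // /vp_coef divff // pnatr_eq0 -lt0n bin_gt0 leq_addr.
  rewrite -[RHS](integralT_cst (1 : C)); apply: integralT_eq => t.
  by rewrite oppr0 expr0z mulr1.
rewrite (_ : fourier _ _ = 0) ?mulr0 ?scale0r //.
rewrite (@fourier_eq _ _ (fun z => z ^ 0)); last by move=> t; rewrite expr0z.
rewrite fourier_exprz eq_sym subr_eq0; case: eqP => // -[ni]; case/eqP: hi.
by apply: val_inj; rewrite /= inordK // ltnS leq_addr.
Qed.

Lemma bddT_vp_ker n z : circle z -> bddT (fun w => vp_ker n z w).
Proof.
move=> cz.
apply: (@bddT_eq _ (fun w => \sum_(i < (n + n).+1)
    (vp_coef n i * z ^ (n%:Z - i%:Z)) * w ^ (i%:Z - n%:Z))).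
  by move=> t; rewrite (vp_ker_expand n cz (circle_expi t)).
apply: bddT_sum => i; apply: bddTM; first exact: bddT_cst.
exact: bddT_exprz.
Qed.

(** A bound for the kernel at distance [d]: the quotient of [4 ^ n] by the
    central binomial coefficient is at most [2 n + 1]. *)
Definition vp_rate (d : R) n : R := (n + n).+1%:R * (1 - d ^+ 2 / 4) ^+ n.

(** Near [z] the oscillation of [H] is at most [e]. Away from [z] the kernel
    is at most [vp_rate d n], because |z + w|^2 = 4 - |z - w|^2. The outer
    factor 2 is that of [le_integralT]. *)
Lemma vp_error n H z (M e d : R) : bddT H -> circle z ->
  (forall w, circle w -> normc (H w) <= M) -> 0 <= e -> 0 < d -> d <= 2 ->
  (forall w, circle w -> normc (w - z) < d -> normc (H w - H z) <= e) ->
  normc ((vp_poly n H).[z] / z ^+ n - H z) <=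
    2 * (e + 2 * M * vp_rate d n).
Proof.
move=> bH cz hM e0 d0 d2 hd.
have bk := bddT_vp_ker n cz.
have M0 : 0 <= M by apply: le_trans (hM z cz); exact: normc_ge0.
have b0 : 0 < 'C(n + n, n)%:R :> R by rewrite ltr0n bin_gt0 leq_addr.
rewrite vp_polyE //; last exact: L1T_bdd.
rewrite -[X in _ - X]mulr1 -(vp_poly1 n cz) -mulN1r mulrA -integralTZ; last exact: L1T_bdd.
rewrite -integralTD; last 2 first.
- by apply: L1T_bdd; exact: bddTM.
- by apply: L1TZ; exact: L1T_bdd.
pose k t := Re (vp_ker n z (expi t)).
have kE t : vp_ker n z (expi t) = (k t)%:C.
  by rewrite /k (vp_ker_real n cz (circle_expi t)).
have k0 t : 0 <= k t.
  rewrite /k (vp_ker_real n cz (circle_expi t)) /=.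
  by rewrite divr_ge0 ?exprn_ge0 ?sqn_ge0 // ltW.
have ik : integrableT k by exact: L1T_Re (L1T_bdd bk).
have k1 : \int[mu]_t k t = 1.
  by have := vp_poly1 n cz; rewrite /integralT => -[].
have rate0 : 0 <= vp_rate d n.
  rewrite mulr_ge0 // exprn_ge0 //; nra.
have -> : e + 2 * M * vp_rate d n =
    \int[mu]_t (e * k t + 2 * M * vp_rate d n).
  rewrite RintegralD //; last 2 first.
  - exact: integrableT_Z.
  - exact: integrableT_cst.
  rewrite RintegralZl // k1 mulr1; congr (_ + _).
  by rewrite Rintegral_cst //= probability_setT mulr1.
apply: le_integralT.
- apply: cmeasD; first by case: (bddTM bH bk).
  by case: (bddTM (bddT_cst (-1 * H z)) bk).
- by apply: integrableT_D; [exact: integrableT_Z|exact: integrableT_cst].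
move=> t; rewrite mulN1r -mulrDl normcM kE normc_real (ger0_norm (k0 t)).
have ct := circle_expi t.
have [near|far] := ltP (normc (expi t - z)) d.
  rewrite (le_trans (ler_wpM2r (k0 t) (hd _ ct near))) // lerDl.
  by apply: mulr_ge0 => //; apply: mulr_ge0.
apply: (@le_trans _ _ (2 * M * vp_rate d n)); last by rewrite lerDr mulr_ge0.
apply: ler_pM => //; first exact: normc_ge0.
  rewrite (le_trans (le_normcD _ _)) // normcN mulr2n mulrDl mul1r lerD ?hM //.
rewrite /k (vp_ker_real n cz (circle_expi t)) /=.
have par : sqn (z + expi t) = 4 - sqn (expi t - z).
  have := sqnD z (expi t); have := sqnD (expi t) (- z).
  have -> : sqn (- z) = sqn z by rewrite /sqn; case: (z) => a b /=; rewrite !sqrrN.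
  rewrite sqn_expi -[sqn z]normc_sqr cz.
  have -> : Re (expi t * (- z)^*) = - Re (z * (expi t)^*).
    by move: (expi t) => -[c x]; case: (z) => a b /=; ring.
  by move=> -> ->; rewrite expr1n; ring.
have far2 : sqn (z + expi t) <= 4 * (1 - d ^+ 2 / 4).
  rewrite par -normc_sqr mulrBr mulr1 mulrCA mulfV // mulr1 lerD2l lerN2.
  by rewrite ler_pXn2r // nnegrE ?normc_ge0 // ltW.
rewrite ler_pdivrMr // /vp_rate mulrAC.
apply: (@le_trans _ _ ((4 * (1 - d ^+ 2 / 4)) ^+ n)).
  rewrite lerXn2r ?nnegrE ?sqn_ge0 //.
  by apply: le_trans far2; exact: sqn_ge0.
rewrite exprMn ler_wpM2r //; first by rewrite exprn_ge0 //; nra.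
by rewrite -natrM -natrX ler_nat central_bin_ge.
Qed.

(** The ratio is written [s ^- 2] with [1 < s]. The power [s ^+ n] grows at
    least linearly, so the inverse of its square overcomes the factor [2 n +
    1]. *)
Lemma vp_rate_cvg (d e : R) : 0 < d -> d <= 2 -> 0 < e ->
  exists N, forall n, (N <= n)%N -> vp_rate d n <= e.
Proof.
move=> d0 d2 e0; pose r := 1 - d ^+ 2 / 4.
have r0 : 0 <= r by rewrite /r; nra.
have r1 : r < 1 by rewrite /r; nra.
have [r00|rn0] := eqVneq r 0.
  exists 1%N => -[//|n] _; rewrite /vp_rate -/r r00 expr0n mulr0; exact: ltW.
have rp : 0 < r by rewrite lt_neqAle eq_sym rn0.
pose s := (Num.sqrt r)^-1; pose y := s - 1.
have s0 : 0 < s by rewrite invr_gt0 sqrtr_gt0.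
have y0 : 0 < y.
  by rewrite subr_gt0 invf_gt1 ?sqrtr_gt0 // -[ltRHS]sqrtr1 ltr_sqrt.
have rs : r = s^-1 ^+ 2 by rewrite invrK sqr_sqrtr.
pose B : R := 1 + 2 / y.
have B0 : 0 < B by rewrite addr_gt0 // divr_gt0.
(* [B] absorbs the factor [2 n + 1] into a multiple of [1 + n y]. *)
exists (Num.truncn (B / (e * y))).+1 => n hn.
have hs : 1 + n%:R * y <= s ^+ n by apply: bernoulli_ge; exact: ltW.
have p0 : 0 < 1 + n%:R * y by rewrite ltr_wpDr // mulr_ge0 // ltW.
have hn2 : B <= n%:R * y * e.
  have := ltW (truncnS_gt (B / (e * y))).
  rewrite ler_pdivrMr ?mulr_gt0 // => h; apply: le_trans h _.
  rewrite -mulrA [y * e]mulrC; apply: ler_wpM2r; first by rewrite mulr_ge0 ?ltW.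
  by rewrite ler_nat.
have c1 : (n + n).+1%:R <= B * (1 + n%:R * y).
  have -> : B * (1 + n%:R * y) = 1 + 2 / y + n%:R * y + n%:R * 2.
    by rewrite /B; field; rewrite gt_eqF.
  rewrite -natr1 natrD.
  have y0' := ltW y0.
  have : 0 <= 2 / y + n%:R * y by rewrite addr_ge0 ?divr_ge0 ?mulr_ge0.
  lra.
have q2 : (1 + n%:R * y) ^+ 2 <= (s ^+ n) ^+ 2.
  have sn0 := lt_le_trans p0 hs.
  by rewrite lerXn2r // nnegrE ltW.
rewrite /vp_rate -/r rs exprAC exprVn exprVn ler_pdivrMr; last first.
  by rewrite !exprn_gt0.
apply: le_trans c1 _; apply: le_trans (ler_wpM2l (ltW e0) q2).
nra.
Qed.

End Kernel.

(** * A measurable inverse of the parametrization *)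
Section Angle.
Variable R : realType.
Local Notation C := R[i].
Local Notation mu := (arclength R).
Implicit Types (s t x y : R).

Lemma cos_2piB x : cos (2 * pi - x) = cos x.
Proof. by rewrite cosB mulr_natl cos2pi sin2pi mul1r mul0r addr0. Qed.

Lemma cos_lt1 y : 0 < y -> y < 2 * pi -> cos y < 1.
Proof.
have p0 := pi_gt0 R.
have key x : 0 < x -> x <= pi -> cos x < 1.
  by move=> x0 xpi; rewrite -cos0 ltr_cos ?in_itv /= ?lexx ?(ltW x0) ?(ltW p0).
move=> y0 y2; have [ypi|ypi] := leP y pi; first exact: key.
by rewrite -cos_2piB key //; lra.
Qed.

Lemma le_cos x y : 0 <= x -> x <= y -> y <= pi -> cos y <= cos x.
Proof.
move=> x0 xy ypi.
have hx : x \in `[0, pi] by rewrite in_itv /= x0 (le_trans xy).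
have hy : y \in `[0, pi] by rewrite in_itv /= ypi (le_trans x0).
by rewrite leNgt ltr_cos // -leNgt.
Qed.

Lemma sqn_chord s t : sqn (expi s - expi t) = 2 - 2 * cos (s - t).
Proof.
rewrite /sqn /= cosB; have := cos2Dsin2 s; have := cos2Dsin2 t.
move: (cos s) (sin s) (cos t) (sin t) => a b c d h1 h2.
have -> : (a - c) ^+ 2 + (b - d) ^+ 2 =
  (a ^+ 2 + b ^+ 2) + (c ^+ 2 + d ^+ 2) - 2 * (a * c + b * d) by ring.
by rewrite h1 h2.
Qed.

(** Close points of the circle have close angles, except around the point 1,
    where the angle jumps by [2 pi]. *)
Lemma chord_arc t (e : R) : 0 < t -> t < 2 * pi -> 0 < e ->
  exists2 d : R, 0 < d & forall s, 0 <= s -> s <= 2 * pi ->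
    normc (expi s - expi t) < d -> `|s - t| < e.
Proof.
move=> t0 t2 e0; have p0 := pi_gt0 R.
pose b := Num.min e (Num.min t (2 * pi - t)).
have b0 : 0 < b by rewrite !lt_min e0 t0 subr_gt0.
have [be bt bt2] : [/\ b <= e, b <= t & b <= 2 * pi - t].
  by rewrite /b !ge_min !lexx ?orbT.
have bpi : b <= pi by lra.
have cb : cos b < 1 by apply: cos_lt1 => //; lra.
exists (Num.sqrt (2 - 2 * cos b)); first by rewrite sqrtr_gt0; lra.
move=> s s0 s2 hs; rewrite ltNge; apply/negP => es.
move: hs; apply/negP; rewrite -leNgt normcE2 sqn_chord ler_wsqrtr //.
suff : cos (s - t) <= cos b by lra.
rewrite -cos_norm; set y := `|s - t| in es *.
have y2 : y <= 2 * pi - b.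
  by rewrite /y ler_norml; apply/andP; split; lra.
have [ypi|ypi] := leP y pi; first by apply: le_cos => //; lra.
by rewrite -cos_2piB; apply: le_cos; lra.
Qed.

Lemma expi_inj s t : 0 <= s < 2 * pi -> 0 <= t < 2 * pi ->
  expi s = expi t -> s = t.
Proof.
move=> /andP[s0 s2] /andP[t0 t2] st.
have : sqn (expi s - expi t) = 0 by rewrite st subrr /sqn /= expr0n addr0.
rewrite sqn_chord -cos_norm => h; apply/eqP; rewrite -subr_eq0 -normr_eq0.
rewrite eq_le normr_ge0 andbT leNgt; apply/negP => y0.
have : cos `|s - t| < 1.
  by apply: cos_lt1 => //; rewrite ltr_norml; apply/andP; split; lra.
by lra.
Qed.

(** The angle of a point of the circle, from 0 included to [2 pi] excluded. *)
Definition argT (z : C) : R := xget 0 [set t | 0 <= t < 2 * pi /\ expi t = z].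

Lemma expi_2pi_int (k : int) : expi (k%:~R * (2 * pi)) = 1 :> C.
Proof.
have key n : expi (n%:R * (2 * pi)) = 1 :> C.
  by have [c s] := cos_sin_nat2pi R n; rewrite /expi c s.
case: k => n; first exact: key.
rewrite NegzE rmorphN mulNr; apply: (mulfI (expi_neq0 (n.+1%:R * (2 * pi)))).
by rewrite -expiD subrr key mul1r /expi cos0 sin0.
Qed.

Lemma expi_mod_2pi t (s := t - 2 * pi * (Num.floor (t / (2 * pi)))%:~R) :
  0 <= s < 2 * pi /\ expi s = expi t.
Proof.
have p0 : 0 < 2 * pi :> R := twopi_gt0 R; split.
  have /andP[h1 h2] := floor_itv (t / (2 * pi)).
  rewrite ler_pdivlMr // in h1; rewrite ltr_pdivrMr // in h2.
  rewrite rmorphD mulrDl /= mul1r in h2.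
  by rewrite /s; apply/andP; split; lra.
by rewrite /s expiD -mulrN -rmorphN [2 * pi * _]mulrC expi_2pi_int mulr1.
Qed.

Lemma argT_expi t : argT (expi t) =
  t - 2 * pi * (Num.floor (t / (2 * pi)))%:~R.
Proof.
have [hs es] := expi_mod_2pi t.
rewrite /argT; case: xgetP => [x _ [hx ex]|/(_ _ (conj hs es))[]//].
by apply: expi_inj => //; rewrite ex es.
Qed.

Lemma argT_id t : 0 <= t < 2 * pi -> argT (expi t) = t.
Proof.
move=> ht; rewrite /argT; case: xgetP => [x _ [hx ex]|/(_ t)[]//].
exact: expi_inj.
Qed.

Lemma argT_itv t : 0 <= argT (expi t) < 2 * pi /\ expi (argT (expi t)) = expi t.
Proof. by rewrite argT_expi; exact: expi_mod_2pi. Qed.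

Lemma measurable_argT : measurable_fun [set: R] (fun t => argT (expi t)).
Proof.
have p0 : 0 < 2 * pi :> R := twopi_gt0 R.
under eq_fun do rewrite argT_expi.
apply: measurable_funB => //; apply: measurable_funM => //.
apply: nondecreasing_measurable => // x y xy.
by rewrite ler_int le_floor // ler_wpM2r // invr_ge0 ltW.
Qed.

Lemma ae_itv_2pi : {ae mu, forall t, 0 < t < 2 * pi}.
Proof.
have p0 : 0 < 2 * pi :> R := twopi_gt0 R.
have hmu : uniform_prob (twopi_gt0 R) (~` `]0, 2 * pi[) = 0%E.
  rewrite /uniform_prob integral_uniform_pdf.
  apply: null_set_integral.
  - by apply: measurableI => //; exact: measurableC.
  - apply/measurable_EFinP; apply: measurable_funTS.
    exact: measurable_uniform_pdf.
  - set N := (X in _ X = _).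
    have mN : measurable N by apply: measurableI => //; exact: measurableC.
    have mB : measurable ([set 0] `|` [set 2 * pi] : set R) by exact: measurableU.
    have NB : N `<=` [set 0] `|` [set 2 * pi].
      move=> x [/= h1 h2]; move: h1 h2; rewrite !in_itv /=.
      have [->|x0] := eqVneq x 0; first by left.
      have [->|x2] := eqVneq x (2 * pi); first by right.
      by move=> /negP + h2; rewrite !lt_neqAle x2 eq_sym x0 /= h2.
    have B0 : lebesgue_measure ([set 0] `|` [set 2 * pi] : set R) = 0%E.
      by rewrite measureU0 //; exact: lebesgue_measure_set1.
    exact: subset_measure0 mN mB NB B0.
exists (~` `]0, 2 * pi[); split; [exact: measurableC|exact: hmu|].
by move=> t /= h1; rewrite in_itv.
Qed.

End Angle.

(** * Approximation by trigonometric polynomials *)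
Section Approximation.
Variable R : realType.
Local Notation C := R[i].
Local Notation mu := (arclength R).
Implicit Types (H u f : C -> C).

(** A denominator that is a power of [z] reduces trigonometric polynomials to
    the algebra of polynomials. *)
Definition trigpoly (N : nat) (P : {poly C}) : C -> C := fun z => P.[z] / z ^+ N.

Lemma bddT_trigpoly N P : bddT (trigpoly N P).
Proof.
apply: (@bddT_eq _ (fun z => P.[z] * z ^ (- N%:Z))).
  by move=> t; rewrite /trigpoly -exprnN.
by apply: bddTM; [exact: bddT_horner|exact: bddT_exprz].
Qed.

Lemma vp_rate2 n : vp_rate (2 : R) n <= 1.
Proof.
rewrite /vp_rate (_ : 1 - 2 ^+ 2 / 4 = 0); last by field.
by case: n => [|n]; rewrite ?mulr1 // expr0n mulr0.
Qed.

(** The conditions on [N] and on [P`_0] make the Hankel matrix of the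
    approximant larger than [k] and invertible. The second one is obtained by
    adding a small constant to the numerator. *)
Lemma weierstrass f (e : R) (k : nat) : circle_measurable f -> continuousT f ->
  0 < e -> exists N (P : {poly C}), [/\ (k < N)%N, P`_0 != 0 &
    forall z, circle z -> normc (f z - trigpoly N P z) <= e].
Proof.
move=> mf cf e0.
have [M M0 hM] := bounded_continuousT cf.
have bf : bddT f by split => //; exists M => t; exact: hM (circle_expi t).
have e8 : 0 < e / 8 by lra.
have [d' d'0 hd'] := unif_continuousT cf e8.
pose d := Num.min d' 2.
have d0 : 0 < d by rewrite lt_min d'0 ltr0n.
have d2 : d <= 2 by rewrite ge_min lexx orbT.
have hd (w z : C) : circle w -> circle z -> normc (w - z) < d ->
    normc (f w - f z) <= e / 8.
  move=> cw cz h; apply/ltW/hd' => //; apply: lt_le_trans h _.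
  by rewrite ge_min lexx.
have M1 : 0 < M + 1 by lra.
(* Both terms of [vp_error] become at most [e / 4], which leaves [e / 2] for
   the constant added to the numerator. *)
have e16 : 0 < e / (16 * (M + 1)) by rewrite divr_gt0 // mulr_gt0.
have [N0 hN0] := vp_rate_cvg d0 d2 e16.
pose N := maxn N0 k.+1.
have hN z : circle z -> normc (trigpoly N (vp_poly N f) z - f z) <= e / 2.
  move=> cz; have e80 := ltW e8.
  have := vp_error N bf cz hM e80 d0 d2 (fun w0 cw => hd w0 z cw cz).
  move/le_trans; apply.
  have := hN0 N (leq_maxl _ _); rewrite ler_pdivlMr ?mulr_gt0 // => hr.
  have r0 : 0 <= vp_rate d N by rewrite mulr_ge0 // exprn_ge0 //; nra.
  by nra.
pose c : C := if (vp_poly N f)`_0 == 0 then (e / 2)%:C else 0.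
exists N, (vp_poly N f + c%:P); split; first exact: leq_maxr.
  rewrite coefD coefC /= /c; case: ifPn => [/eqP ->|h]; last by rewrite addr0.
  by rewrite add0r -normc_eq0 normc_real normr_eq0 gt_eqF // divr_gt0.
move=> z cz; rewrite /trigpoly hornerD hornerC mulrDl -normcN opprB addrAC.
apply: le_trans (le_normcD _ _) _; rewrite [leRHS]splitr lerD ?hN //.
rewrite normcM normcV normcX cz expr1n invr1 mulr1 /c.
by case: ifP => _; rewrite normc_real ger0_norm // ltW // divr_gt0.
Qed.

(** Dominated convergence. The continuity hypothesis leaves out the point 1,
    where functions of [argT] jump. *)
Lemma vp_L2 H (M e : R) : bddT H -> 0 <= M ->
  (forall w, circle w -> normc (H w) <= M) ->
  (forall t, 0 < t < 2 * pi -> forall e, 0 < e -> exists2 d : R, 0 < d &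
     forall w, circle w -> normc (w - expi t) < d ->
       normc (H w - H (expi t)) <= e) ->
  0 < e -> exists N P, nsq (fun z => H z - trigpoly N P z) <= e.
Proof.
move=> bH M0 hM cH e0.
pose g n (z : C) := trigpoly n (vp_poly n H) z - H z.
have bg n : bddT (g n).
  apply: (@bddT_eq _ (fun z => trigpoly n (vp_poly n H) z + (-1) * H z)).
    by move=> t; rewrite mulN1r.
  by apply: bddTD; [exact: bddT_trigpoly|apply: bddTM => //; exact: bddT_cst].
have gM n z : circle z -> normc (g n z) <= 8 * M.
  move=> cz.
  have h (w : C) : circle w -> normc (w - z) < 2 -> normc (H w - H z) <= 2 * M.
    move=> cw _; rewrite (le_trans (le_normcD _ _)) // normcN.
    by rewrite mulr2n mulrDl mul1r lerD ?hM.
  have := vp_error n bH cz hM (mulr_ge0 (ler0n R 2) M0) (ltr0n R 2) (lexx _) h.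
  move/le_trans; apply; have := vp_rate2 n; nra.
have mg n : measurable_fun setT (fun t => (sqn (g n (expi t)))%:E).
  by apply/measurable_EFinP; case: (bg n) => mgn _; exact: cmeas_sqn.
have cg : {ae mu, forall t, setT t ->
    (sqn (g n (expi t)))%:E @[n --> \oo] --> (0 : \bar R)}.
  apply: ae_mono (ae_itv_2pi R) => t tI _.
  apply/fine_cvgP; split; first exact: nearW.
  apply/cvgrPdist_lt => eta eta0.
  (* So [a ^+ 2 < eta], and each term of [vp_error] will be at most [a / 2]. *)
  pose a := Num.sqrt (eta / 2).
  have a0 : 0 < a by rewrite sqrtr_gt0 divr_gt0.
  have a4 : 0 < a / 4 by rewrite divr_gt0.
  have [d' d'0 hd'] := cH t tI _ a4.
  pose d := Num.min d' 2.
  have d0 : 0 < d by rewrite lt_min d'0 ltr0n.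
  have d2 : d <= 2 by rewrite ge_min lexx orbT.
  have hd (w : C) : circle w -> normc (w - expi t) < d ->
      normc (H w - H (expi t)) <= a / 4.
    by move=> cw h; apply: hd' => //; apply: lt_le_trans h _; rewrite ge_min lexx.
  have M1 : 0 < M + 1 by lra.
  have a8 : 0 < a / (8 * (M + 1)) by rewrite divr_gt0 // mulr_gt0.
  have [N hN] := vp_rate_cvg d0 d2 a8.
  exists N => // n /= Nn.
  have := vp_error n bH (circle_expi t) hM (ltW a4) d0 d2 hd.
  have := hN n Nn; rewrite ler_pdivlMr ?mulr_gt0 // => hr.
  have r0 : 0 <= vp_rate d n by rewrite mulr_ge0 // exprn_ge0 //; nra.
  move=> hg; have {}hg : normc (g n (expi t)) <= a by apply: le_trans hg _; nra.
  rewrite sub0r normrN ger0_norm ?sqn_ge0 // -normc_sqr.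
  apply: (@le_lt_trans _ _ (a ^+ 2)); first by rewrite lerXn2r ?nnegrE ?normc_ge0 // ltW.
  by rewrite sqr_sqrtr ?divr_ge0 ?ltW //; lra.
have dg : {ae mu, forall t, forall n, setT t ->
    (`|(sqn (g n (expi t)))%:E| <= ((8 * M) ^+ 2)%:E)%E}.
  apply: ae_all => t n _; rewrite gee0_abs ?lee_fin ?sqn_ge0 // -normc_sqr.
  rewrite lerXn2r ?nnegrE ?normc_ge0 ?mulr_ge0 //.
  exact: gM (circle_expi t).
have [_ _] := @dominated_convergence _ (measurableTypeR R) R mu setT measurableT
  (fun n t => (sqn (g n (expi t)))%:E) (cst 0%E) _ mg (measurable_cst _) cg
  (integrableT_cst ((8 * M) ^+ 2)) dg.
rewrite integral0 => /fine_cvgP[_] /cvgrPdist_lt /(_ e e0)[N _ /(_ N)].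
move=> /(_ (leqnn _)) /=; rewrite sub0r normrN => h.
exists N, (vp_poly N H); rewrite (@nsq_eq _ _ (fun z => (-1) * g N z)).
  rewrite nsqZ; last exact: L2T_bdd.
  rewrite (_ : sqn (-1) = 1) ?mul1r; last by rewrite /sqn /= sqrrN expr1n oppr0 expr0n addr0.
  by apply/ltW/(le_lt_trans _ h); exact: ler_norm.
by move=> t; rewrite /g mulN1r opprB.
Qed.

End Approximation.

(** * Density of trigonometric polynomials in L^2 *)
Section Density.
Variable R : realType.
Local Notation C := R[i].
Local Notation Re := complex.Re.
Local Notation Im := complex.Im.
Local Notation mu := (arclength R).
Implicit Types (u w : C -> C).

Definition clip (M x : R) : R := Num.max (- M) (Num.min M x).

Lemma clip_le M x : 0 <= M -> `|clip M x| <= M.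
Proof.
move=> M0; rewrite /clip ler_norml le_max lexx /= ge_max ge_min lexx /= andbT.
lra.
Qed.

Lemma clip_id M x : `|x| <= M -> clip M x = x.
Proof.
rewrite ler_norml => /andP[h1 h2]; rewrite /clip min_r // max_r //.
Qed.

Lemma clip_lip M x y : `|clip M x - clip M y| <= `|x - y|.
Proof.
rewrite /clip /Num.max /Num.min; do 4 case: ifPn; rewrite -?leNgt => *;
  have := ler_norm (x - y); have := ler_norm (y - x); rewrite [`|y - x|]distrC;
  move=> *; rewrite ler_norml; apply/andP; split; lra.
Qed.

Lemma continuous_clip M (g : R -> R) : continuous g -> continuous (clip M \o g).
Proof.
move=> cg x; apply/cvgrPdist_le => e e0.
have /cvgrPdist_le /(_ e e0) := cg x; apply: filterS => y.
by apply: le_trans; exact: clip_lip.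
Qed.

(** The density [1 / (2 pi)] is at most 1. *)
Lemma integral_arclength_le (h : R -> R) : measurable_fun setT h ->
  (forall t, 0 <= h t) ->
  (\int[mu]_t (h t)%:E <=
     \int[lebesgue_measure]_(t in `[0%R, (2 * pi)%R]) (h t)%:E)%E.
Proof.
move=> mh h0.
have mh' : measurable_fun [set: measurableTypeR R] (EFin \o h).
  exact/measurable_EFinP.
rewrite (@integral_uniform R 0 (2 * pi) (twopi_gt0 R) (EFin \o h) mh'); last first.
  by move=> t; rewrite lee_fin.
have I0 : (0 <= \int[lebesgue_measure]_(t in `[0%R, (2 * pi)%R]) (EFin \o h) t)%E.
  by apply: integral_ge0 => t _; rewrite lee_fin.
rewrite -[leRHS]mul1e; apply: lee_wpmul2r => //.
rewrite lee_fin subr0 invf_le1 ?twopi_gt0 //.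
by have := @pi_ge2 R; lra.
Qed.

(** A continuous approximation in L^1 is clipped between [- M] and [M]: the
    difference is then at most [2 M], and the L^1 bound turns into an L^2
    bound. *)
Lemma continuous_dense_bounded (U : R -> R) (M e : R) :
  measurable_fun setT U -> 0 < M -> {ae mu, forall t, `|U t| <= M} -> 0 < e ->
  exists2 g : R -> R, continuous g & (forall t, `|g t| <= M) /\
    (\int[mu]_t ((U t - g t) ^+ 2)%:E <= e%:E)%E.
Proof.
move=> mU M0 UM e0.
pose V := clip M \o U.
have cclip : continuous (clip M).
  by have := @continuous_clip M id; apply=> x; exact: cvg_id.
have mV : measurable_fun setT V.
  by apply: measurableT_comp => //; exact: continuous_measurable_fun.
have VM t : `|V t| <= M by apply: clip_le; exact: ltW.
have d0 : 0 < e / (2 * M) by rewrite divr_gt0 // mulr_gt0.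
have fin : (@lebesgue_measure R [set` `[0%R, (2 * pi)%R]] < +oo)%E.
  by rewrite lebesgue_measure_itv /= lte_fin twopi_gt0 -EFinB ltry.
have iV : lebesgue_measure.-integrable `[0, 2 * pi] (EFin \o V).
  apply: measurable_bounded_integrable => //.
  - exact: measurable_funTS.
  - exists M; split; first exact: num_real.
    by move=> x Mx t _ /=; rewrite (le_trans (VM t)) // ltW.
have [|g_ [cg ig]] := approximation_continuous_integrable (measurable_itv _) _ iV.
  exact: fin.
move=> /fine_cvgP[[N1 _ hN1]] /cvgrPdist_lt /(_ _ d0)[N2 _ hN2].
pose N := maxn N1 N2.
have := hN2 N (leq_maxr _ _); have := hN1 N (leq_maxl _ _) => /= f1.
rewrite sub0r normrN => /(le_lt_trans (ler_norm _)).
rewrite -lte_fin fineK //; set g := g_ N => hg.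
have mg : measurable_fun setT g by exact: continuous_measurable_fun (cg N).
exists (clip M \o g); first exact: continuous_clip (cg N).
split; first by move=> t; apply: clip_le; exact: ltW.
have m1 : measurable_fun setT (fun t => (U t - clip M (g t)) ^+ 2).
  apply: measurable_funX; apply: measurable_funB => //.
  by apply: measurableT_comp => //; exact: continuous_measurable_fun.
have m2 : measurable_fun setT (fun t => 2 * M * `|V t - g t|).
  apply: measurable_funM => //; apply: measurableT_comp => //.
  exact: measurable_funB.
apply: (@le_trans _ _ (\int[mu]_t (2 * M * `|V t - g t|)%:E)%E).
  apply: ae_ge0_le_integral => //.
  - by move=> t _; rewrite lee_fin sqr_ge0.
  - exact: (proj2 (measurable_EFinP _ _) m1).
  - by move=> t _; rewrite lee_fin mulr_ge0 // mulr_ge0 // ltW.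
  - exact: (proj2 (measurable_EFinP _ _) m2).
  apply: ae_mono UM => t Ut _; rewrite lee_fin.
  have UV : U t = V t by rewrite /V /= clip_id.
  have VV : V t = clip M (V t) by rewrite clip_id.
  have l := clip_lip M (V t) (g t); rewrite -VV -UV in l.
  rewrite -real_normK ?num_real // expr2 -UV; apply: ler_pM => //.
  have := VM t; have := clip_le (g t) (ltW M0); rewrite -UV => h1 h2.
  by rewrite (le_trans (ler_normB _ _)) //; lra.
apply: le_trans (integral_arclength_le m2 _) _.
  by move=> t; rewrite mulr_ge0 // mulr_ge0 // ltW.
under eq_integral do rewrite EFinM.
rewrite ge0_integralZl_EFin //; last 2 first.
- apply/measurable_EFinP; apply: measurable_funTS; apply: measurableT_comp => //.
  exact: measurable_funB.
- by rewrite mulr_ge0 // ltW.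
apply: (@le_trans _ _ ((2 * M)%:E * (e / (2 * M))%:E)%E).
  apply: lee_wpmul2l; first by rewrite lee_fin mulr_ge0 // ltW.
  by apply: le_trans (ltW hg); rewrite /=.
by rewrite -EFinM mulrC divfK // mulf_neq0 // gt_eqF.
Qed.

Lemma nsq_le u (c : R) : L2T u ->
  (\int[mu]_t (sqn (u (expi t)))%:E <= c%:E)%E -> nsq u <= c.
Proof.
move=> [_ iu] h; rewrite -lee_fin fineK //.
exact: integrable_fin_num iu.
Qed.

(** The real and imaginary parts are approximated by continuous functions of
    the angle. These may differ at 0 and [2 pi], but composed with [argT] they
    are continuous on the circle outside of 1, as [vp_L2] requires. *)
Lemma trigpoly_dense u (M e : R) : L2T u -> 0 < M ->
  {ae mu, forall t, normc (u (expi t)) <= M} -> 0 < e ->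
  exists N P, nsq (fun z => u z - trigpoly N P z) <= e.
Proof.
move=> hu M0 uM e0; have [[mr mi] _] := hu.
have e8 : 0 < e / 8 by rewrite divr_gt0.
have [|g cg [gM ge]] := continuous_dense_bounded mr M0 _ e8.
  by apply: ae_mono uM => t; apply: le_trans; exact: normc_Re.
have [|k ck [kM ke]] := continuous_dense_bounded mi M0 _ e8.
  by apply: ae_mono uM => t; apply: le_trans; exact: normc_Im.
pose H (z : C) := g (argT z) +i* k (argT z).
have mgk (h : R -> R) : continuous h -> measurable_fun setT (fun t => h (argT (expi t))).
  move=> ch; apply: (measurableT_comp (continuous_measurable_fun ch)).
  exact: measurable_argT.
have HM z : normc (H z) <= 2 * M.
  by rewrite (le_trans (normc_le _)) //= mulr2n mulrDl mul1r lerD.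
have bH : bddT H by split; [split; exact: mgk|exists (2 * M)].
have [N [P hP]] : exists N P, nsq (fun z => H z - trigpoly N P z) <= e / 4.
  apply: (@vp_L2 _ H (2 * M)) => //; last 1 first.
  - by rewrite divr_gt0.
  - by rewrite mulr_ge0 // ltW.
  move=> t /andP[t0 t2] a a0; have a2 : 0 < a / 2 by rewrite divr_gt0.
  have : \forall s \near t, `|g t - g s| <= a / 2 /\ `|k t - k s| <= a / 2.
    have /cvgrPdist_le /(_ _ a2) h1 := cg t.
    have /cvgrPdist_le /(_ _ a2) h2 := ck t.
    by near=> s; split; near: s.
  move=> /nbhs_ballP[d1 /= d10 hd1].
  have [d d0 hd] := chord_arc t0 t2 d10.
  exists d => // w cw; have [s0 _ ->] := circleP cw.
  have [/andP[s1 s2] es] := argT_itv s0.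
  rewrite -es => /(hd _ s1 (ltW s2)) hs.
  have /hd1[h1 h2] : ball t d1 (argT (expi s0)) by rewrite /ball /= distrC.
  apply: (le_trans (normc_le (H (expi (argT (expi s0))) - H (expi t)))).
  rewrite [leRHS]splitr /H (@argT_id _ (argT (expi s0))) ?s1 //.
  rewrite (@argT_id _ t) ?(ltW t0) //=.
  by apply: lerD; rewrite distrC.
exists N, P.
have hH : nsq (fun z => u z - H z) <= e / 4.
  apply: nsq_le; first by apply: L2TB => //; exact: L2T_bdd.
  have mu1 : measurable_fun [set: measurableTypeR R]
      (fun t => ((Re (u (expi t)) - g t) ^+ 2)%:E).
    apply/measurable_EFinP; apply: measurable_funX.
    by apply: measurable_funB => //; exact: continuous_measurable_fun.
  have mu2 : measurable_fun [set: measurableTypeR R]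
      (fun t => ((Im (u (expi t)) - k t) ^+ 2)%:E).
    apply/measurable_EFinP; apply: measurable_funX.
    by apply: measurable_funB => //; exact: continuous_measurable_fun.
  apply: (@le_trans _ _ (\int[mu]_t (((Re (u (expi t)) - g t) ^+ 2)%:E +
     ((Im (u (expi t)) - k t) ^+ 2)%:E))%E).
    apply: ae_ge0_le_integral => //.
    - by move=> t _; rewrite lee_fin sqn_ge0.
    - apply/measurable_EFinP.
      exact: (cmeas_sqn (proj1 (L2TB hu (L2T_bdd bH)))).
    - by move=> t _; rewrite -EFinD lee_fin addr_ge0 // sqr_ge0.
    - exact: emeasurable_funD.
    - apply: ae_mono (ae_itv_2pi R) => t /andP[t0 t2] _.
      rewrite -EFinD lee_fin /sqn !reD !imD /H argT_id ?(ltW t0) //=.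
  rewrite (ge0_integralD _ _ _ mu1 _ mu2) //; last 2 first.
  - by move=> t _; rewrite lee_fin sqr_ge0.
  - by move=> t _; rewrite lee_fin sqr_ge0.
  apply: le_trans (leeD ge ke) _; rewrite -EFinD lee_fin; lra.
rewrite (@nsq_eq _ _ (fun z => (u z - H z) + (H z - trigpoly N P z))); last first.
  by move=> t; rewrite addrA subrK.
have h1 : L2T (fun z => u z - H z) by apply: L2TB => //; exact: L2T_bdd.
have h2 : L2T (fun z => H z - trigpoly N P z).
  by apply: L2TB; apply: L2T_bdd => //; exact: bddT_trigpoly.
rewrite nsqD //.
have := nsqB h1 h2; have := nsq_ge0 (fun z => (u z - H z) - (H z - trigpoly N P z)).
by lra.
Unshelve. all: by end_near. Qed.

End Density.

(** * Orthogonality of analytic and antianalytic functions *)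
Section Orthogonality.
Variable R : realType.
Local Notation C := R[i].
Local Notation Re := complex.Re.
Local Notation mu := (arclength R).
Implicit Types (u w : C -> C).

Lemma H2P u : H2 u <-> L2T u /\ forall k : int, k < 0 -> fourier u k = 0.
Proof. by split=> -[/LpT2P]. Qed.

Lemma Hbar20P u : Hbar20 u <-> L2T u /\ forall k : int, 0 <= k -> fourier u k = 0.
Proof. by split=> -[/LpT2P]. Qed.

Lemma H2_hardy1 u : H2 u -> hardy1 u.
Proof. by move=> /H2P[/L2T_L1T hu fu]. Qed.

Lemma fourier_horner (P : {poly C}) (k : int) :
  fourier (fun z => P.[z]) k = if k is Posz j then P`_j else 0.
Proof.
have h (i : nat) : L1T (fun z : C => z ^+ i) := L1T_bdd (bddT_exprz R i).
rewrite (@fourier_eq _ _ (fun z => \sum_(i < size P) P`_i * z ^+ i)); last first.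
  by move=> t; rewrite horner_coef.
rewrite fourier_sum; last by move=> i; exact: L1TZ.
under eq_bigr => i _.
  rewrite fourierZ // (_ : fourier _ k = (Posz i == k)%:R); last exact: (fourier_exprz R i k).
  over.
case: k => k; last by rewrite big1 // => i _; rewrite mulr0.
have [kP|kP] := ltnP k (size P); last first.
  rewrite nth_default // big1 // => i _; rewrite eqz_nat.
  by case: eqP => [ik|]; rewrite ?mulr0 //; have := ltn_ord i; rewrite ik ltnNge kP.
rewrite (bigD1 (Ordinal kP)) //= eqxx mulr1 big1 ?addr0 // => i.
by rewrite eqz_nat -val_eqE /= => /negbTE ->; rewrite mulr0.
Qed.

Lemma dotT_trigpoly u (N : nat) (P : {poly C}) : L2T u ->
  dotT u (trigpoly N P) =
  \sum_(i < size P) (P`_i)^* * fourier u (i%:Z - N%:Z).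
Proof.
move=> hu; have b (k : int) : L2T (fun z : C => z ^ k) := L2T_bdd (bddT_exprz R k).
rewrite (@dotT_eq _ _ u _ (fun z => \sum_(i < size P) P`_i * z ^ (i%:Z - N%:Z))) //; last first.
  move=> t; rewrite /trigpoly horner_coef mulr_suml; apply: eq_bigr => i _.
  by rewrite -mulrA; congr (_ * _); rewrite expfzDr ?expi_neq0 // exprnN.
rewrite dotT_sumr //; last by move=> i; exact: L2TZ.
by apply: eq_bigr => i _; rewrite dotTZr // fourier_dotT.
Qed.

Definition taylor N u : {poly C} := \poly_(j < N) fourier u j%:Z.

Lemma bddT_taylor N u : bddT (fun z => (taylor N u).[z]).
Proof. exact: bddT_horner. Qed.

Lemma fourier_taylor N u (k : int) : L2T u -> (forall k : int, k < 0 -> fourier u k = 0) ->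
  k < N%:Z -> fourier (fun z => u z - (taylor N u).[z]) k = 0.
Proof.
move=> hu fu kN; rewrite fourierB; last 2 first.
- exact: L2T_L1T.
- exact: L1T_bdd (bddT_taylor N u).
rewrite fourier_horner; case: k kN => k; last by rewrite fu // subrr.
by rewrite ltz_nat => kN; rewrite coef_poly kN subrr.
Qed.

(** The coefficients of index less than [size P] of [u - taylor (size P) u]
    vanish, so this function is orthogonal to both [taylor (size P) u] and
    [trigpoly N P]. *)
Lemma taylor_best u N (P : {poly C}) : L2T u ->
  (forall k : int, k < 0 -> fourier u k = 0) ->
  nsq (fun z => u z - (taylor (size P) u).[z]) <=
  nsq (fun z => u z - trigpoly N P z).
Proof.
move=> hu fu; set q := taylor _ u.
have hq : L2T (fun z => q.[z]) by exact: L2T_bdd (bddT_horner q).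
have hT : L2T (trigpoly N P) by exact: L2T_bdd (bddT_trigpoly N P).
have h1 : L2T (fun z => u z - q.[z]) by exact: L2TB.
have h2 : L2T (fun z => q.[z] - trigpoly N P z) by exact: L2TB.
rewrite [leRHS](@nsq_eq _ _ (fun z => (u z - q.[z]) + (q.[z] - trigpoly N P z))); last first.
  by move=> t; rewrite addrA subrK.
rewrite (nsqD h1 h2) dotTBr //.
have -> : dotT (fun z => u z - q.[z]) (fun z => q.[z]) = 0.
  rewrite (@dotT_eq _ _ (fun z => u z - q.[z]) _ (trigpoly 0 q)) //; last first.
    by move=> t; rewrite /trigpoly expr0 divr1.
  rewrite dotT_trigpoly // big1 // => i _.
  rewrite fourier_taylor ?mulr0 // subr0 ltz_nat.
  by apply: leq_trans (ltn_ord i) _; rewrite size_poly.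
have -> : dotT (fun z => u z - q.[z]) (trigpoly N P) = 0.
  rewrite dotT_trigpoly // big1 // => i _.
  rewrite fourier_taylor ?mulr0 // ltrBlDr -PoszD ltz_nat.
  by rewrite ltn_addr.
by rewrite subr0 mulr0 addr0 lerDl nsq_ge0.
Qed.

Lemma dotT_poly_Hbar20 (P : {poly C}) w : Hbar20 w -> dotT (fun z => P.[z]) w = 0.
Proof.
move=> /Hbar20P[hw fw]; have hP := L2T_bdd (bddT_horner P).
rewrite -dotT_conj //.
rewrite (@dotT_eq _ _ w _ (trigpoly 0 P)) //; last first.
  by move=> t; rewrite /trigpoly expr0 divr1.
by rewrite dotT_trigpoly // big1 ?conjC0 // => i _; rewrite subr0 fw ?mulr0.
Qed.

(** For a polynomial [u] this is [dotT_poly_Hbar20]. In general a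
    trigonometric polynomial close to [u] can be replaced by a polynomial at
    least as close, by [taylor_best], and the scalar product is continuous. *)
Lemma hardy_orth u w (M : R) : H2 u -> {ae mu, forall t, normc (u (expi t)) <= M} ->
  Hbar20 w -> dotT u w = 0.
Proof.
move=> /H2P[hu fu] uM Hw; have /Hbar20P[hw _] := Hw.
have [K K0 uK] : exists2 K, 0 < K & {ae mu, forall t, normc (u (expi t)) <= K}.
  exists (`|M| + 1); first by rewrite ltr_pwDr.
  by apply: ae_mono uM => t /le_trans; apply; have := ler_norm M; lra.
have key (c : C) (e : R) : 0 < e ->
    Re (c * dotT u w) <= Num.sqrt (sqn c * e) * Num.sqrt (nsq w).
  move=> e0; have [N [P hP]] := trigpoly_dense hu K0 uK e0.
  set q := taylor (size P) u.
  have hq : L2T (fun z => q.[z]) by exact: L2T_bdd (bddT_horner q).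
  have hd : L2T (fun z => u z - q.[z]) by exact: L2TB.
  have -> : dotT u w = dotT (fun z => u z - q.[z]) w.
    by rewrite dotTBl // dotT_poly_Hbar20 // subr0.
  rewrite -dotTZl //; apply: le_trans (CauchySchwarzT (L2TZ c hd) hw) _.
  rewrite ler_wpM2r ?sqrtr_ge0 // ler_wsqrtr // nsqZ // ler_wpM2l ?sqn_ge0 //.
  exact: le_trans (taylor_best N P hu fu) hP.
have key2 (c : C) : Re (c * dotT u w) <= 0.
  rewrite leNgt; apply/negP => x0; set x := Re _ in x0.
  pose B := sqn c * nsq w.
  have B0 : 0 <= B by rewrite mulr_ge0 ?sqn_ge0 ?nsq_ge0.
  (* Small enough for the right-hand side of [key] to be less than [x]. *)
  have e0 : 0 < x ^+ 2 / (2 * (B + 1)).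
    by rewrite divr_gt0 ?exprn_gt0 // mulr_gt0 // ltr_wpDl.
  have := key c _ e0; rewrite -/x -sqrtrM; last first.
    by rewrite mulr_ge0 ?sqn_ge0 // ltW.
  rewrite leNgt => /negP; apply.
  rewrite -[ltRHS]ger0_norm ?(ltW x0) // -sqrtr_sqr ltr_sqrt ?exprn_gt0 //.
  rewrite mulrAC -/B mulrA ltr_pdivrMr ?mulr_gt0 ?ltr_wpDl //.
  have := exprn_gt0 2 x0; set y := x ^+ 2; nra.
apply/eqP; rewrite -sqn_eq0 eq_le sqn_ge0 andbT.
(* For this [c] the product is the squared modulus. *)
by have := key2 (dotT u w)^*; rewrite mulrC -sqnE /=.
Qed.

End Orthogonality.

(** * Multiplication by a rational function *)
Lemma exists_left_kernel (F : fieldType) p q (A : 'M[F]_(p, q)) : (q < p)%N ->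
  exists2 c : 'rV_p, c != 0 & c *m A = 0.
Proof.
move=> qp; have : kermx A != 0.
  rewrite -mxrank_eq0 mxrank_ker subn_eq0 -ltnNge.
  exact: leq_ltn_trans (rank_leq_col A) qp.
by move=> /rowV0Pn[c /sub_kermxP cA c0]; exists c.
Qed.

Section RankArgument.
Variable R : realType.
Local Notation C := R[i].
Local Notation mu := (arclength R).
Implicit Types (u w : C -> C).

Lemma le_nsq_ae u w : L2T u -> L2T w ->
  {ae mu, forall t, sqn (u (expi t)) <= sqn (w (expi t))} -> nsq u <= nsq w.
Proof.
move=> [mu1 iu] [mw iw] uw; rewrite -lee_fin !fineK; try exact: integrable_fin_num.
apply: ae_ge0_le_integral => //.
- by move=> t _; rewrite lee_fin sqn_ge0.
- by apply/measurable_EFinP; exact: cmeas_sqn.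
- by move=> t _; rewrite lee_fin sqn_ge0.
- by apply/measurable_EFinP; exact: cmeas_sqn.
- by apply: ae_mono uw => t h _; rewrite lee_fin.
Qed.

Lemma ae_forall (k : nat) (P : 'I_k -> R -> Prop) :
  (forall i, {ae mu, forall t, P i t}) -> {ae mu, forall t, forall i, P i t}.
Proof.
by move=> h; apply: (@filter_forall _ _ _ _ (ae_filter_ringOfSetsType mu)).
Qed.

Lemma poly_circle_factor (Q : {poly C}) : (forall z, circle z -> ~~ root Q z) ->
  exists a s r, [/\ a != 0, (size s + size r = (size Q).-1)%N,
    (forall x, x \in s -> normc x < 1), (forall x, x \in r -> 1 < normc x) &
    Q = a *: (\prod_(x <- s) ('X - x%:P) * \prod_(x <- r) ('X - x%:P))].
Proof.
move=> hQ; have [rs Qrs] := closed_field_poly_normal Q.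
have Q0 : Q != 0.
  apply: contraTneq isT => Q0; have := hQ _ (circle_expi 0).
  by rewrite Q0 root0.
have l0 : lead_coef Q != 0 by rewrite lead_coef_eq0.
have rs1 x : x \in rs -> normc x != 1.
  move=> xrs; apply/eqP => x1; have := hQ x x1.
  by rewrite Qrs rootZ // root_prod_XsubC xrs.
exists (lead_coef Q), [seq x <- rs | normc x < 1], [seq x <- rs | ~~ (normc x < 1)].
split=> //.
- by rewrite [in RHS]Qrs size_scale // size_prod_XsubC /= !size_filter count_predC.
- by move=> x; rewrite mem_filter => /andP[].
- move=> x; rewrite mem_filter -leNgt => /andP[x1 /rs1 x2].
  by rewrite lt_neqAle eq_sym x2.
- by rewrite {1}Qrs (bigID (fun x => normc x < 1)) /= !big_filter.
Qed.

Lemma horner_prod_XsubC (s : seq C) z :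
  (\prod_(x <- s) ('X - x%:P)).[z] = \prod_(x <- s) (z - x).
Proof. by rewrite horner_prod; apply: eq_bigr => x _; rewrite hornerXsubC. Qed.

Lemma bddT_rat (P Q : {poly C}) : (forall z, circle z -> ~~ root Q z) ->
  bddT (fun z => P.[z] / Q.[z]).
Proof.
move=> /poly_circle_factor[a [s [r [a0 _ hs hr ->]]]].
have b1 := bddT_prod_XsubCV (s := s) (fun x xs => negbT (lt_eqF (hs x xs))).
have b2 := bddT_prod_XsubCV (s := r) (fun x xr => negbT (gt_eqF (hr x xr))).
apply: bddT_eq (bddTM (bddTM (bddT_horner P) (bddT_cst a^-1)) (bddTM b1 b2)).
by move=> t; rewrite hornerZ hornerM !horner_prod_XsubC !invfM !mulrA.
Qed.

Lemma hardy1_rat (P Q : {poly C}) (a : C) (s r : seq C) u :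
  Q = a *: (\prod_(x <- s) ('X - x%:P) * \prod_(x <- r) ('X - x%:P)) ->
  (forall x, x \in s -> normc x < 1) -> (forall x, x \in r -> 1 < normc x) ->
  hardy1 u ->
  (forall i, (i < size s)%N ->
     integralT (fun z => u z * z / \prod_(a <- take i.+1 s) (z - a)) = 0) ->
  hardy1 (fun z => P.[z] / Q.[z] * u z).
Proof.
move=> -> hs hr hu h0.
have h1 := hardy1_div_disk (fun x xs => negbT (lt_eqF (hs x xs))) hu h0.
have h2 := hardy1_div_outer hr h1.
apply: hardy1_eq (hardy1_horner P (hardy1Z a^-1 h2)) => t /=.
rewrite hornerZ hornerM !horner_prod_XsubC !invfM.
move: (_^-1) (_^-1) (_^-1) => x y z; ring.
Qed.

(** Each root of [Q] in the disk gives one linear functional, and there are at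
    most [n] of them, so some combination [u] of the [v j] is in their common
    kernel. Then [P / Q * u] is in H^2, hence orthogonal to the combination
    [W] of the [w j]. *)
Lemma rational_combination_bound f n (v w : 'I_n.+1 -> C -> C) (s m : 'I_n.+1 -> R)
    (P Q : {poly C}) :
  bddT f -> (forall j, H2 (v j)) ->
  (forall j, {ae mu, forall t, normc (v j (expi t)) <= m j}) ->
  (forall j, Hbar20 (w j)) ->
  (forall j e, Hbar20 e -> dotT (fun z => f z * v j z - w j z) e = 0) ->
  (forall i j, dotT (w i) (w j) = ((i == j)%:R * s j ^+ 2)%:C) ->
  (size Q <= n.+1)%N -> (forall z, circle z -> ~~ root Q z) ->
  exists2 c : 'I_n.+1 -> C, (exists j, c j != 0) &
    \sum_j sqn (c j) * s j ^+ 2 <=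
    (\sum_j normc (c j) * m j) ^+ 2 * nsq (fun z => f z - P.[z] / Q.[z]).
Proof.
move=> bf Hv vm Hw fvw ww sQ Q1.
have [a [ins [outs [a0 szs hin hout QE]]]] := poly_circle_factor Q1.
have s_n : (size ins <= n)%N.
  apply: leq_trans (leq_addr (size outs) _) _; rewrite szs.
  by move: sQ; case: (size Q).
pose lam i u := integralT (fun z => u z * z / \prod_(x <- take i.+1 ins) (z - x)).
have hL2v j : L2T (v j) by have /H2P[] := Hv j.
have hL2w j : L2T (w j) by have /Hbar20P[] := Hw j.
pose A : 'M[C]_(n.+1, n) := \matrix_(j, i) lam i (v j).
have [c c0 cA] := exists_left_kernel A (ltnSn n).
exists (fun j => c 0 j).
  have /rV0Pn[j cj] := c0; by exists j.
pose u z := \sum_j c 0 j * v j z.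
pose W z := \sum_j c 0 j * w j z.
have hu : L2T u by apply: L2T_sum => j; exact: L2TZ.
have hW : L2T W by apply: L2T_sum => j; exact: L2TZ.
have HW : Hbar20 W.
  apply/Hbar20P; split=> // k k0; rewrite fourier_sum; last first.
    by move=> j; exact: L1TZ (L2T_L1T (hL2w j)).
  rewrite big1 // => j _; rewrite fourierZ; last exact: L2T_L1T.
  by have /Hbar20P[_ ->] := Hw j; rewrite ?mulr0.
have hu1 : hardy1 u.
  by apply: hardy1_sum => j; apply: hardy1Z; exact: H2_hardy1.
pose g z := P.[z] / Q.[z].
have bg : bddT g := bddT_rat P Q1.
have hgu : hardy1 (fun z => g z * u z).
  apply: (hardy1_rat _ QE hin hout hu1 _) => i i_s.
  have i_n : (i < n)%N := leq_trans i_s s_n.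
  have := congr1 (fun B : 'rV_n => B 0 (Ordinal i_n)) cA; rewrite !mxE.
  have bt : bddT (fun z => z / \prod_(x <- take i.+1 ins) (z - x)).
    apply: bddTM; first exact: bddT_eq (bddT_exprz R 1).
    apply: bddT_prod_XsubCV => x /mem_take /hin x1; by rewrite lt_eqF.
  have hvt j : L1T (fun z => v j z * z / \prod_(x <- take i.+1 ins) (z - x)).
    apply: L1T_eq (L1TM bt (L2T_L1T (hL2v j))) => t.
    by rewrite [LHS]mulrC mulrA.
  move=> h; rewrite -[RHS]h.
  under [RHS]eq_bigr do rewrite mxE /lam /= -integralTZ //.
  rewrite -integralT_sum; last by move=> j; exact: L1TZ.
  apply: integralT_eq => t; rewrite /u !mulr_suml.
  by apply: eq_bigr => j _; rewrite !mulrA.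
have L2gu : L2T (fun z => g z * u z) by exact: L2TM.
have Hgu : H2 (fun z => g z * u z).
  by apply/H2P; split=> // k k0; case: hgu => _ ->.
have um : {ae mu, forall t, normc (u (expi t)) <= \sum_j normc (c 0 j) * m j}.
  apply: ae_mono (ae_forall vm) => t vmt.
  apply: le_trans (normc_sum _ _ _) _; apply: ler_sum => j _.
  by rewrite normcM ler_wpM2l ?normc_ge0.
set S := \sum_j normc _ * _ in um *.
have [B gB] := bg.2.
have gum : {ae mu, forall t, normc (g (expi t) * u (expi t)) <= B * S}.
  by apply: ae_mono um => t h; rewrite normcM ler_pM ?normc_ge0.
have guW : dotT (fun z => g z * u z) W = 0 := hardy_orth Hgu gum HW.
have nW : nsq W = \sum_j sqn (c 0 j) * s j ^+ 2.
  apply: (@complexI R); rewrite -dotT_nsq dotT_suml //; last by move=> j; exact: L2TZ.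
  rewrite rmorph_sum; apply: eq_bigr => j _ /=.
  rewrite dotTZl // dotT_sumr //; last by move=> i; exact: L2TZ.
  rewrite (bigD1 j) //= big1 => [|i ij]; last first.
    by rewrite dotTZr // ww eq_sym (negbTE ij) mul0r mulr0.
  rewrite dotTZr // ww eqxx mul1r addr0 mulrA -sqnE.
  by rewrite -rmorphM.
have fuW : dotT (fun z => f z * u z) W = (nsq W)%:C.
  have hfv j : L2T (fun z => f z * v j z) by exact: L2TM.
  rewrite -dotT_nsq [in RHS]/W.
  rewrite (@dotT_eq _ _ (fun z => \sum_j c 0 j * (f z * v j z)) _ W) //; last first.
    by move=> t; rewrite /u mulr_sumr; apply: eq_bigr => j _; rewrite mulrCA.
  rewrite !dotT_suml //; try by move=> j; exact: L2TZ.
  apply: eq_bigr => j _; rewrite !dotTZl //; congr (_ * _).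
  by apply/eqP; rewrite -subr_eq0 -dotTBl // fvw.
have bfg : bddT (fun z => f z - g z).
  apply: bddT_eq (bddTD bf (bddTM (bddT_cst (-1)) bg)) => t.
  by rewrite mulN1r.
have hfgu : L2T (fun z => (f z - g z) * u z) by exact: L2TM.
have e1 : dotT (fun z => (f z - g z) * u z) W = (nsq W)%:C.
  rewrite (@dotT_eq _ _ (fun z => f z * u z - g z * u z) _ W) //; last first.
    by move=> t; rewrite mulrBl.
  by rewrite dotTBl ?guW ?subr0 //; exact: L2TM.
rewrite -nW; have := CauchySchwarzT hfgu hW; rewrite e1 /= => cs.
have W0 := nsq_ge0 W.
have {}cs : nsq W <= nsq (fun z => (f z - g z) * u z).
  have [W00|W00] := eqVneq (nsq W) 0; first by rewrite W00 nsq_ge0.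
  have Wp : 0 < nsq W by rewrite lt_neqAle eq_sym W00.
  rewrite -ler_sqrt ?nsq_ge0 // -(ler_pM2r (x := Num.sqrt (nsq W))) ?sqrtr_gt0 //.
  by rewrite -expr2 sqr_sqrtr.
apply: le_trans cs _.
have h2 : L2T (fun z => f z - g z) := L2T_bdd bfg.
have -> : S ^+ 2 * nsq (fun z => f z - g z) = nsq (fun z => S%:C * (f z - g z)).
  by rewrite nsqZ // sqn_real.
apply: le_nsq_ae => //; first exact: L2TZ.
apply: ae_mono um => t h; rewrite !sqnM mulrC ler_wpM2r ?sqn_ge0 // sqn_real.
rewrite -normc_sqr lerXn2r ?nnegrE ?normc_ge0 //.
exact: le_trans (normc_ge0 _) h.
Qed.

End RankArgument.

(** * Singular values of matrices *)
Section SingularValues.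
Variable R : realType.
Local Notation C := R[i].

Definition rnsq N (a : 'rV[C]_N) : R := \sum_j sqn (a 0 j).

Lemma rnsq_ge0 N (a : 'rV[C]_N) : 0 <= rnsq a.
Proof. by apply: sumr_ge0 => j _; exact: sqn_ge0. Qed.

Lemma rnsqE N (a : 'rV[C]_N) : (rnsq a)%:C = (a *m a^t*%sesqui) 0 0.
Proof.
rewrite rmorph_sum mxE; apply: eq_bigr => j _ /=.
by rewrite sqnE !mxE.
Qed.

Lemma rnsq_eq0 N (a : 'rV[C]_N) : (rnsq a == 0) = (a == 0).
Proof.
apply/eqP/eqP => [/eqP|->].
  rewrite psumr_eq0 => [/allP h|j _]; last exact: sqn_ge0.
  apply/rowP => j; rewrite mxE; apply/eqP; rewrite -sqn_eq0.
  by apply: (implyP (h j (mem_index_enum _))).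
by rewrite /rnsq big1 // => j _; rewrite mxE /sqn /= expr0n addr0.
Qed.

Lemma rnsqZ N (x : C) (a : 'rV[C]_N) : rnsq (x *: a) = sqn x * rnsq a.
Proof.
by rewrite /rnsq mulr_sumr; apply: eq_bigr => j _; rewrite mxE sqnM.
Qed.

Lemma rnsq_unitary m N (P : 'M[C]_(m, N)) (c : 'rV_m) : P \is unitarymx ->
  rnsq (c *m P) = rnsq c.
Proof.
move=> /unitarymxP PP; apply: (@complexI R); rewrite !rnsqE.
by rewrite trmx_mul map_mxM /= mulmxA -[c *m P *m _]mulmxA PP mulmx1.
Qed.

(** The rows of [P] are orthonormal left eigenvectors of the product of [H]
    and its adjoint, so [lam] lists squares of singular values of [H]. The
    matrix [P] may have fewer rows than [H]. *)
Definition eigenrows m N (H : 'M[C]_N) (P : 'M[C]_(m, N)) (lam : 'I_m -> R) :=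
  P \is unitarymx /\
  P *m (H *m H^t*%sesqui) = diag_mx (\row_i (lam i)%:C) *m P.

Lemma row_diag_mul m N (d : 'rV[C]_m) (P : 'M[C]_(m, N)) i :
  row i (diag_mx d *m P) = d 0 i *: row i P.
Proof. by apply/rowP => j; rewrite mul_diag_mx !mxE. Qed.

Lemma rnsq_row m N (P : 'M[C]_(m, N)) i : P \is unitarymx -> rnsq (row i P) = 1.
Proof.
move=> uP; rewrite rowE rnsq_unitary // /rnsq (bigD1 i) //= big1 => [|j ji].
  by rewrite mxE !eqxx addr0 /sqn /= expr1n expr0n addr0.
by rewrite mxE (negbTE ji) andbF /sqn /= expr0n addr0.
Qed.

Lemma eigenrows_exists N (H : 'M[C]_N) :
  exists (P : 'M[C]_N) lam, eigenrows H P lam.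
Proof.
pose A := H *m H^t*%sesqui.
have At : A^t*%sesqui = A by rewrite trmx_mul map_mxM /= trmxCK.
have nA : A \is normalmx by apply/normalmxP; rewrite At.
have /orthomx_spectralP AE := nA.
set P := spectralmx A in AE; set sp := spectral_diag A in AE.
have uP : P \is unitarymx := spectral_unitarymx A.
have PA : P *m A = diag_mx sp *m P.
  by rewrite AE mulmxA mulmxA mulmxV ?mul1mx ?spectral_unit.
exists P, (fun i => rnsq (row i P *m H)); split => //; rewrite -/A PA.
congr (diag_mx _ *m _); apply/rowP => i; rewrite mxE rnsqE.
rewrite trmx_mul map_mxM /= mulmxA -[row i P *m H *m _]mulmxA.
rewrite -/A -row_mul PA row_diag_mul.
by rewrite -scalemxAl mxE -rnsqE rnsq_row // mulr1.
Qed.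

Lemma rnsq_eigenrows m N (H : 'M[C]_N) (P : 'M[C]_(m, N)) lam (c : 'rV_m) :
  eigenrows H P lam -> rnsq (c *m P *m H) = \sum_i lam i * sqn (c 0 i).
Proof.
move=> [uP PA]; apply: (@complexI R); rewrite rnsqE.
have -> : c *m P *m H *m (c *m P *m H)^t*%sesqui =
    c *m (P *m (H *m H^t*%sesqui) *m P^t*%sesqui) *m c^t*%sesqui.
  by rewrite !trmx_mul !map_mxM /= !mulmxA.
have /unitarymxP PP := uP.
rewrite PA -[diag_mx _ *m P *m _]mulmxA PP mulmx1 mxE rmorph_sum.
apply: eq_bigr => i _ /=.
by rewrite mul_mx_diag !mxE mulrAC -sqnE -rmorphM mulrC.
Qed.

Lemma eigenrows_sub m m' N (H : 'M[C]_N) (P : 'M[C]_(m, N)) lam (g : 'I_m' -> 'I_m) :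
  injective g -> eigenrows H P lam -> eigenrows H (rowsub g P) (lam \o g).
Proof.
move=> gi [uP PA]; split.
  apply/row_unitarymxP => i j; rewrite !row_rowsub.
  by have /row_unitarymxP -> := uP; rewrite (inj_eq gi).
apply/row_matrixP => i; rewrite row_mul row_rowsub -row_mul PA !row_diag_mul.
by rewrite row_rowsub !mxE.
Qed.

Lemma eigenrow_lam m N (H : 'M[C]_N) (P : 'M[C]_(m, N)) lam i : eigenrows H P lam ->
  rnsq (row i P *m H) = lam i.
Proof.
move=> eP; rewrite rowE (rnsq_eigenrows _ eP) (bigD1 i) //= big1 => [|j ji].
  by rewrite mxE !eqxx addr0 /sqn /= expr1n expr0n addr0 mulr1.
by rewrite mxE (negbTE ji) andbF /sqn /= expr0n addr0 mulr0.
Qed.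

(** In the basis of eigenvectors [a] has coordinates only for eigenvalues at
    most [s2], and the weighted sum of their squared moduli reaches its
    largest possible value only if the other eigenvalues do not occur. *)
Lemma eigen_of_extremal N (H P : 'M[C]_N) lam (s2 : R) (a : 'rV[C]_N) :
  eigenrows H P lam ->
  (forall i, s2 < lam i -> (a *m P^t*%sesqui) 0 i = 0) ->
  s2 * rnsq a <= rnsq (a *m H) -> a *m (H *m H^t*%sesqui) = s2%:C *: a.
Proof.
move=> eP; have [uP PA] := eP; set c := a *m _ => c0.
have aE : a = c *m P by rewrite /c -mulmxA -invmx_unitary // mulVmx ?mulmx1 ?unitarymx_unit.
clearbody c; rewrite aE (rnsq_eigenrows _ eP) rnsq_unitary // /rnsq mulr_sumr -subr_ge0 -sumrB => h.
have t0 i : 0 <= s2 * sqn (c 0 i) - lam i * sqn (c 0 i).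
  rewrite -mulrBl; have [/c0 ->|h1] := ltP s2 (lam i).
    by rewrite /sqn /= expr0n addr0 mulr0.
  by rewrite mulr_ge0 ?sqn_ge0 // subr_ge0.
have : \sum_i (s2 * sqn (c 0 i) - lam i * sqn (c 0 i)) = 0.
  apply/eqP; rewrite eq_le sumr_ge0 // andbT -oppr_ge0 -sumrN.
  by under eq_bigr do rewrite opprB.
move/eqP; rewrite psumr_eq0 // => /allP hz.
rewrite -mulmxA PA mulmxA scalemxAl; congr (_ *m _); apply/rowP => i.
rewrite mul_mx_diag !mxE mulrC.
have := implyP (hz i (mem_index_enum _)) isT.
rewrite -mulrBl mulf_eq0 sqn_eq0 subr_eq0 => /orP[/eqP -> //|/eqP ->].
by rewrite !mulr0.
Qed.

(** The value [lam i0] is the one of index [k], from 0, in decreasing order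
    with repetitions: the largest value reached by more than [k] indices. *)
Lemma pick_level N (lam : 'I_N -> R) k : (k < N)%N ->
  exists i0, (#|[pred i | (lam i0 < lam i)%R]| <= k)%N /\
             (k < #|[pred i | (lam i0 <= lam i)%R]|)%N.
Proof.
case: N lam => // N lam kN.
pose cnt i := #|[pred j | (lam i <= lam j)%R]|.
case: (arg_minP lam (P := predT) (i0 := ord0)) => // imin _ hmin.
have Pmin : (k < cnt imin)%N.
  rewrite /cnt (_ : #|_| = N.+1) // -[RHS]card_ord; apply: eq_card => j.
  by rewrite !inE hmin.
case: (arg_maxP lam (P := fun i => (k < cnt i)%N) Pmin) => i0 Pi0 hmax.
exists i0; split => //; rewrite leqNgt; apply/negP => hk.
have [i1 hi1] : exists i1, lam i0 < lam i1.
  by have /card_gt0P[i1] := leq_ltn_trans (leq0n k) hk; exists i1.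
case: (arg_minP lam (P := fun i => lam i0 < lam i) hi1) => i2 hi2 hmin2.
have : (k < cnt i2)%N.
  by apply: leq_trans hk _; apply: subset_leq_card; apply/fintype.subsetP.
by move/hmax => /(lt_le_trans hi2); rewrite ltxx.
Qed.

End SingularValues.

(** * The Hankel matrix of a trigonometric polynomial *)
Section HankelMatrix.
Variable R : realType.
Local Notation C := R[i].
Implicit Types (u w x : C -> C).

(** The coefficient of index [- (i + j).+1] of [trigpoly N F]: this is the
    matrix of its Hankel operator between powers of [z] and conjugates of
    positive powers of [z]. *)
Definition hankel_mx N (F : {poly C}) : 'M[C]_N :=
  \matrix_(i, j) if (i + j < N)%N then F`_(N - (i + j).+1) else 0.

Lemma hankel_mx_sym N F : (hankel_mx N F)^T = hankel_mx N F.
Proof. by apply/matrixP => i j; rewrite !mxE addnC. Qed.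

Definition coefvec N u : 'rV[C]_N := \row_j fourier u j%:Z.

Lemma sum_support (f : nat -> C) n m : (forall l, (n <= l)%N -> f l = 0) ->
  (forall l, (m <= l)%N -> f l = 0) -> \sum_(l < n) f l = \sum_(l < m) f l.
Proof.
wlog nm : n m / (n <= m)%N.
  move=> h hn hm; have [nm|/ltnW mn] := leqP n m; first exact: h.
  by apply/esym; exact: h.
move=> hn _; rewrite -!(big_mkord xpredT) [RHS](@big_cat_nat _ _ _ n) //=.
rewrite [X in _ = _ + X]big_nat_cond [X in _ = _ + X]big1 ?addr0 // => l.
by rewrite andbT => /andP[/hn].
Qed.

(** The coefficients of [u] of index at least [N] contribute to nonnegative
    frequencies only. *)
Lemma fourier_trigpolyM N F u (i : 'I_N) : hardy1 u ->
  fourier (fun z => trigpoly N F z * u z) (Negz i) =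
  (coefvec N u *m hankel_mx N F) 0 i.
Proof.
move=> [hu fu].
have iN := ltn_ord i.
pose c (l : nat) := fourier u (Negz i - (l%:Z - N%:Z)).
transitivity (\sum_(l < size F) F`_l * c l).
  rewrite (@fourier_eq _ _ (fun z => \sum_(l < size F) F`_l * (z ^ (l%:Z - N%:Z) * u z))).
    rewrite fourier_sum => [|l]; last by apply: L1TZ; exact: L1TM (bddT_exprz _ _) hu.
    apply: eq_bigr => l _; rewrite fourierZ; last exact: L1TM (bddT_exprz _ _) hu.
    by rewrite fourier_exprzM.
  move=> t; rewrite /trigpoly horner_coef !mulr_suml; apply: eq_bigr => l _.
  by rewrite mulrA expfzDr ?expi_neq0 // exprnN mulrA.
rewrite (@sum_support (fun l => F`_l * c l) (size F) (N - i)); last 2 first.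
- by move=> l hl; rewrite nth_default ?mul0r.
- move=> l hl; rewrite /c fu ?mulr0 // NegzE.
  by move: hl iN; move: (nat_of_ord i) => j; lia.
pose h (j : nat) := if (j + i < N)%N then fourier u j%:Z * F`_(N - (j + i).+1) else 0.
have -> : (coefvec N u *m hankel_mx N F) 0 i = \sum_(j < N) h j.
  by rewrite mxE; apply: eq_bigr => j _; rewrite !mxE /h; case: ifP; rewrite ?mulr0.
rewrite (@sum_support h N (N - i)) => [|l hl|l hl].
- rewrite [LHS](reindex_inj rev_ord_inj) /=; apply: eq_bigr => j _.
  have jN := ltn_ord j; rewrite /h ifT; last by lia.
  rewrite mulrC; congr (_ * _); first by congr (fourier u _); lia.
  by congr (F`_ _); lia.
- by rewrite /h ifF //; lia.
- by rewrite /h ifF //; lia.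
Qed.

(** The matrix vanishes below its antidiagonal, whose entries are all [F`_0]. *)
Lemma hankel_mx_inj N (F : {poly C}) (a : 'rV[C]_N) : F`_0 != 0 -> a *m hankel_mx N F = 0 -> a = 0.
Proof.
move=> F0 aH; apply/rowP => i; rewrite mxE.
have [l] := ubnP (nat_of_ord i); elim: l i => // l IH i il.
have iN := ltn_ord i.
have rN : (N - i.+1 < N)%N by lia.
have := congr1 (fun B : 'rV_N => B 0 (Ordinal rN)) aH; rewrite !mxE.
rewrite (bigD1 i) //= big1 => [|j ji].
  rewrite addr0 mxE /= ifT; last by lia.
  rewrite (_ : (N - (i + (N - i.+1)).+1 = 0)%N); last by lia.
  by move/eqP; rewrite mulf_eq0 (negbTE F0) orbF => /eqP.
rewrite mxE /=; have [jlt|] := ltnP j i; first by rewrite IH ?mul0r //; lia.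
rewrite leq_eqVlt => /orP[/eqP e|ij].
  by move: ji; rewrite -val_eqE /= e eqxx.
by rewrite ifF ?mulr0 //; lia.
Qed.

Lemma nsq_horner (P : {poly C}) N : (size P <= N)%N ->
  nsq (fun z => P.[z]) = \sum_(i < N) sqn P`_i.
Proof.
move=> PN; apply: (@complexI R); rewrite -dotT_nsq.
rewrite (@dotT_eq _ _ (fun z => P.[z]) _ (trigpoly 0 P)) //; last first.
  by move=> t; rewrite /trigpoly expr0 divr1.
rewrite dotT_trigpoly; last exact: L2T_bdd (bddT_horner P).
rewrite rmorph_sum /= (@sum_support (fun i => (sqn P`_i)%:C) N (size P)) => [|l hl|l hl].
- apply: eq_bigr => i _; rewrite fourier_horner subr0.
  by rewrite sqnE mulrC.
- by rewrite nth_default ?(leq_trans PN) // /sqn /= expr0n addr0.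
- by rewrite nth_default // /sqn /= expr0n addr0.
Qed.

Lemma nsq_rVpoly N (a : 'rV[C]_N) : nsq (fun z => (rVpoly a).[z]) = rnsq a.
Proof.
rewrite (@nsq_horner _ N) ?size_poly //.
by apply: eq_bigr => i _; rewrite coef_rVpoly_ord.
Qed.

Lemma bessel N u : L2T u -> rnsq (coefvec N u) <= nsq u.
Proof.
move=> hu; set q := rVpoly (coefvec N u).
have hq : L2T (fun z => q.[z]) by exact: L2T_bdd (bddT_horner q).
have : 0 <= nsq (fun z => u z - q.[z]) by exact: nsq_ge0.
rewrite nsqB // nsq_rVpoly.
have -> : dotT u (fun z => q.[z]) = (rnsq (coefvec N u))%:C.
  rewrite (@dotT_eq _ _ u _ (trigpoly 0 q)) //; last first.
    by move=> t; rewrite /trigpoly expr0 divr1.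
  rewrite dotT_trigpoly // rmorph_sum.
  rewrite (@sum_support (fun i => (q`_i)^* * fourier u (i%:Z - 0%:Z)) (size q) N) => [|l hl|l hl].
  - by apply: eq_bigr => i _; rewrite coef_rVpoly_ord subr0 mxE mulrC -sqnE.
  - by rewrite nth_default // conjC0 mul0r.
  - by rewrite nth_default ?conjC0 ?mul0r // (leq_trans (size_poly _ _)).
by rewrite /=; lra.
Qed.

End HankelMatrix.

(** * Hankel operators against operators of small rank *)
Section LowerBound.
Variable R : realType.
Local Notation C := R[i].
Implicit Types (f u w x : C -> C).

Lemma fourier_conj u k : L1T u -> fourier (fun z => (u z)^*) k = (fourier u (- k))^*.
Proof.
move=> hu; rewrite /fourier -integralT_conj; last exact: L1T_exprzM.
apply: integralT_eq => t; rewrite rmorphM /= opprK; congr (_ * _).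
by rewrite rmorphXz ?unitfE ?expi_neq0 //= expi_conj -exprz_inv.
Qed.

(** The first term collects the nonnegative frequencies of the product; the
    second one is the conjugate of a function with positive frequencies and
    collects the negative ones. *)
Lemma toeplitz_split N (F : {poly C}) (a : 'rV[C]_N) z : circle z ->
  trigpoly N F z * (rVpoly a).[z] = (drop_poly N (F * rVpoly a)).[z] +
    (z * (rVpoly (map_mx Num.conj (a *m hankel_mx N F))).[z])^*.
Proof.
move=> cz; have z0 := circle_neq0 cz; set X := rVpoly a.
rewrite /trigpoly mulrAC -hornerM -{1}(poly_take_drop N (F * X)).
rewrite hornerD hornerM hornerXn mulrDl mulfK ?expf_neq0 // addrC; congr (_ + _).
rewrite (horner_coef_wide _ (size_take_poly N (F * X))).
rewrite (horner_coef_wide _ (size_poly _ _ : (size (rVpoly _) <= N)%N)).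
rewrite mulr_suml mulr_sumr rmorph_sum (reindex_inj rev_ord_inj) /=.
apply: eq_bigr => i _; have iN := ltn_ord i.
rewrite !rmorphM rmorphXn /= (circle_conj cz) coef_rVpoly_ord mxE conjCK.
have -> : (take_poly N (F * X))`_(N - i.+1) = (a *m hankel_mx N F) 0 i.
  rewrite coef_take_poly ifT; last by lia.
  pose h (j : nat) := if (j + i < N)%N then X`_j * F`_(N - (j + i).+1) else 0.
  transitivity (\sum_(j < N) h j); last first.
    rewrite mxE; apply: eq_bigr => j _.
    by rewrite !mxE /h coef_rVpoly_ord; case: ifP; rewrite ?mulr0.
  rewrite mulrC coefM (@sum_support _ h N (N - i.+1).+1) => [|l hl|l hl].
  - apply: eq_bigr => j _; have jN := ltn_ord j.
    by rewrite /h ifT; [congr (_ * F`_ _); lia|lia].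
  - by rewrite /h ifF //; lia.
  - by rewrite /h ifF //; lia.
rewrite -mulrA [RHS]mulrCA; congr (_ * _).
rewrite exprVn -invfM -exprS; apply: (mulIf (expf_neq0 N z0)).
have -> : z ^+ N = z ^+ (N - i.+1) * z ^+ i.+1 by rewrite -exprD subnK.
by rewrite divfK ?mulf_neq0 ?expf_neq0 // mulrCA mulVf ?mulr1 ?expf_neq0.
Qed.

Definition is_proj f v w := Hbar20 w /\
  forall e, Hbar20 e -> dotT (fun z => f z * v z - w z) e = 0.

Lemma hankel_projP f v w : is_proj f v w -> is_proj f v (hankel f v).
Proof.
by move=> h; rewrite /is_proj /hankel /Pminus /orth_proj; case: xgetP => [y _ //|/(_ w)[]].
Qed.

Lemma H2_poly (P : {poly C}) : H2 (fun z => P.[z]).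
Proof.
apply/H2P; split; first exact: L2T_bdd (bddT_horner P).
by move=> k k0; case: (hardy1_poly P) => _ ->.
Qed.

(** As [f] has negative frequencies only, those of the product are less than
    [size P], so the projection subtracts a polynomial. *)
Lemma hankel_poly_proj f (P : {poly C}) : Hbar20 f -> bddT f ->
  is_proj f (fun z => P.[z]) (hankel f (fun z => P.[z])).
Proof.
move=> /Hbar20P[hf ff] bf; set N := size P.
pose q := rVpoly (coefvec N (fun z => f z * P.[z])).
have hfP : L2T (fun z => f z * P.[z]) by exact: L2TM (L2T_bdd (bddT_horner P)).
have hq : L2T (fun z => q.[z]) by exact: L2T_bdd (bddT_horner q).
apply: (@hankel_projP _ _ (fun z => f z * P.[z] - q.[z])); split.
  apply/Hbar20P; split; first exact: L2TB.
  case=> // k _; rewrite fourierB; try exact: L2T_L1T.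
  rewrite fourier_horner; have [kN|kN] := ltnP k N.
    by rewrite (coef_rVpoly_ord _ (Ordinal kN)) mxE subrr.
  rewrite nth_default ?subr0 ?(leq_trans (size_poly _ _)) //.
  rewrite (@fourier_eq _ _ (fun z => \sum_(j < N) P`_j * (z ^ j%:Z * f z))); last first.
    move=> t; rewrite horner_coef mulr_sumr; apply: eq_bigr => j _.
    by rewrite mulrC -mulrA.
  have hj (j : 'I_N) : L1T (fun z => z ^ j%:Z * f z).
    exact: L1TM (bddT_exprz _ _) (L2T_L1T hf).
  rewrite fourier_sum; last by move=> j; exact: L1TZ.
  rewrite big1 // => j _; rewrite fourierZ // fourier_exprzM ff ?mulr0 //.
  by rewrite subr_ge0 lez_nat (leq_trans _ kN) // ltnW.
move=> e he; rewrite -(dotT_poly_Hbar20 q he); apply: dotT_eq => // t.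
by rewrite opprB addrC subrK.
Qed.

Lemma aeT_trans u w x : aeT u w -> aeT w x -> aeT u x.
Proof. by move=> uw wx; apply: ae_mono (ae_and uw wx) => t [-> ->]. Qed.

Lemma bounded_linear_sum (G : (C -> C) -> (C -> C)) m (c : 'I_m -> C)
    (x : 'I_m -> C -> C) : bounded_linear G -> (forall i, H2 (x i)) ->
  aeT (G (fun z => \sum_i c i * x i z)) (fun z => \sum_i c i * G (x i) z).
Proof.
move=> [GH Gae Glin _] Hx.
have H20 : H2 (fun=> 0 : C).
  by have := H2_poly 0; under eq_fun do rewrite horner0.
have Hsum (r : seq 'I_m) : H2 (fun z => \sum_(i <- r) c i * x i z).
  apply/H2P; split; first by apply: L2T_sum => i; apply: L2TZ; case/H2P: (Hx i).
  move=> k k0; rewrite fourier_sum => [|i]; last first.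
    by apply: L1TZ; case: (H2_hardy1 (Hx i)).
  rewrite big1 // => i _; rewrite fourierZ; last by case: (H2_hardy1 (Hx i)).
  by case: (H2_hardy1 (Hx i)) => _ ->; rewrite ?mulr0.
have G0 : aeT (G (fun=> 0)) (fun=> 0).
  have := Glin 1 _ _ H20 H20.
  rewrite (_ : (fun z => 1 * 0 + 0) = (fun=> 0 : C)); last first.
    by apply/funext => z; rewrite mulr0 addr0.
  apply: ae_mono => t /= h; apply: (addrI (G (fun=> 0) (expi t))).
  by rewrite addr0 {3}h mul1r.
elim: (index_enum _) => [|i r IH].
  by under eq_fun do rewrite big_nil; under [X in aeT _ X]eq_fun do rewrite big_nil.
under eq_fun do rewrite big_cons; under [X in aeT _ X]eq_fun do rewrite big_cons.
apply: aeT_trans (Glin (c i) _ _ (Hx i) (Hsum r)) _.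
by apply: ae_mono IH => t ->.
Qed.

(** Some unit combination [X] of the [m] polynomials given by the rows of [P]
    is mapped to 0 by [G], since its range is spanned by [k < m] elements. The
    Hankel matrix maps [X] to a vector of norm at least [s], and the Hankel
    operators of [f] and of [trigpoly N F] differ on [X] by at most [e]. *)
Lemma opnorm_lower f N (F : {poly C}) (e s : R) m k (P : 'M[C]_(m, N)) lam G :
  Hbar20 f -> bddT f ->
  (forall z, circle z -> normc (f z - trigpoly N F z) <= e) ->
  eigenrows (hankel_mx N F) P lam -> (forall i, s ^+ 2 <= lam i) -> 0 <= s ->
  0 <= e -> (k < m)%N -> bounded_linear G -> rank_le k G ->
  ((s - e)%:E <= opnorm (fun v => (hankel f v \- G v)%R))%E.
Proof.
move=> Hf bf fF eP slam s0 e0 km bG [d [Hd rG]].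
pose x (i : 'I_m) (z : C) := (rVpoly (row i P)).[z].
have Hx i : H2 (x i) by exact: H2_poly.
have [B hB] := choice (fun i => rG _ (Hx i)).
pose A : 'M[C]_(m, k) := \matrix_(i, l) B i l.
have [c0 c00 c0A] := exists_left_kernel A km.
have nc0 : 0 < rnsq c0 by rewrite lt_neqAle rnsq_ge0 andbT eq_sym rnsq_eq0.
pose c := ((Num.sqrt (rnsq c0))^-1)%:C *: c0.
have nc : rnsq c = 1.
  rewrite rnsqZ sqn_real exprVn sqr_sqrtr ?rnsq_ge0 // mulVf // gt_eqF //.
have cA : c *m A = 0 by rewrite -scalemxAl c0A scaler0.
pose a := c *m P; pose X := rVpoly a.
have XE : (fun z => X.[z]) = (fun z => \sum_i c 0 i * x i z).
  apply/funext => z; rewrite /X /a mulmx_sum_row linear_sum horner_sum.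
  by apply: eq_bigr => i _; rewrite linearZ hornerZ.
have GX : aeT (G (fun z => X.[z])) (fun=> 0).
  rewrite XE; apply: aeT_trans (bounded_linear_sum _ bG Hx) _.
  have := ae_forall (fun i => hB i); apply: ae_mono => t h.
  under eq_bigr do rewrite h mulr_sumr.
  rewrite exchange_big /= big1 // => l _.
  under eq_bigr do rewrite mulrA.
  rewrite -mulr_suml.
  have AE i : B i l = A i l by rewrite mxE.
  under eq_bigr do rewrite AE.
  have := congr1 (fun M : 'rV_k => M 0 l) cA.
  by rewrite mxE => ->; rewrite mxE mul0r.
have HX : H2 (fun z => X.[z]) := H2_poly X.
have L2X : L2T (fun z => X.[z]) := L2T_bdd (bddT_horner X).
have nX : nsq (fun z => X.[z]) = 1.
  by rewrite nsq_rVpoly /a; case: eP => uP _; rewrite rnsq_unitary.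
set Gam := hankel f (fun z => X.[z]).
have [HGam hGam] := hankel_poly_proj X Hf bf.
have /Hbar20P[L2Gam _] := HGam.
have L2GX : L2T (G (fun z => X.[z])).
  by case: bG => GH _ _ _; have /Hbar20P[] := GH _ HX.
apply: (@le_trans _ _ (normT 2%:E (Gam \- G (fun z => X.[z])))); last first.
  apply: ereal_sup_ubound; exists (fun z => X.[z]) => //; split => //.
  by rewrite normT2E // nX sqrtr1.
have L2d : L2T (Gam \- G (fun z => X.[z])) by exact: L2TB.
rewrite normT2E // lee_fin.
have -> : nsq (Gam \- G (fun z => X.[z])) = nsq Gam.
  apply: ae_nsq; [by case: L2d|by case: L2Gam|].
  by apply: ae_mono GX => t /= ->; rewrite subr0.
(* [y] is the image of [X] under the Hankel operator of the trigonometric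
   polynomial; it is compared with [Gam] by taking scalar products with [y]. *)
pose b := a *m hankel_mx N F.
pose Y := rVpoly (map_mx Num.conj b).
pose y (z : C) := (z * Y.[z])^*.
have by_ : bddT y.
  by apply: bddT_conj; apply: bddTM; [exact: bddT_eq (bddT_exprz R 1)|exact: bddT_horner].
have ny : nsq y = rnsq b.
  rewrite (@nsq_eq _ _ (fun z => (z * Y.[z])^*)) //.
  have -> : nsq (fun z => (z * Y.[z])^*) = nsq (fun z => Y.[z]).
    by apply: nsq_eq_sqn => t; rewrite sqn_conj sqnM sqn_expi mul1r.
  rewrite nsq_rVpoly /rnsq; apply: eq_bigr => j _; by rewrite mxE sqn_conj.
have L2y := L2T_bdd by_.
have Hy : Hbar20 y.
  apply/Hbar20P; split=> // k0 k00; rewrite fourier_conj; last first.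
    apply: L1T_bdd; apply: bddTM; last exact: bddT_horner.
    exact: bddT_eq (bddT_exprz R 1).
  rewrite (fourier_exprzM (fun z => Y.[z]) 1); case: (hardy1_poly Y) => _ ->.
    by rewrite conjC0.
  by rewrite subr_lt0 (le_lt_trans _ ltr01) // oppr_le0.
have bT := bddT_trigpoly N F.
have L2f : L2T (fun z => f z * X.[z]) by exact: L2TM.
have L2T' : L2T (fun z => trigpoly N F z * X.[z]) by exact: L2TM.
have L2dd : L2T (fun z => trigpoly N F z * X.[z] - f z * X.[z]) by exact: L2TB.
set p := drop_poly N (F * X).
have e1 : dotT (fun z => trigpoly N F z * X.[z]) y = (nsq y)%:C.
  rewrite (@dotT_eq _ _ (fun z => p.[z] + y z) _ y) //; last first.
    by move=> t; exact: (toeplitz_split F a (circle_expi t)).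
  rewrite dotTDl //; last exact: L2T_bdd (bddT_horner p).
  by rewrite dotT_poly_Hbar20 // add0r dotT_nsq.
have e2 : dotT (fun z => f z * X.[z]) y = dotT Gam y.
  by apply/eqP; rewrite -subr_eq0 -dotTBl // hGam.
have e3 : (nsq y)%:C = dotT Gam y +
    dotT (fun z => trigpoly N F z * X.[z] - f z * X.[z]) y.
  by rewrite dotTBl // e1 e2 addrC subrK.
have ne : nsq (fun z => trigpoly N F z * X.[z] - f z * X.[z]) <= e ^+ 2.
  have h : nsq (fun z => e%:C * X.[z]) = e ^+ 2 by rewrite nsqZ // nX mulr1 sqn_real.
  rewrite -h; apply: le_nsq => //; first exact: L2TZ.
  move=> t; rewrite -mulrBl !sqnM ler_wpM2r ?sqn_ge0 // sqn_real -normc_sqr.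
  rewrite lerXn2r ?nnegrE ?normc_ge0 // -normcN opprB.
  exact: fF (circle_expi t).
have ys : s ^+ 2 <= nsq y.
  rewrite ny /b /a (rnsq_eigenrows _ eP) -[s ^+ 2]mulr1 -nc /rnsq mulr_sumr.
  by apply: ler_sum => i _; rewrite ler_wpM2r ?sqn_ge0.
have key : Num.sqrt (nsq y) * Num.sqrt (nsq y) <=
    (Num.sqrt (nsq Gam) + e) * Num.sqrt (nsq y).
  rewrite -expr2 sqr_sqrtr ?nsq_ge0 //.
  rewrite -[leLHS]/(complex.Re (nsq y)%:C) e3 reD mulrDl; apply: lerD; first exact: CauchySchwarzT.
  apply: le_trans (CauchySchwarzT L2dd L2y) _.
  rewrite ler_wpM2r ?sqrtr_ge0 //.
  by rewrite -[leRHS]ger0_norm // -sqrtr_sqr ler_wsqrtr.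
have [s00|sn0] := eqVneq s 0.
  by rewrite s00 sub0r (le_trans _ (sqrtr_ge0 _)) // oppr_le0.
have sp : 0 < s by rewrite lt_neqAle eq_sym sn0.
have sy : s <= Num.sqrt (nsq y) by rewrite -[leLHS]ger0_norm // -sqrtr_sqr ler_wsqrtr.
rewrite lerBlDr; apply: (le_trans sy).
by rewrite -(ler_pM2r (x := Num.sqrt (nsq y))) // (lt_le_trans sp).
Qed.

End LowerBound.

(** * Polynomials compared on the circle *)
Section CirclePolynomials.
Variable R : realType.
Local Notation C := R[i].
Local Notation Re := complex.Re.
Local Notation Im := complex.Im.
Implicit Types (u w x : C -> C).

(** The function [z * D.[z]] has positive frequencies only and its conjugate
    negative ones. *)
Lemma real_poly_circle0 (D : {poly C}) :
  (forall z, circle z -> (z * D.[z])^* = z * D.[z]) -> D = 0.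
Proof.
move=> hD; apply/polyP => j; rewrite coef0.
have hz : L1T (fun z => z * D.[z]).
  by apply: L1T_bdd; apply: bddTM; [exact: bddT_eq (bddT_exprz R 1)|exact: bddT_horner].
have sh (k : int) : fourier (fun z => z * D.[z]) k = fourier (fun z => D.[z]) (k - 1).
  exact: (fourier_exprzM (fun z => D.[z]) 1 k).
have -> : D`_j = fourier (fun z => z * D.[z]) (j%:Z + 1).
  by rewrite sh addrK fourier_horner.
rewrite -(@fourier_eq _ (fun z => (z * D.[z])^*)); last first.
  by move=> t; exact: hD (circle_expi t).
rewrite fourier_conj // sh; case: (hardy1_poly D) => _ ->; first by rewrite conjC0.
by lia.
Qed.

(** Continuity along the parametrization, stated by components so that it only
    involves real functions. *)
Definition ccont u := continuous (fun t => Re (u (expi t))) /\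
  continuous (fun t => Im (u (expi t))).

Lemma continuous_ext (g h : R -> R) : g =1 h -> continuous g -> continuous h.
Proof. by move=> /funext ->. Qed.

Lemma continuous_add (g h : R -> R) : continuous g -> continuous h ->
  continuous (fun t => g t + h t).
Proof. by move=> cg ch t; apply: continuousD; [exact: cg|exact: ch]. Qed.

Lemma continuous_mul (g h : R -> R) : continuous g -> continuous h ->
  continuous (fun t => g t * h t).
Proof. by move=> cg ch t; apply: continuousM; [exact: cg|exact: ch]. Qed.

Lemma continuous_sub (g h : R -> R) : continuous g -> continuous h ->
  continuous (fun t => g t - h t).
Proof. by move=> cg ch t; apply: continuousB; [exact: cg|exact: ch]. Qed.

Lemma ccontM u w : ccont u -> ccont w -> ccont (fun z => u z * w z).
Proof.
move=> [u1 u2] [w1 w2]; split.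
  apply: continuous_ext (continuous_sub (continuous_mul u1 w1) (continuous_mul u2 w2)).
  by move=> t; rewrite reM.
apply: continuous_ext (continuous_add (continuous_mul u1 w2) (continuous_mul u2 w1)).
by move=> t; rewrite imM.
Qed.

Lemma ccont_cst (c : C) : ccont (fun=> c).
Proof. by split=> t; exact: cst_continuous. Qed.

Lemma ccontD u w : ccont u -> ccont w -> ccont (fun z => u z + w z).
Proof.
move=> [u1 u2] [w1 w2]; split.
  by apply: continuous_ext (continuous_add u1 w1) => t; rewrite reD.
by apply: continuous_ext (continuous_add u2 w2) => t; rewrite imD.
Qed.

Lemma ccont_horner (P : {poly C}) : ccont (fun z => P.[z]).
Proof.
elim/poly_ind: P => [|P c IH].
  by rewrite (_ : (fun z => _) = (fun=> 0)); [exact: ccont_cst|apply/funext => z; rewrite horner0].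
rewrite (_ : (fun z => _) = (fun z => P.[z] * z + c)); last first.
  by apply/funext => z; rewrite hornerMXaddC.
apply: ccontD; last exact: ccont_cst.
by apply: ccontM => //; split; [exact: continuous_cos|exact: continuous_sin].
Qed.

Lemma continuous_sqn u : ccont u -> continuous (fun t => sqn (u (expi t))).
Proof.
move=> [u1 u2].
exact: (continuous_add (continuous_mul u1 u1) (continuous_mul u2 u2)).
Qed.

(** At a root of [d] where the inequality failed it would fail on a whole arc
    by continuity; then [d] would vanish on this arc and have too many roots. *)
Lemma poly_le_cancel (A B d : {poly C}) : d != 0 ->
  (forall z, circle z -> sqn (A.[z] * d.[z]) <= sqn (B.[z] * d.[z])) ->
  forall z, circle z -> sqn A.[z] <= sqn B.[z].
Proof.
move=> d0 hAB z /circleP[t0 _ ->]; rewrite leNgt; apply/negP => lt.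
pose g t := sqn A.[expi t] - sqn B.[expi t].
have cg : continuous g.
  exact: (continuous_sub (continuous_sqn (ccont_horner A))
    (continuous_sqn (ccont_horner B))).
have g0 : 0 < g t0 by rewrite subr_gt0.
have /cvgrPdist_lt /(_ _ g0) /nbhs_ballP[e /= e0 he] := cg t0.
have hd t : `|t0 - t| < e -> root d (expi t).
  move=> /he; rewrite ltr_norml => /andP[_ h].
  have gt : 0 < g t by lra.
  have := hAB _ (circle_expi t); rewrite !sqnM => h2.
  rewrite /root -sqn_eq0 eq_le sqn_ge0 andbT leNgt; apply/negP => d1.
  by move: h2; rewrite ler_pM2r // leNgt -subr_gt0 gt.
(* [size d] points of the arc, shorter than 1 so that they are distinct. *)
pose M := size d; pose del : R := Num.min e 1 / 2.
have del0 : 0 < del by rewrite divr_gt0 // lt_min e0 ltr01.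
have [de d1] : del < e /\ del < 1.
  have := ge_min e e 1; have := ge_min 1 e 1; rewrite !lexx orbT /= => h1 h2.
  by rewrite /del; split; lra.
pose pt (i : nat) := t0 + del * (i.+1%:R / M.+1%:R).
have fr i : (i < M)%N -> 0 < (i.+1%:R / M.+1%:R : R) <= 1.
  by move=> iM; rewrite divr_gt0 ?ltr0n //= ler_pdivrMr ?ltr0n // mul1r ler_nat ltnW.
pose rs := [seq expi (pt i) | i <- iota 0 M].
have rroot : all (root d) rs.
  rewrite /rs all_map; apply/allP => i; rewrite mem_iota /= add0n => iM; apply: hd.
  have /andP[f0 f1] := fr i iM; rewrite /pt opprD addNKr normrN.
  rewrite gtr0_norm; last exact: mulr_gt0.
  apply: (@le_lt_trans _ _ del) => //.
  by rewrite ler_piMr // ltW.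
have urs : uniq rs.
  rewrite map_inj_in_uniq ?iota_uniq // => i j; rewrite !mem_iota /= !add0n => iM jM.
  move=> /(congr1 (fun z0 : C => sqn (z0 - expi (pt j)))); rewrite subrr sqn_chord.
  rewrite sqn0 => h.
  have /andP[fi0 fi1] := fr i iM; have /andP[fj0 fj1] := fr j jM.
  apply/eqP/negPn/negP => ij.
  have : cos `|pt i - pt j| < 1.
    apply: cos_lt1.
      rewrite normr_gt0 subr_eq0; apply: contra ij => /eqP /addrI.
      move=> /(mulfI (lt0r_neq0 del0)) /(congr1 (fun y => y * M.+1%:R)).
      by rewrite !divfK ?pnatr_eq0 // => /eqP; rewrite eqr_nat eqSS.
    have p2 := pi_ge2 R; rewrite /pt opprD addrACA subrr add0r -mulrBr.
    rewrite normrM (gtr0_norm del0); apply: (@lt_trans _ _ 1); last by lra.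
    apply: (le_lt_trans _ d1); rewrite ler_piMr ?(ltW del0) //.
    move: (i.+1%:R / M.+1%:R) (j.+1%:R / M.+1%:R) fi0 fi1 fj0 fj1 => a b *.
    by rewrite ler_norml; apply/andP; split; lra.
  by rewrite cos_norm; lra.
have := max_poly_roots d0 rroot urs.
by rewrite size_map size_iota ltnn.
Qed.

End CirclePolynomials.

(** * Division by the denominator of a Blaschke product *)
Section BlaschkeDivision.
Variable R : realType.
Local Notation C := R[i].
Implicit Types (u : C -> C).

Lemma one_sub_conj_neq0 (x : C) t : normc x < 1 -> 1 - x^* * expi t != 0.
Proof.
move=> x1; rewrite subr_eq0; apply/eqP => h.
have : normc (1 : C) = 1 by rewrite normc1.
by rewrite h normcM normc_conj normc_expi mulr1 => h1; move: x1; rewrite h1 ltxx.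
Qed.

Lemma refl_div (x : C) z : x != 0 -> (1 - x^* * z)^-1 = - x^*^-1 / (z - x^*^-1).
Proof.
move=> x0; have xc : x^* != 0 by rewrite conjC_eq0.
have -> : 1 - x^* * z = - x^* * (z - x^*^-1) by field.
by rewrite invfM invrN.
Qed.

Lemma normc_reflV (x : C) : x != 0 -> normc x < 1 -> 1 < normc (x^*^-1).
Proof.
move=> x0 x1; rewrite normcV normc_conj invf_gt1 //.
by rewrite lt_neqAle normc_ge0 eq_sym normc_eq0 x0.
Qed.

(** The denominator of the Blaschke product with zeros [s]. On the circle it
    is [z ^+ size s] times the conjugate of the numerator. *)
Definition refl_prod (s : seq C) (z : C) : C := \prod_(x <- s) (1 - x^* * z).

(** The roots of the denominator are the reflections of the nonzero elements
    of [s], which are outside of the closed disk. *)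
Lemma hardy1_div_refl (s : seq C) u : (forall x, x \in s -> normc x < 1) ->
  hardy1 u -> hardy1 (fun z => u z / refl_prod s z).
Proof.
rewrite /refl_prod; elim: s => [|x s IH] hs hu.
  by apply: hardy1_eq hu => t; rewrite big_nil divr1.
have x1 : normc x < 1 by apply: hs; rewrite inE eqxx.
have {IH} hv : hardy1 (fun z => u z / \prod_(x <- s) (1 - x^* * z)).
  by apply: IH => // y ys; apply: hs; rewrite inE ys orbT.
have [x0|x0] := eqVneq x 0.
  apply: hardy1_eq hv => t; rewrite big_cons x0 conjC0 mul0r subr0 mul1r //.
have h := hardy1Z (- x^*^-1) (hardy1_div_out (normc_reflV x0 x1) hv).
apply: hardy1_eq h => t; rewrite big_cons invfM refl_div //.
by rewrite mulrCA -!mulrA; congr (_ * _); rewrite mulrCA; congr (_ * _); rewrite mulrC.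
Qed.

Lemma bddT_refl (s : seq C) : (forall x, x \in s -> normc x < 1) ->
  bddT (fun z => (refl_prod s z)^-1).
Proof.
rewrite /refl_prod; elim: s => [|x s IH] hs.
  by apply: bddT_eq (bddT_cst 1) => t; rewrite big_nil invr1.
have x1 : normc x < 1 by apply: hs; rewrite inE eqxx.
have {IH} hv : bddT (fun z => (\prod_(x <- s) (1 - x^* * z))^-1).
  by apply: IH => // y ys; apply: hs; rewrite inE ys orbT.
have [x0|x0] := eqVneq x 0.
  by apply: bddT_eq hv => t; rewrite big_cons x0 conjC0 mul0r subr0 mul1r.
have x2 := normc_reflV x0 x1.
have h := bddTM (bddTM (bddT_cst (- x^*^-1)) (bddT_XsubCV (negbT (gt_eqF x2)))) hv.
by apply: bddT_eq h => t; rewrite big_cons invfM refl_div.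
Qed.

Lemma refl_prod_neq0 (s : seq C) t : (forall x, x \in s -> normc x < 1) ->
  refl_prod s (expi t) != 0.
Proof.
move=> hs; rewrite /refl_prod prodf_seq_neq0; apply/allP => x xs /=.
exact/one_sub_conj_neq0/hs.
Qed.

Lemma conj_prod_XsubC (s : seq C) z : circle z ->
  (\prod_(x <- s) (z - x))^* = refl_prod s z / z ^+ size s.
Proof.
move=> cz; have z0 := circle_neq0 cz; rewrite /refl_prod.
elim: s => [|x s IH]; first by rewrite !big_nil conjC1 expr0 divr1.
rewrite !big_cons rmorphM /= IH rmorphB /= (circle_conj cz) exprS invfM.
rewrite mulrACA; congr (_ * _).
by rewrite mulrBl mul1r mulfK.
Qed.

End BlaschkeDivision.

(** * Schmidt pairs of the Hankel matrix *)
Section SchmidtPairs.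
Variable R : realType.
Local Notation C := R[i].
Variables (N : nat) (F : {poly C}) (s : R).
Hypothesis s0 : 0 < s.
Local Notation H := (hankel_mx N F).
Implicit Types (a b : 'rV[C]_N).

(** As the Hankel matrix is symmetric, its left and right singular vectors are
    conjugate to each other, which makes this notion symmetric in [a] and [b]. *)
Definition schmidt_pair a b :=
  a *m H = s%:C *: map_mx Num.conj b /\ b *m H = s%:C *: map_mx Num.conj a.

Lemma schmidt_pair_sym a b : schmidt_pair a b -> schmidt_pair b a.
Proof. by case. Qed.

Lemma schmidt_exists a : a *m (H *m H^t*%sesqui) = (s ^+ 2)%:C *: a ->
  exists b, schmidt_pair a b.
Proof.
have sC : s%:C != 0 :> C by rewrite -[0]/(0%:C) (inj_eq (@complexI R)) gt_eqF.
have cs : (s%:C)^* = s%:C :> C by rewrite -[LHS]/(conjc _) conjc_real.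
move=> aA; exists (s%:C^-1 *: map_mx Num.conj (a *m H)); split.
  rewrite map_mxZ /= map_mxCK fmorphV /= cs scalerA mulfV // scale1r //.
rewrite -scalemxAl.
have -> : map_mx Num.conj (a *m H) *m H = map_mx Num.conj (a *m (H *m H^t*%sesqui)).
  by rewrite mulmxA [RHS]map_mxM /= map_mxCK hankel_mx_sym.
rewrite aA map_mxZ /= scalerA; congr (_ *: _).
have -> : ((s ^+ 2)%:C : C)^* = s%:C ^+ 2.
  by rewrite -[LHS]/(conjc _) conjc_real rmorphXn.
by rewrite expr2 mulKf.
Qed.

Lemma schmidt_identity a b z : schmidt_pair a b -> circle z ->
  trigpoly N F z * (rVpoly a).[z] = (drop_poly N (F * rVpoly a)).[z] +
    s%:C * (z * (rVpoly b).[z])^*.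
Proof.
have cs : (s%:C)^* = s%:C :> C by rewrite -[LHS]/(conjc _) conjc_real.
move=> [ab _] cz; rewrite toeplitz_split // ab map_mxZ /= map_mxCK cs.
by rewrite linearZ hornerZ mulrCA rmorphM /= cs.
Qed.

(** Eliminating [trigpoly N F] between the identities for the two orders of
    the pair shows that [z * (p * w - q * v).[z]] is [s * (|v|^2 - |w|^2)] on
    the circle. This is real, so it vanishes by [real_poly_circle0]. *)
Lemma schmidt_modulus a b : schmidt_pair a b ->
  drop_poly N (F * rVpoly a) * rVpoly b = drop_poly N (F * rVpoly b) * rVpoly a /\
  forall z, circle z -> sqn (rVpoly a).[z] = sqn (rVpoly b).[z].
Proof.
move=> ab; set p := drop_poly _ _; set q := drop_poly _ (F * rVpoly b).
set v := rVpoly a; set w := rVpoly b.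
have key z : circle z -> z * (p * w - q * v).[z] = (s * (sqn v.[z] - sqn w.[z]))%:C.
  move=> cz; have z0 := circle_neq0 cz.
  have e1 := schmidt_identity ab cz; have e2 := schmidt_identity (schmidt_pair_sym ab) cz.
  rewrite hornerD hornerN !hornerM.
  have -> : p.[z] = trigpoly N F z * v.[z] - s%:C * (z * w.[z])^* by rewrite e1 addrK.
  have -> : q.[z] = trigpoly N F z * w.[z] - s%:C * (z * v.[z])^* by rewrite e2 addrK.
  have -> : (s * (sqn v.[z] - sqn w.[z]))%:C =
      s%:C * (v.[z] * (v.[z])^* - w.[z] * (w.[z])^*).
    by rewrite -!sqnE rmorphM rmorphB.
  rewrite !rmorphM /= (circle_conj cz).
  move: (v.[z]) (w.[z]) ((v.[z])^*) ((w.[z])^*) (trigpoly N F z) => v1 w1 v2 w2 t.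
  by field.
have D0 : p * w - q * v = 0.
  apply: real_poly_circle0 => z cz; rewrite key //.
  by rewrite -[LHS]/(conjc _) conjc_real.
split; first by apply/eqP; rewrite -subr_eq0 D0.
move=> z cz; have := key z cz; rewrite D0 horner0 mulr0 => /esym/eqP.
rewrite -[0]/(0%:C) (inj_eq (@complexI R)) mulf_eq0 gt_eqF //= subr_eq0.
by move/eqP.
Qed.

End SchmidtPairs.

(** * Poles in the disk of the approximant *)
Section InnerDegree.
Variable R : realType.
Local Notation C := R[i].

Lemma nsq_poly_eq0 (P : {poly C}) : nsq (fun z => P.[z]) = 0 -> P = 0.
Proof.
move=> h; apply/polyP => i; rewrite coef0.
have := nsq_horner (leqnn (size P)); rewrite h => /esym/eqP.
rewrite psumr_eq0 => [/allP hz|j _]; last exact: sqn_ge0.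
have [iP|iP] := ltnP i (size P); last by rewrite nth_default.
have := implyP (hz (Ordinal iP) (mem_index_enum _)) isT.
by rewrite sqn_eq0 => /eqP.
Qed.

(** Let [D] be the denominator of the Blaschke product with zeros [ins] and
    let [q] be a polynomial of size at most [size ins]. The function [x = z q
    v / D] has the modulus of a polynomial [y] on the circle, and the negative
    frequencies of [trigpoly N F * x] are those of [s (z y)^*], so the Hankel
    matrix multiplies its norm by [s]. With too many zeros, some nonzero [q]
    makes [x] orthogonal to the eigenvectors with eigenvalue above [s ^+ 2].
    By [eigen_of_extremal] its coefficients then form an eigenvector, which
    vanishes at 0 to a larger order than [a]. *)
Lemma inner_degree_le N (F : {poly C}) (s : R) (P : 'M[C]_N) lam
    (a b : 'rV[C]_N) l (c0 : C) (ins outs : seq C) (e : {poly C}) :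
  0 < s -> eigenrows (hankel_mx N F) P lam ->
  schmidt_pair F s a b -> a != 0 ->
  (forall j : 'I_N, (j < l)%N -> a 0 j = 0) ->
  (forall a' : 'rV[C]_N,
     a' *m (hankel_mx N F *m (hankel_mx N F)^t*%sesqui) = (s ^+ 2)%:C *: a' ->
     (forall j : 'I_N, (j <= l)%N -> a' 0 j = 0) -> a' = 0) ->
  c0 != 0 -> (forall x, x \in ins -> normc x < 1) ->
  rVpoly b = e * (c0 *: (\prod_(x <- ins) ('X - x%:P) *
                         \prod_(x <- outs) ('X - x%:P))) ->
  (size ins <= #|[pred i | (s ^+ 2 < lam i)%R]|)%N.
Proof.
move=> s0 eP ab a0 al amax c00 hin bE; rewrite leqNgt; apply/negP => hm.
set m := size ins in hm; set A := [pred i | _] in hm.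
set H := hankel_mx N F in eP amax.
set v := rVpoly a; set w := rVpoly b in bE.
have [_ vw] := schmidt_modulus s0 ab.
have v0 : v != 0.
  by apply: contra a0 => /eqP v0; rewrite -(rVpolyK a) -/v v0 linear0.
(* The candidates [x], with [q] first taken among the powers of [z]. *)
pose D := refl_prod ins.
have bD : bddT (fun z => (D z)^-1) := bddT_refl hin.
pose X (j : nat) (z : C) := ('X^(j.+1) * v).[z] / D z.
have hX j : hardy1 (X j) by exact: hardy1_div_refl hin (hardy1_poly _).
pose B : 'M[C]_(m, #|A|) :=
  \matrix_(j, i) (coefvec N (X j) *m P^t*%sesqui) 0 (enum_val i).
have [c c_neq0 cB] := exists_left_kernel B hm.
pose q := rVpoly c.
pose x (z : C) := (q * 'X * v).[z] / D z.
have xE t : x (expi t) = \sum_(j < m) c 0 j * X j (expi t).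
  rewrite /x /X; under eq_bigr do rewrite mulrA.
  rewrite -mulr_suml; congr (_ / _); rewrite !hornerM hornerX.
  rewrite (horner_coef_wide _ (size_poly _ _ : (size q <= m)%N)).
  rewrite -mulrA mulr_suml; apply: eq_bigr => j _.
  by rewrite hornerM hornerXn coef_rVpoly_ord exprSr !mulrA.
have hx : hardy1 x by exact: hardy1_div_refl hin (hardy1_poly _).
have bx : bddT x by exact: bddTM (bddT_horner _) bD.
pose xi := coefvec N x.
have xiE : xi = \sum_(j < m) c 0 j *: coefvec N (X j).
  apply/rowP => i; transitivity (fourier x i%:Z); first by rewrite [LHS]mxE.
  rewrite (@fourier_eq _ _ (fun z => \sum_(j < m) c 0 j * X j z) _ xE).
  rewrite fourier_sum; last by move=> j; apply: L1TZ; case: (hX j).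
  rewrite summxE; apply: eq_bigr => j _.
  by rewrite fourierZ ?mxE //; case: (hX j).
have xiA i : s ^+ 2 < lam i -> (xi *m P^t*%sesqui) 0 i = 0.
  move=> hi; have iA : i \in A by [].
  have := congr1 (fun M : 'rV_#|A| => M 0 (enum_rank_in iA i)) cB.
  rewrite mxE [in RHS]mxE => h; rewrite -[RHS]h xiE mulmx_suml summxE.
  apply: eq_bigr => j _; rewrite -scalemxAl mxE; congr (_ * _).
  by rewrite [RHS]mxE enum_rankK_in.
(* On the circle [qs] is the conjugate of [q] up to a power of [z], which
   cancels the one that relates [D] to its conjugate. *)
pose qs := rVpoly (\row_j (c 0 (rev_ord j))^* : 'rV[C]_m).
have m0 : (0 < m)%N by exact: leq_trans hm.
have qsE z : circle z -> (qs.[z])^* = q.[z] / z ^+ m.-1.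
  move=> cz; have z0 := circle_neq0 cz.
  rewrite (horner_coef_wide _ (size_poly _ _ : (size qs <= m)%N)).
  rewrite (horner_coef_wide _ (size_poly _ _ : (size q <= m)%N)).
  rewrite rmorph_sum mulr_suml (reindex_inj rev_ord_inj); apply: eq_bigr => j _ /=.
  rewrite rmorphM rmorphXn /= (circle_conj cz).
  rewrite (coef_rVpoly_ord _ (rev_ord j)) mxE rev_ordK conjCK coef_rVpoly_ord.
  rewrite -mulrA; congr (_ * _).
  have jm := ltn_ord j.
  have -> : z ^+ m.-1 = z ^+ (m - j.+1) * z ^+ j.
    by rewrite -exprD; congr (_ ^+ _); lia.
  by rewrite invfM mulrCA mulfV ?mulr1 ?exprVn // expf_neq0.
pose Qo := c0 *: \prod_(x <- outs) ('X - x%:P).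
pose y := e * Qo * qs.
have wE : w = e * Qo * \prod_(x <- ins) ('X - x%:P).
  by rewrite bE /Qo -mulrA -scalerAl; congr (_ * (_ *: _)); rewrite mulrC.
have w0 : w != 0.
  apply: contra v0 => /eqP w0; apply/eqP/nsq_poly_eq0.
  rewrite (@nsq_eq_sqn _ _ (fun z => w.[z])); last first.
    by move=> t; exact: vw (circle_expi t).
  by rewrite w0 (@nsq_horner _ _ 0%N) ?size_poly0 // big_ord0.
have eQ0 : e * Qo != 0 by apply: contraNneq w0 => h; rewrite wE h mul0r.
have sy : (size y <= N)%N.
  have sw : (size w <= N)%N by exact: size_poly.
  have ww : size w = (size (e * Qo)%R + m)%N.
    rewrite wE [LHS]size_Mmonic ?eQ0 ?monic_prod_XsubC //.
    have -> : size (\prod_(x <- ins) ('X - x%:P)) = m.+1 by exact: size_prod_XsubC.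
    by rewrite addnS.
  have sq : (size qs <= m)%N by exact: size_poly.
  apply: leq_trans (size_polyMleq (e * Qo) qs) _.
  rewrite ww in sw; apply: leq_trans sw; apply: leq_trans (leq_pred _) _.
  by rewrite leq_add2l.
have ywE z : circle z -> (w.[z])^* * (q * 'X).[z] / D z = (y.[z])^*.
  move=> cz; have z0 := circle_neq0 cz; have [t _ zt] := circleP cz.
  have D0 : D z != 0 by rewrite zt; exact: refl_prod_neq0.
  rewrite wE /y !hornerM hornerX !rmorphM /= qsE //.
  have em : z ^+ m = z * z ^+ m.-1 by rewrite -exprS prednK.
  rewrite horner_prod_XsubC conj_prod_XsubC // -/m -/(D z) em.
  have : z ^+ m.-1 != 0 by rewrite expf_neq0.
  move: (z ^+ m.-1) (D z) D0 (e.[z]^*) (Qo.[z]^*) (q.[z]) => zm Dz D0 a1 a2 a3 zm0.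
  by field; rewrite D0 z0 zm0.
have xD z : x z = (q * 'X).[z] * v.[z] / D z by rewrite /x hornerM.
clearbody x.
have sqx t : sqn (x (expi t)) = sqn y.[expi t].
  rewrite -[RHS]sqn_conj -(ywE _ (circle_expi t)) xD.
  by rewrite !sqnM sqn_conj -(vw _ (circle_expi t)) -/v [_ * sqn v.[_]]mulrC.
have nxy : nsq x = nsq (fun z => y.[z]) by exact: nsq_eq_sqn.
pose p := drop_poly N (F * v).
have Tx t : trigpoly N F (expi t) * x (expi t) =
    (p * (q * 'X)).[expi t] / D (expi t) + s%:C * (expi t * y.[expi t])^*.
  have cz := circle_expi t.
  rewrite xD [_ * v.[_]]mulrC -[_ * _ / D _]mulrA [LHS]mulrA (schmidt_identity ab cz).
  rewrite -/v -/w -/p [(p * _).[_]]hornerM mulrDl; congr (_ + _); first by rewrite mulrA.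
  by rewrite !rmorphM /= -(ywE _ cz) -!mulrA.
have bzy : bddT (fun z => z * y.[z]).
  by apply: bddTM; [exact: bddT_eq (bddT_exprz R 1)|exact: bddT_horner].
have xiH (i : 'I_N) : (xi *m H) 0 i = s%:C * (y`_i)^*.
  rewrite -(fourier_trigpolyM F i hx).
  transitivity (fourier (fun z => (p * (q * 'X)).[z] / D z +
      s%:C * (z * y.[z])^*) (Negz i)); first exact: fourier_eq Tx.
  have hp : hardy1 (fun z => (p * (q * 'X)).[z] / D z).
    exact: hardy1_div_refl hin (hardy1_poly _).
  have hzy := L1T_conj (L1T_bdd bzy).
  rewrite fourierD; [|by case: hp|exact: L1TZ].
  rewrite (proj2 hp) // add0r fourierZ //; congr (_ * _).
  rewrite fourier_conj; last exact: L1T_bdd.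
  congr (_^*); rewrite (fourier_exprzM (fun z => y.[z]) 1).
  rewrite (_ : - Negz i - 1 = i%:Z) ?fourier_horner //.
  by rewrite NegzE opprK; lia.
have nH : rnsq (xi *m H) = s ^+ 2 * nsq x.
  rewrite nxy (nsq_horner sy) /rnsq mulr_sumr; apply: eq_bigr => i _.
  by rewrite xiH sqnM sqn_conj sqn_real.
have xieig : xi *m (H *m H^t*%sesqui) = (s ^+ 2)%:C *: xi.
  apply: (eigen_of_extremal eP xiA); rewrite nH ler_wpM2l ?sqr_ge0 //.
  by apply: bessel; exact: L2T_bdd.
have xi0 : xi = 0.
  apply: amax xieig _ => j jl; rewrite mxE.
  have vl : v = drop_poly l v * 'X^l.
    rewrite -{1}(poly_take_drop l v) (_ : take_poly l v = 0) ?add0r //.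
    apply/polyP => i; rewrite coef_take_poly coef0; case: ifP => // il.
    have [iN|iN] := ltnP i N; last by rewrite nth_default // (leq_trans (size_poly _ _)).
    by rewrite (coef_rVpoly_ord _ (Ordinal iN)) al.
  pose h (z : C) := (q * drop_poly l v).[z] / D z.
  have hh : hardy1 h by exact: hardy1_div_refl hin (hardy1_poly _).
  rewrite (@fourier_eq _ _ (fun z => z ^+ l.+1 * h z)).
    by rewrite fourier_exprnM (proj2 hh) //; lia.
  move=> t; rewrite xD vl /h !hornerM hornerX hornerXn exprS; ring.
have y0 : y = 0.
  apply: nsq_poly_eq0; rewrite -nxy; apply/eqP.
  have : s ^+ 2 * nsq x = 0 by rewrite -nH xi0 mul0mx /rnsq big1 // => i _; rewrite mxE /sqn /= expr0n addr0.
  by move/eqP; rewrite mulf_eq0 expf_eq0 /= gt_eqF.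
have qs0 : qs = 0 by move/eqP: y0; rewrite mulf_eq0 (negbTE eQ0) => /eqP.
move/negP: c_neq0; apply; apply/eqP/rowP => j.
have := congr1 (fun Q : {poly C} => Q`_(rev_ord j)) qs0.
rewrite coef0 coef_rVpoly_ord !mxE rev_ordK => /eqP.
by rewrite conjC_eq0 => /eqP.
Qed.

End InnerDegree.

(** * Approximation of trigonometric polynomials with few poles *)
Section BestApproximation.
Variable R : realType.
Local Notation C := R[i].

Lemma sqn_circleX (z : C) n : circle z -> sqn (z ^+ n) = 1.
Proof. by move=> cz; rewrite -normc_sqr normcX cz !expr1n. Qed.

(** Let [T] be [trigpoly N F] and [p] the polynomial part of [T v]. On the
    circle |T v - p| = s |w| = s |v|, so [p / v] is at distance [s] of [T]. In
    lowest terms it is [P / Q], and [Q] divides [w] because [p w = p' v]. *)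
Lemma schmidt_quotient N (F : {poly C}) (s : R) (a b : 'rV[C]_N) :
  0 < s -> schmidt_pair F s a b -> a != 0 ->
  exists P Q e : {poly C}, [/\ forall z, circle z -> ~~ root Q z,
    rVpoly b = e * Q &
    forall z, circle z -> sqn (trigpoly N F z - P.[z] / Q.[z]) <= s ^+ 2].
Proof.
move=> s0 ab a0; have [pw vw] := schmidt_modulus s0 ab.
set v := rVpoly a in pw vw; set w := rVpoly b in pw vw *.
set p := drop_poly N (F * v) in pw; set p' := drop_poly N (F * w) in pw.
have v0 : v != 0.
  by apply: contra a0 => /eqP v0; rewrite -(rVpolyK a) -/v v0 linear0.
pose d := gcdp p v; pose P := p %/ d; pose Q := v %/ d.
have d0 : d != 0 by rewrite gcdp_eq0 negb_and v0 orbT.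
have pE : p = P * d by rewrite divpK // dvdp_gcdl.
have vE : v = Q * d by rewrite divpK // dvdp_gcdr.
have cPQ : coprimep Q P.
  by rewrite coprimep_sym coprimep_div_gcd // v0 orbT.
have /dvdpP[e wE] : Q %| w.
  rewrite -(Gauss_dvdpr _ cPQ); apply/dvdpP; exists p'.
  by apply: (mulIf d0); rewrite -[RHS]mulrA -vE -pw pE mulrAC.
have key z : circle z -> sqn (F * Q - 'X^N * P).[z] <= sqn (s%:C *: Q).[z].
  move: z; apply: (poly_le_cancel d0) => z cz.
  have z0 := circle_neq0 cz.
  have h : (F * Q - 'X^N * P).[z] * d.[z] = z ^+ N * (s%:C * (z * w.[z])^*).
    have := schmidt_identity ab cz; rewrite -/v -/w -/p /trigpoly => h.
    have -> : s%:C * (z * w.[z])^* = F.[z] / z ^+ N * v.[z] - p.[z].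
      by rewrite h [p.[z] + _]addrC addrK.
    rewrite pE vE hornerD hornerN !hornerM hornerXn.
    by field; rewrite expf_neq0.
  have -> : sqn ((s%:C *: Q).[z] * d.[z]) = s ^+ 2 * sqn w.[z].
    by rewrite -vw // vE hornerZ hornerM -mulrA [LHS]sqnM sqn_real.
  rewrite h !sqnM sqn_conj sqnM sqn_real sqn_circleX //.
  by rewrite -[z]expr1 sqn_circleX // !mul1r.
have noroot z : circle z -> ~~ root Q z.
  move=> cz; apply/negP => rz; have := coprimep_root cPQ rz.
  have := key z cz; rewrite hornerD hornerN !hornerM hornerZ (rootP rz) !mulr0 add0r.
  rewrite sqn0 => h; have : sqn (- ('X^N.[z] * P.[z])) == 0 by rewrite eq_le h sqn_ge0.
  rewrite sqn_eq0 oppr_eq0 mulf_eq0 hornerXn expf_eq0 (negbTE (circle_neq0 cz)) andbF /=.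
  by move=> ->.
exists P, Q, e; split => //.
move=> z cz; have z0 := circle_neq0 cz; have rz : Q.[z] != 0 := noroot z cz.
  rewrite -(ler_pM2r (x := sqn Q.[z])); last by rewrite lt_neqAle sqn_ge0 andbT eq_sym sqn_eq0.
  have := key z cz; rewrite hornerZ [X in _ <= X]sqnM sqn_real; apply: le_trans.
  rewrite -sqnM -[X in X <= _]mul1r -(sqn_circleX N cz) -sqnM le_eqVlt; apply/orP; left.
  apply/eqP; congr sqn; rewrite hornerD hornerN !hornerM hornerXn /trigpoly.
  by field; rewrite rz expf_neq0.
Qed.

Lemma Hinf_bdd (u : C -> C) : bddT u -> hardy1 u -> Hinf u.
Proof.
move=> [mu1 [M uM]] [_ hu]; split=> //; split=> //.
by apply: (@le_lt_trans _ _ M%:E); [apply: normTy_le; exact: (aeW (arclength R) uM)|rewrite ltry].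
Qed.

(** The factors with roots in the disk are completed to a Blaschke product by
    [refl_prod ins], and the rest of the quotient is bounded and analytic. *)
Lemma Hinf_rat k (P : {poly C}) (c : C) (ins outs : seq C) :
  (size ins <= k)%N -> (forall x, x \in ins -> normc x < 1) ->
  (forall x, x \in outs -> 1 < normc x) ->
  exists2 h, Hinf_ k h & forall z, circle z -> h z =
    P.[z] / (c *: (\prod_(x <- ins) ('X - x%:P) * \prod_(x <- outs) ('X - x%:P))).[z].
Proof.
move=> ik hi ho.
pose g z := c^-1 * (P.[z] / (\prod_(x <- outs) (z - x)) / refl_prod ins z).
pose b z := 1 * \prod_(x <- ins) ((z - x) / (1 - x^* * z)).
exists (fun z => g z / b z).
  exists g, b; split=> //; last first.
    by exists 1, ins; split=> //; exact: normc1.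
  apply: Hinf_bdd.
    apply: bddTM (bddT_cst _) _; apply: bddTM (bddT_refl hi).
    apply: bddTM (bddT_horner _) (bddT_prod_XsubCV _) => x xo.
    by rewrite gt_eqF // ho.
  exact: hardy1Z (hardy1_div_refl hi (hardy1_div_outer ho (hardy1_poly P))).
move=> z cz; have [t _ zt] := circleP cz.
have r0 : refl_prod ins z != 0 by rewrite zt refl_prod_neq0.
rewrite /b mul1r prodf_div -/(refl_prod ins z) hornerZ hornerM !horner_prod_XsubC /g.
move: (refl_prod ins z) r0 => r r0; rewrite !invfM invrK.
move: c^-1 (\prod_(x <- ins) (z - x))^-1 (\prod_(x <- outs) (z - x))^-1 => x1 x2 x3.
by field.
Qed.

(** Among the eigenvectors for the level given by [pick_level], one with the
    largest order of vanishing at 0 is chosen, as [inner_degree_le] requires. *)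
Lemma aak_trigpoly N (F : {poly C}) k : (k < N)%N -> F`_0 != 0 ->
  exists s m (P : 'M[C]_(m, N)) lam h, [/\ 0 < s /\ (k < m)%N,
    eigenrows (hankel_mx N F) P lam, forall i, s ^+ 2 <= lam i, Hinf_ k h &
    forall z, circle z -> normc (trigpoly N F z - h z) <= s].
Proof.
move=> kN F0; set H := hankel_mx N F.
have [P [lam eP]] := eigenrows_exists H.
have [i0 [lt_k k_le]] := pick_level lam kN.
have uP : P \is unitarymx by case: eP.
have row0 i : row i P != 0.
  rewrite -rnsq_eq0 rnsq_row //; exact: oner_neq0.
have lam0 i : 0 < lam i.
  rewrite lt_neqAle -(eigenrow_lam i eP) rnsq_ge0 andbT eq_sym rnsq_eq0.
  by apply: contra (row0 i) => /eqP /(hankel_mx_inj F0) ->.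
pose s := Num.sqrt (lam i0).
have s0 : 0 < s by rewrite sqrtr_gt0.
have s2 : s ^+ 2 = lam i0 by rewrite sqr_sqrtr // ltW.
pose E (a : 'rV[C]_N) := a != 0 /\ a *m (H *m H^t*%sesqui) = (s ^+ 2)%:C *: a.
pose L l := `[< exists a, E a /\ forall j : 'I_N, (j < l)%N -> a 0 j = 0 >].
have exL : exists l, L l.
  exists 0%N; apply/asboolP; exists (row i0 P); do !split=> //.
  by rewrite -row_mul (proj2 eP) row_diag_mul mxE s2.
have bL l : L l -> (l <= N)%N.
  move=> /asboolP[a [[a0 _] al]]; rewrite leqNgt; apply/negP => Nl.
  by move/eqP: a0; apply; apply/rowP => j; rewrite mxE al // (ltn_trans _ Nl).
case: (ex_maxnP exL bL) => l /asboolP[a [[a0 aE] al]] lmax.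
have amax (a' : 'rV[C]_N) : a' *m (H *m H^t*%sesqui) = (s ^+ 2)%:C *: a' ->
    (forall j : 'I_N, (j <= l)%N -> a' 0 j = 0) -> a' = 0.
  move=> a'E a'l; apply/eqP; apply: contraT => a'0.
  have := lmax l.+1; rewrite ltnn ; apply; apply/asboolP.
  by exists a'.
have [b ab] := schmidt_exists s0 aE.
have [P0 [Q [e [Qroot bE le_s]]]] := schmidt_quotient s0 ab a0.
have [c [ins [outs [c0 _ hi ho QE]]]] := poly_circle_factor Qroot.
rewrite QE in bE.
have ik : (size ins <= k)%N.
  apply: leq_trans (inner_degree_le s0 eP ab a0 al amax c0 hi bE) _.
  by rewrite s2.
have [h Hh hE] := Hinf_rat P0 c ik hi ho.
pose A := [pred i | (lam i0 <= lam i)%R].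
exists s, #|A|, (rowsub (@enum_val _ A) P), (lam \o @enum_val _ A), h; split=> //.
- by apply: eigenrows_sub eP; exact: enum_val_inj.
- by move=> i; rewrite s2; have := enum_valP i.
- move=> z cz; rewrite hE // -QE -(ler_pXn2r (n := 2)) ?nnegrE ?normc_ge0 ?(ltW s0) //.
  by rewrite normc_sqr le_s.
Qed.

End BestApproximation.

(** * The theorem of Adamyan, Arov and Krein *)
Section AAK.
Variable R : realType.
Local Notation C := R[i].
Implicit Types (f u v w : C -> C).

Lemma bddT_continuous f : circle_measurable f -> continuousT f -> bddT f.
Proof.
move=> mf /bounded_continuousT[M _ hM]; split=> //.
by exists M => t; apply/hM/circle_expi.
Qed.

(** A trigonometric polynomial within [e / 2] of [f] costs [e / 2] in the
    upper bound for the distance and [e / 2] in the lower bound for the norm. *)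
Lemma dist_Hinf_le_opnorm f k G : Hbar20 f -> continuousT f ->
  bounded_linear G -> rank_le k G ->
  (distT +oo%E f (Hinf_ k) <= opnorm (fun v => (hankel f v \- G v)%R))%E.
Proof.
move=> Hf cf bG rG; have mf : circle_measurable f by case: Hf => -[].
have bf := bddT_continuous mf cf.
apply/lee_addgt0Pr => e e0; have e20 : 0 < e / 2 by rewrite divr_gt0.
have [N [F [kN F0 fF]]] := weierstrass k mf cf e20.
have [s [m [P [lam [h [[s0 km] eP slam Hh Fh]]]]]] := aak_trigpoly kN F0.
have lo := opnorm_lower Hf bf fF eP slam (ltW s0) (ltW e20) km bG rG.
apply: (@le_trans _ _ (s + e / 2)%:E).
  apply: ge_ereal_inf; exists (normT +oo%E (f \- h)); first by exists h.
  apply: normTy_le; apply: ae_all => t /=.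
  rewrite -(subrKA (trigpoly N F (expi t))) addrC.
  apply: le_trans (le_normcD _ _) _; apply: lerD; first exact: Fh (circle_expi t).
  exact: fF (circle_expi t).
rewrite (_ : s + e / 2 = (s - e / 2) + e); last by field.
by rewrite EFinD leeD2r.
Qed.

Lemma nsq0 : nsq (fun=> 0 : C) = 0.
Proof.
rewrite (@nsq_eq _ _ (fun z => 0 * 1)) => [|t]; last by rewrite mul0r.
by rewrite nsqZ ?sqn0 ?mul0r //; exact: L2T_bdd (bddT_cst 1).
Qed.

Lemma Hbar20_0 : Hbar20 (fun=> 0 : C).
Proof.
apply/Hbar20P; split; first exact: L2T_bdd (bddT_cst 0).
move=> k _; rewrite (@fourier_eq _ _ (fun z => 0 * 1)) => [|t]; last by rewrite mul0r.
by rewrite fourierZ ?mul0r //; exact: L1T_bdd (bddT_cst 1).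
Qed.

(** The projection does not increase norms, by Pythagoras; when there is none,
    the value selected for [hankel f v] is 0. *)
Lemma hankel_bound f v (M : R) : bddT f ->
  (forall t, normc (f (expi t)) <= M) -> H2 v ->
  L2T (hankel f v) /\ nsq (hankel f v) <= M ^+ 2 * nsq v.
Proof.
move=> bf fM /H2P[hv _]; have M0 : 0 <= M := le_trans (normc_ge0 _) (fM 0).
have h0 : L2T (fun=> 0 : C) by exact: L2T_bdd (bddT_cst 0).
rewrite /hankel /Pminus /orth_proj; case: xgetP => [w _ [Hw ow]|_]; last first.
  split=> //; rewrite (_ : nsq _ = 0) ?mulr_ge0 ?sqr_ge0 ?nsq_ge0 //.
  exact: nsq0.
have [lw _] := proj1 (Hbar20P _) Hw; split=> //.
have lfv : L2T (fun z => f z * v z) := L2TM bf hv.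
have lr : L2T (fun z => f z * v z - w z) := L2TB lfv lw.
have pyth : nsq (fun z => f z * v z) = nsq (fun z => f z * v z - w z) + nsq w.
  have := nsqD lr lw; rewrite (ow w Hw) mulr0 addr0 => <-.
  by apply: nsq_eq => t; rewrite subrK.
apply: (@le_trans _ _ (nsq (fun z => f z * v z))).
  by rewrite pyth lerDr nsq_ge0.
have -> : M ^+ 2 * nsq v = nsq (fun z => M%:C * v z) by rewrite nsqZ // sqn_real.
apply: le_nsq => //; first exact: L2TZ.
move=> t; rewrite !sqnM sqn_real ler_wpM2r ?sqn_ge0 // -normc_sqr.
by rewrite ler_pXn2r ?nnegrE ?normc_ge0.
Qed.

(** The zero operator is a competitor, and [fine] in the next theorem is then
    faithful. *)
Lemma singular_value_lty f k : Hbar20 f -> bddT f ->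
  (singular_value f k < +oo)%E.
Proof.
move=> Hf bf; have [_ [M fM]] := bf.
have M0 : 0 <= M := le_trans (normc_ge0 _) (fM 0).
have n0 : normT 2%:E (fun=> 0 : C) = 0%E.
  by rewrite normT2E ?nsq0 ?sqrtr0 //; exact: L2T_bdd (bddT_cst 0).
have H0 := Hbar20_0.
apply: (@le_lt_trans _ _ M%:E); last exact: ltry.
apply: ge_ereal_inf.
exists (opnorm (fun v => hankel f v \- (fun=> 0)%R)).
  exists (fun _ _ => 0) => //; split.
    split=> //.
    - by move=> *; apply: ae_all.
    - by move=> a v w _ _; apply: ae_all => t; rewrite mulr0 addr0.
    - apply: (@le_lt_trans _ _ 0%E); last exact: ltry.
      by apply: ge_ereal_sup => _ [v _ <-]; rewrite n0.
  exists (fun _ _ => 0); split=> // v _; exists (fun=> 0).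
  by apply: ae_all => t; rewrite big1 // => i _; rewrite mulr0.
apply: ge_ereal_sup => _ [v [Hv v1] <-].
have [lv _] := proj1 (H2P _) Hv; have [lh bh] := hankel_bound bf fM Hv.
have lh' : L2T (hankel f v \- (fun=> 0)).
  by apply: L2T_eq lh => t /=; rewrite subr0.
rewrite normT2E // lee_fin.
rewrite (@nsq_eq _ _ (hankel f v)); last by move=> t /=; rewrite subr0.
rewrite normT2E // lee_fin in v1.
apply: le_trans (ler_wsqrtr bh) _; rewrite sqrtrM ?sqr_ge0 // sqrtr_sqr ger0_norm //.
exact: ler_piMr.
Qed.

Theorem aak_distance f k : Hbar20 f -> continuousT f ->
  (distT +oo%E f (Hinf_ k) <= (fine (singular_value f k))%:E)%E.
Proof.
move=> Hf cf; have mf : circle_measurable f by case: Hf => -[].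
have h : (distT +oo%E f (Hinf_ k) <= singular_value f k)%E.
  apply: le_ereal_inf_tmp => _ [G [bG rG] <-].
  exact: dist_Hinf_le_opnorm.
have := singular_value_lty k Hf (bddT_continuous mf cf).
move: h; case: (singular_value f k) => [r| |] //= h _.
by apply: le_trans h _; rewrite leNye.
Qed.

End AAK.

(** * Distance to rational functions *)
Section RationalDistance.
Variable R : realType.
Local Notation C := R[i].
Local Notation mu := (arclength R).
Local Notation cmeas := (@circle_measurable R).
Implicit Types (f u v w : C -> C).

(** The variance of the [x i] is nonnegative. *)
Lemma sqr_sum_le n (x : 'I_n -> R) :
  (\sum_i x i) ^+ 2 <= n%:R * \sum_i x i ^+ 2.
Proof.
case: n => [|n] in x *; first by rewrite !big_ord0 expr0n mulr0.
set S := \sum_i x i; set T := \sum_i x i ^+ 2; pose m : R := n.+1%:R.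
have m0 : 0 < m by rewrite ltr0n.
have : 0 <= \sum_i (m * x i - S) ^+ 2 by apply: sumr_ge0 => i _; exact: sqr_ge0.
have -> : \sum_i (m * x i - S) ^+ 2 = m * (m * T - S ^+ 2).
  under eq_bigr => i _.
    rewrite (_ : _ ^+ 2 = m ^+ 2 * x i ^+ 2 + (- 2 * m * S) * x i + S ^+ 2); last by ring.
    over.
  rewrite !big_split /= -!mulr_sumr sumr_const card_ord -/S -/T -mulr_natl -/m.
  by ring.
by rewrite pmulr_rge0 // subr_ge0.
Qed.

(** Multiplying [a] by the sum of the [c j * m j] gives at most the sum of the
    [c j * s j], to which the inequality of Cauchy and Schwarz applies. *)
Lemma weighted_bound n (c m s : 'I_n.+1 -> R) (a d : R) : 0 < a ->
  (forall j, 0 <= c j) -> (exists j, c j != 0) -> (forall j, 0 < m j) ->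
  (forall j, a * m j <= s j) ->
  \sum_j c j ^+ 2 * s j ^+ 2 <= (\sum_j c j * m j) ^+ 2 * d ->
  a / Num.sqrt n.+1%:R <= Num.sqrt d.
Proof.
move=> a0 c0 [j0 cj0] m0 ams h; set S := \sum_j c j * m j in h.
have S0 : 0 < S.
  rewrite /S (bigD1 j0) //= ltr_pwDl //.
    by rewrite mulr_gt0 // lt_neqAle eq_sym cj0 c0.
  by apply: sumr_ge0 => i _; rewrite mulr_ge0 // ltW.
have aS : (a * S) ^+ 2 <= n.+1%:R * (S ^+ 2 * d).
  apply: le_trans (_ : n.+1%:R * \sum_j (c j * s j) ^+ 2 <= _); last first.
    by rewrite ler_wpM2l //; apply: le_trans h; apply: ler_sum => j _; rewrite exprMn.
  apply: le_trans (sqr_sum_le _); rewrite ler_pXn2r ?nnegrE //.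
  - rewrite /S mulr_sumr; apply: ler_sum => j _; rewrite mulrCA.
    by rewrite ler_wpM2l.
  - by rewrite mulr_ge0 // ltW.
  - apply: sumr_ge0 => j _; rewrite mulr_ge0 // (le_trans _ (ams j)) //.
    by rewrite mulr_ge0 // ltW.
have n0 : 0 < n.+1%:R :> R by rewrite ltr0n.
have ad : a ^+ 2 <= n.+1%:R * d.
  rewrite -(ler_pM2r (exprn_gt0 2 S0)) -exprMn; apply: le_trans aS _.
  by rewrite [S ^+ 2 * d]mulrC mulrA.
rewrite ler_pdivrMr ?sqrtr_gt0 // -sqrtrM; last first.
  by rewrite -(pmulr_rge0 _ n0) (le_trans _ ad) // sqr_ge0.
by rewrite -[leLHS]ger0_norm ?(ltW a0) // -sqrtr_sqr ler_wsqrtr // [d * _]mulrC.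
Qed.

Lemma dotT_aer u v w : cmeas u -> cmeas v -> cmeas w -> aeT v w ->
  dotT u v = dotT u w.
Proof.
move=> mu1 mv mw vw; apply: integralT_ae; try exact: cmeasM mu1 (cmeas_conj _).
by apply: ae_mono vw => t ->.
Qed.

(** The adjoint is given by a choice operator: if its set of candidates were
    empty, the default value 0 would force [v] to vanish. *)
Lemma singular_vector_dotT f (s : R) v u : singular_vector f s v -> s != 0 ->
  bddT f -> H2 u -> dotT (hankel f u) (hankel f v) = (s ^+ 2)%:C * dotT u v.
Proof.
move=> [Hv v0 adj] s0 bf Hu; have [_ [M fM]] := bf.
have mh w : H2 w -> cmeas w by move=> /H2P[[]].
have sC : (s ^+ 2)%:C != 0 :> C.
  by rewrite -[0]/(0%:C) (inj_eq (@complexI R)) expf_neq0.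
move: adj; rewrite /adjoint; case: xgetP => [g _ [Hg gE]|_] adj; last first.
  exfalso; apply: v0; apply: ae_mono adj => t /esym/eqP.
  by rewrite mulf_eq0 (negbTE sC) => /eqP.
rewrite gE // (dotT_aer _ _ _ adj); [|exact: mh..|exact: cmeasM (cmeas_cst _) (mh _ Hv)].
have [lu lv] : L2T u /\ L2T v by split; [case/H2P: Hu|case/H2P: Hv].
by rewrite dotTZr // -[(_%:C)^*]/(conjc _) conjc_real.
Qed.

(** If the projection did not exist, the default value 0 of [hankel f v] would
    contradict its norm [s]. *)
Lemma hankel_singular f (s : R) v : singular_vector f s v -> s != 0 ->
  bddT f -> dotT v v = 1 -> is_proj f v (hankel f v).
Proof.
move=> sv s0 bf v1; have [Hv _ _] := sv.
have := singular_vector_dotT sv s0 bf Hv; rewrite v1 mulr1.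
rewrite /is_proj /hankel /Pminus /orth_proj; case: xgetP => [y _ [//]|_].
rewrite dotT_nsq nsq0 => /complexI/esym/eqP; rewrite expf_eq0 /=.
by rewrite (negbTE s0).
Qed.

Lemma Hinf_sup u : Hinf u -> exists m : R,
  [/\ normT +oo%E u = m%:E, 0 <= m & {ae mu, forall t, normc (u (expi t)) <= m}].
Proof.
move=> [[_ ulty] _]; exists (fine (normT +oo%E u)).
have u0 : (0 <= normT +oo%E u)%E by exact: Lnorm_ge0.
split; [by rewrite fineK // ge0_fin_numE|exact: fine_ge0|exact: normTy_ge].
Qed.

End RationalDistance.

Theorem theorem4 (R : realType) (f : R[i] -> R[i])
    (f_Hbar20 : Hbar20 f) (f_cont : continuousT f)
    (n : nat) (v : 'I_n.+1 -> R[i] -> R[i])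
    (v_orthonormal : orthonormal_family v)
    (v_singular : forall k : 'I_n.+1,
       singular_vector f (fine (singular_value f k)) (v k)) :
  (M_ f v / (Num.sqrt n.+1%:R)%:E <=
     distT 2%:E f (@ratfuns R (n%:Z - 1) n%:Z))%E.
Proof.
have mf : circle_measurable f by case: f_Hbar20 => -[].
have bf : bddT f := bddT_continuous mf f_cont.
have r0 : 0 < Num.sqrt (n.+1%:R : R) by rewrite sqrtr_gt0 ltr0n.
set s := fun k : 'I_n.+1 => fine (singular_value f k).
apply: le_ereal_inf_tmp => _ [g [P [Q [_ Qn Qroot ->]]] <-].
have norm_ge0 : (0 <= normT 2%:E (f \- (fun z => P.[z] / Q.[z]))%R)%E.
  exact: Lnorm_ge0.
have rE : ((Num.sqrt n.+1%:R)%:E^-1 = (Num.sqrt (n.+1%:R : R))^-1%:E)%E.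
  by rewrite inver gt_eqF.
rewrite rE.
have M_le0 : (M_ f v <= 0)%E ->
    (M_ f v * (Num.sqrt n.+1%:R)^-1%:E <=
      normT 2%:E (f \- (fun z => P.[z] / Q.[z]))%R)%E.
  move=> M0; apply: le_trans norm_ge0; rewrite lee_pdivrMr // mul0e //.
have [vinf|] := pselect (forall j, Hinf (v j)); last first.
  by move=> nv; apply: M_le0; rewrite /M_ ifF //; apply/asboolP.
have [m hm] := choice (fun j => Hinf_sup (vinf j)).
have m0 j : 0 < m j.
  have [_ mj0 vm] := hm j; rewrite lt_neqAle mj0 andbT eq_sym; apply/eqP => mj.
  have [_ v0 _] := v_singular j; apply: v0; apply: ae_mono vm => t.
  rewrite mj => h; apply/eqP; rewrite -normc_eq0; apply/eqP.
  by apply: le_anti; rewrite h normc_ge0.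
have M_le j : (M_ f v <= (s j / m j)%:E)%E.
  rewrite /M_ ifT; last exact/asboolP.
  apply: le_trans (bigmin_le _ j _) _; have [-> _ _] := hm j.
  rewrite inver gt_eqF // EFinM lee_pmul2r ?fin_numE //; last by rewrite lte_fin invr_gt0.
  exact: aak_distance.
(* A positive minimum forces every singular value to be positive, so that the
   choices made by [adjoint] and [hankel] are meaningful. *)
have [M0|M0] := leP (M_ f v) 0%E; first exact: M_le0.
have [a Ma] : exists a, M_ f v = a%:E.
  by move: M0 (M_le ord0); case: (M_ f v) => [a _ _| |//]; [exists a|].
rewrite Ma lte_fin in M0.
have am j : a * m j <= s j by have := M_le j; rewrite Ma lee_fin ler_pdivlMr.
have s0 j : s j != 0.
  by rewrite gt_eqF // (lt_le_trans _ (am j)) // mulr_gt0.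
have Hv j : H2 (v j) by case: (v_singular j).
have proj j : is_proj f (v j) (hankel f (v j)).
  apply: hankel_singular (v_singular j) (s0 j) bf _.
  by rewrite v_orthonormal eqxx.
have lf : L2T f := L2T_bdd bf.
have [c [j0 cj0] hc] : exists2 c : 'I_n.+1 -> R[i], (exists j, c j != 0) &
    \sum_j sqn (c j) * s j ^+ 2 <= (\sum_j normc (c j) * m j) ^+ 2 *
      nsq (fun z => f z - P.[z] / Q.[z]).
  apply: (rational_combination_bound (w := fun j => hankel f (v j))) => //.
  - by move=> j; case: (hm j).
  - by move=> j; case: (proj j).
  - by move=> j; case: (proj j).
  - move=> i j; rewrite (singular_vector_dotT (v_singular j)) //; last exact: s0.
    by rewrite v_orthonormal; case: (i == j); rewrite ?mulr1 ?mul1r ?mulr0 ?mul0r.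
  - by move: Qn; rewrite /polys /= -PoszD lez_nat addn1.
rewrite Ma normT2E; last exact: L2TB lf (L2T_bdd (bddT_rat _ Qroot)).
rewrite -EFinM lee_fin.
apply: (@weighted_bound _ _ (fun j => normc (c j)) m s) => //.
- by move=> j; exact: normc_ge0.
- by exists j0; rewrite normc_eq0.
by under eq_bigr do rewrite normc_sqr.
Qed.
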